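(* Let $m,n,d$ be positive integers and let $p$ be a positive multiple of $n$. Let $Q$ be a noncommutative multilinear polynomial of degree $d$ in $m$ variables with coefficients in $M_n(\mathbb{C})$ such that $\|Q(\sigma)\|\le1$ for all $\sigma\in\{-1,1\}^m$. Let $\tau:=\max_{i=1,\dots,m}\sum_{S\subseteq\{1,\dots,m\}:\, i\in S}\mathrm{Tr}(\widehat{Q}(S)\widehat{Q}(S)^* )$ be the maximum influence of $Q$, with $\tau>0$. Let $\mathcal{G}$ be a distribution on $M_n(\mathbb{C})$ such that $G\sim\mathcal{G}$ satisfies $\mathbb{E}G=0$ and $\mathbb{E}GG^*=I$, and let $c_2,c_3\ge1$ be such that $\|\mathbb{E}(GG^* )^2\|\le c_2$ and $\|\mathbb{E}(GG^* )^3\|\le c_3$. Then $$\mathbb{E}_{G_i\sim\mathcal{G}\otimes I,\;H_i\sim\mathcal{H}_p}\frac1n\mathrm{Tr}\Big(\max\big(0,|Q^{\iota}\{G_iH_i\}|-1\big)\Big)^2\le(8c_2c_3)^{9d}n^{1/2}\tau^{1/6}+O_{m,n}(\tau^{-1/3}p^{-1/2}).$$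
   Context: A noncommutative multilinear polynomial of degree $d$ in $m$ variables is an expression $Q(X_1,\dots,X_m)=\sum_{S\subseteq\{1,\dots,m\}:|S|\le d}\widehat{Q}(S)\prod_{i\in S}X_i$, where $\widehat{Q}(S)\in M_n(\mathbb{C})$, the $X_i$ are noncommuting $n\times n$ matrix variables, and products are taken in increasing order of the index; the degree is $\max\{|S|:\widehat Q(S)\ne0\}$. Scalars $\sigma_i$ are substituted as $\sigma_i I$, and $Q\{A_i\}$ denotes $Q(A_1,\dots,A_m)$. For $A\in M_n(\mathbb{C})$, $\iota(A)=\begin{pmatrix}A&0\\0&0\end{pmatrix}\in M_p(\mathbb{C})$, and $Q^{\iota}(X_1,\dots,X_m)=\sum_{S}\iota(\widehat{Q}(S))\prod_{i\in S}X_i$ for $p\times p$ matrix variables $X_i$. $|A|=(AA^* )^{1/2}$; $\|A\|$ is the operator norm; $\mathrm{Tr}$ is the unnormalized trace; the real function $t\mapsto(\max(0,t-1))^2$ is applied to the Hermitian matrix $|A|$ by spectral calculus. $G_i\sim\mathcal{G}\otimes I$: $G_i=G_i'\otimes I_{p/n}\in M_p(\mathbb{C})$ with $G_1',\dots,G_m'$ i.i.d. of distribution $\mathcal{G}$. $H_i\sim\mathcal{H}_p$: $H_1,\dots,H_m$ are independent $p\times p$ Haar-distributed random unitary matrices. All these random variables are independent. $a\le O_c(b)$ means that $a\le C(c)b$ for a constant $C(c)>0$ depending on $c$. *)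

(* Defs.v *)
From HB Require Import structures.
From mathcomp Require Import all_boot all_order all_algebra.
From mathcomp Require Import complex.
From mathcomp Require mxtens.
From mathcomp Require Import all_classical all_reals all_analysis.

Set Implicit Arguments.
Unset Strict Implicit.
Unset Printing Implicit Defensive.

Import Order.TTheory GRing.Theory Num.Theory.

Local Open Scope classical_set_scope.
Local Open Scope ring_scope.
Local Open Scope complex_scope.
Local Open Scope sesquilinear_scope.

Section matrices.
Context {R : realType}.

Definition l2norm (n : nat) (x : 'cV[R[i]]_n) : R :=
  Num.sqrt (\sum_(i < n) Normc.normc (x i ord0) ^+ 2).

Definition opnorm (n : nat) (A : 'M[R[i]]_n) : R :=
  sup [set l2norm (A *m x) | x in [set x : 'cV[R[i]]_n | l2norm x <= 1]].

Definition retr (n : nat) (A : 'M[R[i]]_n) : R := complex.Re (\tr A).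

(* Spectral calculus. By orthomx_spectralP, a normal A is equal to
   invmx (spectralmx A) *m diag_mx (spectral_diag A) *m spectralmx A, with
   spectralmx A unitary; the eigenvalues are real if A is Hermitian. *)
Definition spectral_calc (f : R -> R) (n : nat) (A : 'M[R[i]]_n) : 'M[R[i]]_n :=
  invmx (spectralmx A)
  *m diag_mx (map_mx (fun z : R[i] => (f (complex.Re z))%:C) (spectral_diag A))
  *m spectralmx A.

Definition absmx (n : nat) (A : 'M[R[i]]_n) : 'M[R[i]]_n :=
  spectral_calc Num.sqrt (A *m A ^t*).

(* (pid_mx n : 'M_(p, n)) is the identity on top of zeros when n <= p, so that
   iotamx p A has A as its upper left block and is zero elsewhere. *)
Definition iotamx (n p : nat) (A : 'M[R[i]]_n) : 'M[R[i]]_p :=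
  (pid_mx n : 'M[R[i]]_(p, n)) *m A *m (pid_mx n : 'M[R[i]]_(n, p)).

Definition ampliation (n k : nat) (A : 'M[R[i]]_n) : 'M[R[i]]_(n * k) :=
  mxtens.tensmx A (1%:M : 'M[R[i]]_k).

End matrices.

Section ncpoly.
Context {R : realType}.

Definition ncpoly (m n : nat) : Type := {ffun {set 'I_m} -> 'M[R[i]]_n}.

Definition ncdegree (m n : nat) (Q : ncpoly m n) : nat :=
  \max_(S : {set 'I_m} | Q S != 0) #|S|.

(* Big operators enumerate 'I_m in increasing order. *)
Definition nceval (m n : nat) (Q : ncpoly m n) (X : 'I_m -> 'M[R[i]]_n) :
    'M[R[i]]_n :=
  \sum_(S : {set 'I_m}) Q S *m \prod_(i < m | i \in S) X i.

Definition iotapoly (m n p : nat) (Q : ncpoly m n) : ncpoly m p :=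
  [ffun S => iotamx p (Q S)].

Definition max_influence (m n : nat) (Q : ncpoly m n) : R :=
  \big[Num.max/0]_(i < m)
    \sum_(S : {set 'I_m} | i \in S) retr (Q S *m (Q S) ^t*).

End ncpoly.

Arguments ncpoly : clear implicits.

(* M_n(C) as a measurable space: its Borel sigma-algebra, i.e. the one
   generated by the real and imaginary parts of the matrix entries. *)
Definition cmx (R : realType) (n : nat) : Type := 'M[R[i]]_n.

Definition cmx_cylinders (R : realType) (n : nat) : set (set (cmx R n)) :=
  [set A | exists (i j : 'I_n) (B : set R), measurable B /\
    (A = [set M : 'M[R[i]]_n | B (complex.Re (M i j))] \/
     A = [set M : 'M[R[i]]_n | B (complex.Im (M i j))])].

HB.instance Definition _ (R : realType) (n : nat) :=
  Choice.copy (cmx R n) 'M[R[i]]_n.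
HB.instance Definition _ (R : realType) (n : nat) :=
  isPointed.Build (cmx R n) (0 : 'M[R[i]]_n).
HB.instance Definition _ (R : realType) (n : nat) :=
  @isMeasurable.Build (sigma_display (@cmx_cylinders R n)) (cmx R n)
    <<s @cmx_cylinders R n >> (@sigma_algebra0 _ setT (@cmx_cylinders R n))
    (@sigma_algebraC _ (@cmx_cylinders R n))
    (@sigma_algebra_bigcup _ setT (@cmx_cylinders R n)).

Section random_matrices.
Context {R : realType} {disp : measure_display} {T : measurableType disp}.

Definition mx_integrable (P : probability T R) (n : nat)
    (F : T -> 'M[R[i]]_n) : Prop :=
  forall i j : 'I_n,
    P.-integrable setT (fun w => (complex.Re (F w i j))%:E) /\
    P.-integrable setT (fun w => (complex.Im (F w i j))%:E).

Definition mx_expectation (P : probability T R) (n : nat)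
    (F : T -> 'M[R[i]]_n) : 'M[R[i]]_n :=
  \matrix_(i, j)
    (fine 'E_P[fun w => complex.Re (F w i j)]%E
     +i* fine 'E_P[fun w => complex.Im (F w i j)]%E).

Definition rv_events (n : nat) (X : T -> cmx R n) : set (set T) :=
  preimage_set_system setT X measurable.

Definition mutually_independent (P : probability T R) (I : finType)
    (F : I -> set (set T)) : Prop :=
  forall (J : {set I}) (E : I -> set T),
    (forall i, i \in J -> F i (E i)) ->
    P (\bigcap_(i in [set i | i \in J]) E i) = (\prod_(i in J) P (E i))%E.

End random_matrices.

Definition haar_unitary (R : realType) (p : nat) (nu : set (cmx R p) -> \bar R) :
    Prop :=
  nu [set U : cmx R p | (U : 'M[R[i]]_p) \is unitarymx] = 1%E /\
  forall (U : 'M[R[i]]_p) (A : set (cmx R p)),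
    U \is unitarymx -> measurable A ->
    nu [set M : cmx R p | A (U *m M)] = nu A /\
    nu [set M : cmx R p | A ((M : 'M[R[i]]_p) *m U)] = nu A.

(* Main.v *)
Require Import Defs.
From HB Require Import structures.
From mathcomp Require Import all_boot all_order all_algebra.
From mathcomp Require Import complex.
From mathcomp Require mxtens.
From mathcomp Require Import ring lra.
From mathcomp Require Import all_classical all_reals all_analysis.
From mathcomp Require Import measurable_realfun.

Set Implicit Arguments.
Unset Strict Implicit.
Unset Printing Implicit Defensive.

Import Order.TTheory GRing.Theory Num.Theory.

Local Open Scope classical_set_scope.
Local Open Scope ring_scope.
Local Open Scope complex_scope.
Local Open Scope sesquilinear_scope.

(** Write X_i = (G_i (x) I) H_i and let q be the n x p matrix formed by the first
    n rows of Q^iota(X), so that q q^* = sum_(S, S') Q_S Z_(S, S') Q_S'^* where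
    Z_(S, S') is the upper left n x n corner of X_S X_S'^*.  Integrating the Haar
    unitaries one at a time, from the last factor inwards, shows that
    Z_(S, S') is within O(p^(-1/2)) in L^2 of zero if S <> S', and of the scalar
    y_S = (G_i G_i^* )_00 * prod_(j in S, j > i) tr_n (G_j G_j^* ), i = min S, if S = S'.
    Hence q q^* is close to sum_S y_S Q_S Q_S^*, whose mean is the average of
    Q(sigma) Q(sigma)^* over the signs and is therefore at most I, and whose variance
    is at most c_2^d d tau n because y_S and y_S' are uncorrelated when S and S'
    are disjoint.  It remains to use
    max(0, t - 1)^2 <= min(t^2, (max(0, t^2 - 1) / 2)^2), which bounds the trace by
    a quarter of the squared distance from q q^* to any matrix below I (used if
    tau <= 1) and by the trace of q q^* (used if tau > 1).  The powers of c_2 in the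
    error terms are absorbed by the right-hand side through an arithmetic-geometric
    mean argument. *)

(** * Frobenius norm *)

(** The index 00 in y_S comes from the layout of [iotamx]. For n <= k the first n basis vectors of
    C^n (x) C^k are e_0 (x) e_c with distinct c, so the upper left n x n corner of A (x) I is A_00
    times the identity; for n > k one has p < n^2, and a trivial bound is already of order 1/p.
    Every later factor is seen through a full Haar conjugate h D h^*, which is close to the
    normalized trace of D. The Haar estimates are second moments only, and follow from unitarity and
    from the transitivity of the unitary group on orthonormal frames.

    The obstacle at the end is the order of the quantifiers: the constant of the error term may
    depend on m and n but not on the law of G, while the errors carry c_2^(2d). This power is traded
    against (8 c_2 c_3)^(9d) tau^(1/6), and the factor tau^(-1/3) of the error term is what pays for
    the trade.

    The matrices live on an arbitrary probability space, not on a product. Tonelli is reached by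
    pairing one matrix with the sigma-algebra generated by all the others. *)

Section frobenius.
Context {R : realType}.
Implicit Types z w : R[i].

Definition sqn z : R := complex.Re z ^+ 2 + complex.Im z ^+ 2.

Lemma sqn_ge0 z : 0 <= sqn z.
Proof. by rewrite addr_ge0 ?sqr_ge0. Qed.

Lemma sqn0 : sqn 0 = 0.
Proof. by rewrite /sqn /= expr0n addr0. Qed.

Lemma sqn1 : sqn 1 = 1.
Proof. by rewrite /sqn /= expr0n addr0 expr1n. Qed.

Lemma sqnM z w : sqn (z * w) = sqn z * sqn w.
Proof. by case: z => a b; case: w => c e; rewrite /sqn /=; ring. Qed.

Lemma sqnC z : sqn z^* = sqn z.
Proof. by case: z => a b; rewrite /sqn /= sqrrN. Qed.

Lemma sqnN z : sqn (- z) = sqn z.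
Proof. by case: z => a b; rewrite /sqn /= !sqrrN. Qed.

Lemma sqnR (x : R) : sqn x%:C = x ^+ 2.
Proof. by rewrite /sqn /= expr0n addr0. Qed.

Lemma sqnD_le z w : sqn (z + w) <= 2 * sqn z + 2 * sqn w.
Proof.
case: z => a b; case: w => c e; rewrite /sqn /=.
rewrite -subr_ge0 [X in 0 <= X](_ : _ = (a - c) ^+ 2 + (b - e) ^+ 2).
  by rewrite addr_ge0 ?sqr_ge0.
by ring.
Qed.

Lemma mulCJ z : z * z^* = (sqn z)%:C.
Proof.
case: z => a b; rewrite /sqn; apply/eqP; rewrite eq_complex /=.
by apply/andP; split; apply/eqP; ring.
Qed.

Lemma ReD z w : complex.Re (z + w) = complex.Re z + complex.Re w.
Proof. by case: z => a b; case: w => c e. Qed.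

Lemma ImD z w : complex.Im (z + w) = complex.Im z + complex.Im w.
Proof. by case: z => a b; case: w => c e. Qed.

Lemma Re_sum I (r : seq I) (Q : pred I) (F : I -> R[i]) :
  complex.Re (\sum_(i <- r | Q i) F i) = \sum_(i <- r | Q i) complex.Re (F i).
Proof. by elim/big_rec2: _ => //= i x y _ <-; rewrite ReD. Qed.

Lemma Re_sqr_le z : complex.Re z ^+ 2 <= sqn z.
Proof. by rewrite lerDl sqr_ge0. Qed.

(** Induction on the list: the cross term [2 * c] is at most [a * Q + P * b], because [c ^+ 2] is at
    most the product of these two summands. *)
Lemma cauchy_schwarz_sqn I (r : seq I) (F G : I -> R[i]) :
  sqn (\sum_(i <- r) F i * G i) <=
  (\sum_(i <- r) sqn (F i)) * (\sum_(i <- r) sqn (G i)).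
Proof.
elim: r => [|i r IH]; first by rewrite !big_nil sqn0 mul0r.
rewrite !big_cons; set s := \sum_(j <- r) _ in IH *.
set P := \sum_(j <- r) _ in IH *; set Q := \sum_(j <- r) _ in IH *.
have P0 : 0 <= P by apply: sumr_ge0 => *; exact: sqn_ge0.
have Q0 : 0 <= Q by apply: sumr_ge0 => *; exact: sqn_ge0.
set x := F i * G i; have xE : sqn x = sqn (F i) * sqn (G i) by rewrite /x sqnM.
set a := sqn (F i) in xE *; set b := sqn (G i) in xE *.
have a0 : 0 <= a := sqn_ge0 _; have b0 : 0 <= b := sqn_ge0 _.
have -> : sqn (x + s) = sqn x + sqn s +
    2 * (complex.Re x * complex.Re s + complex.Im x * complex.Im s).
  by case: (x) => ? ?; case: (s) => ? ?; rewrite /sqn /=; ring.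
set c := _ * _ + _ * _.
have cle : c ^+ 2 <= (a * Q) * (P * b).
  apply: (@le_trans _ _ (sqn x * sqn s)).
    (* Lagrange's identity: the difference of the two sides is a square. *)
    rewrite -subr_ge0 /c /sqn [X in 0 <= X](_ : _ = (complex.Re x * complex.Im s -
      complex.Im x * complex.Re s) ^+ 2) ?sqr_ge0//; by ring.
  have -> : a * Q * (P * b) = (a * b) * (P * Q) by ring.
  by rewrite xE ler_wpM2l// mulr_ge0.
have aQ0 : 0 <= a * Q by rewrite mulr_ge0.
have Pb0 : 0 <= P * b by rewrite mulr_ge0.
suff : 2 * c <= a * Q + P * b by rewrite xE mulrDl !mulrDr => h; lra.
rewrite -(ler_pM2l (_ : 0 < 1)) //; apply: le_trans (ler_norm _) _.
rewrite -(@ler_pXn2r _ 2) ?nnegrE ?mul1r ?addr_ge0 ?normr_ge0//.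
rewrite real_normK ?num_real// exprMn.
have := sqr_ge0 (a * Q - P * b); lra.
Qed.

(** The square of the Frobenius norm. Squares keep the integrands polynomial in the entries, at the
    price of a factor 2 in the triangle inequality [froD_le]. *)
Definition fro a b (A : 'M[R[i]]_(a, b)) : R := \sum_i \sum_j sqn (A i j).

Lemma fro_ge0 a b (A : 'M[R[i]]_(a, b)) : 0 <= fro A.
Proof. by apply: sumr_ge0 => *; apply: sumr_ge0 => *; exact: sqn_ge0. Qed.

Lemma fro_trmxC a b (A : 'M[R[i]]_(a, b)) : fro (A^t*) = fro A.
Proof.
rewrite /fro exchange_big; apply: eq_bigr => i _; apply: eq_bigr => j _.
by rewrite !mxE sqnC.
Qed.

Lemma fro0 a b : fro (0 : 'M[R[i]]_(a, b)) = 0.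
Proof. by rewrite /fro !big1// => *; rewrite big1// => *; rewrite mxE sqn0. Qed.

Lemma fro_scalar1 a : fro (1%:M : 'M[R[i]]_a) = a%:R.
Proof.
rewrite /fro (eq_bigr (fun=> 1)) ?sumr_const ?card_ord// => i _.
rewrite (bigD1 i)//= mxE eqxx sqn1 big1 ?addr0// => j ji.
by rewrite mxE eq_sym (negbTE ji) sqn0.
Qed.

Lemma fro_mxtrace a b (A : 'M[R[i]]_(a, b)) : \tr (A *m A^t*) = (fro A)%:C.
Proof.
rewrite /fro rmorph_sum; apply: eq_bigr => i _.
by rewrite mxE rmorph_sum; apply: eq_bigr => j _; rewrite !mxE mulCJ.
Qed.

Lemma retr_fro a (A : 'M[R[i]]_a) : retr (A *m A^t*) = fro A.
Proof. by rewrite /retr fro_mxtrace. Qed.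

Lemma trmxC_mul a b c (A : 'M[R[i]]_(a, b)) (B : 'M[R[i]]_(b, c)) :
  (A *m B)^t* = B^t* *m A^t*.
Proof. by rewrite trmx_mul map_mxM. Qed.

Lemma trmxCD a b (A B : 'M[R[i]]_(a, b)) : (A + B)^t* = A^t* + B^t*.
Proof. by rewrite linearD map_mxD. Qed.

Lemma trmxCN a b (A : 'M[R[i]]_(a, b)) : (- A)^t* = - A^t*.
Proof. by rewrite linearN map_mxN. Qed.

Lemma trmxCZ a b x (A : 'M[R[i]]_(a, b)) : (x *: A)^t* = x^* *: A^t*.
Proof. by rewrite linearZ map_mxZ. Qed.

Lemma trmxC_sum a b I (r : seq I) (Q : pred I) (F : I -> 'M[R[i]]_(a, b)) :
  (\sum_(i <- r | Q i) F i)^t* = \sum_(i <- r | Q i) (F i)^t*.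
Proof. by rewrite linear_sum map_mx_sum. Qed.

Lemma fro_mulmx_unitary a b (A : 'M[R[i]]_(a, b)) (U : 'M[R[i]]_b) :
  U \is unitarymx -> fro (A *m U) = fro A.
Proof.
move=> /unitarymxP UU; apply: (@complexI R).
by rewrite -!fro_mxtrace trmxC_mul mulmxA -(mulmxA A) UU mulmx1.
Qed.

Lemma fro_unitary_mulmx a b (A : 'M[R[i]]_(a, b)) (U : 'M[R[i]]_a) :
  U \is unitarymx -> fro (U *m A) = fro A.
Proof.
by move=> UU; rewrite -fro_trmxC trmxC_mul fro_mulmx_unitary ?trmxC_unitary// fro_trmxC.
Qed.

Lemma fro_mulmx_le a b c (A : 'M[R[i]]_(a, b)) (B : 'M[R[i]]_(b, c)) :
  fro (A *m B) <= fro A * fro B.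
Proof.
rewrite /fro [X in _ <= _ * X]exchange_big mulr_suml; apply: ler_sum => i _.
rewrite mulr_sumr; apply: ler_sum => j _; rewrite mxE.
exact: cauchy_schwarz_sqn.
Qed.

Lemma froZ a b x (A : 'M[R[i]]_(a, b)) : fro (x *: A) = sqn x * fro A.
Proof.
rewrite /fro mulr_sumr; apply: eq_bigr => i _; rewrite mulr_sumr.
by apply: eq_bigr => j _; rewrite mxE sqnM.
Qed.

Lemma froN a b (A : 'M[R[i]]_(a, b)) : fro (- A) = fro A.
Proof. by apply: eq_bigr => i _; apply: eq_bigr => j _; rewrite mxE sqnN. Qed.

Lemma froD_le a b (A B : 'M[R[i]]_(a, b)) : fro (A + B) <= 2 * fro A + 2 * fro B.
Proof.
rewrite /fro !mulr_sumr -big_split; apply: ler_sum => i _.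
rewrite !mulr_sumr -big_split; apply: ler_sum => j _; rewrite mxE; exact: sqnD_le.
Qed.

Lemma sqn_sum_le (I : finType) (F : I -> R[i]) :
  sqn (\sum_i F i) <= #|I|%:R * \sum_i sqn (F i).
Proof.
have := cauchy_schwarz_sqn (index_enum I) (fun=> 1) F.
under eq_bigr do rewrite mul1r.
by under [X in _ <= X * _]eq_bigr do rewrite sqn1; rewrite sumr_const.
Qed.

Lemma fro_sum_le a b (I : finType) (F : I -> 'M[R[i]]_(a, b)) :
  fro (\sum_i F i) <= #|I|%:R * \sum_i fro (F i).
Proof.
rewrite /fro [X in _ <= _ * X]exchange_big /= mulr_sumr; apply: ler_sum => x _.
rewrite [X in _ <= _ * X]exchange_big /= mulr_sumr; apply: ler_sum => y _.
by rewrite summxE; apply: sqn_sum_le.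
Qed.

Lemma sqn_le_fro a b (A : 'M[R[i]]_(a, b)) i j : sqn (A i j) <= fro A.
Proof.
rewrite /fro (bigD1 i)//= (bigD1 j)//= -addrA lerDl addr_ge0//.
  by apply: sumr_ge0 => *; exact: sqn_ge0.
by apply: sumr_ge0 => *; apply: sumr_ge0 => *; exact: sqn_ge0.
Qed.

Lemma sqn_eq0 z : sqn z = 0 -> z = 0.
Proof.
case: z => x y /eqP; rewrite /sqn /= paddr_eq0 ?sqr_ge0// !sqrf_eq0.
by move=> /andP[/eqP -> /eqP ->].
Qed.

Lemma fro_eq0 a b (A : 'M[R[i]]_(a, b)) : fro A = 0 -> A = 0.
Proof.
move=> A0; apply/matrixP => i j; rewrite mxE; apply: sqn_eq0; apply/eqP.
by rewrite eq_le sqn_ge0 andbT -A0 sqn_le_fro.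
Qed.

Lemma fro11 (A : 'M[R[i]]_1) : fro A = sqn (A 0 0).
Proof. by rewrite /fro !big_ord1. Qed.

Lemma fro_row a b (A : 'M[R[i]]_(a, b)) : fro A = \sum_i fro (row i A).
Proof.
apply: eq_bigr => i _; rewrite /fro big_ord1; apply: eq_bigr => j _.
by rewrite mxE.
Qed.

Lemma mxtrace_sqn_le a (A : 'M[R[i]]_a) : sqn (\tr A) <= a%:R * fro A.
Proof.
apply: le_trans (sqn_sum_le _) _; rewrite card_ord ler_wpM2l//.
apply: ler_sum => i _; rewrite (bigD1 i)//= lerDl.
by apply: sumr_ge0 => *; exact: sqn_ge0.
Qed.

Lemma fro_scalar_mx a (x : R[i]) : fro (x%:M : 'M[R[i]]_a) = a%:R * sqn x.
Proof. by rewrite -scalemx1 froZ fro_scalar1 mulrC. Qed.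

Lemma sqn_inv_nat (a : nat) : sqn ((a%:R)^-1 : R[i]) = a%:R^-1 ^+ 2.
Proof. by rewrite -sqnR fmorphV rmorph_nat. Qed.

(** Both terms of the difference have [fro] at most [fro A], the scalar one by Cauchy-Schwarz on the
    diagonal; 4 is the loss in [froD_le]. *)
Lemma fro_traceless_le a (A : 'M[R[i]]_a) :
  fro (A - (\tr A / a%:R)%:M) <= 4 * fro A.
Proof.
apply: le_trans (froD_le _ _) _; rewrite froN fro_scalar_mx sqnM.
suff : a%:R * (sqn (\tr A) * sqn (a%:R^-1 : R[i])) <= fro A by lra.
case: a A => [|a] A; first by rewrite mul0r fro_ge0.
rewrite sqn_inv_nat mulrA mulrAC -[leLHS]mulrA mulrA.
have a0 : 0 < a.+1%:R :> R by rewrite ltr0n.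
rewrite expr2 [X in X * _]mulrA divff ?gt_eqF// mul1r mulrC ler_pdivrMr// mulrC.
exact: mxtrace_sqn_le.
Qed.

End frobenius.

(** * Spectral bounds for the truncation *)

Section spectral.
Context {R : realType}.

(** For a rectangular matrix [unitarymx] means orthonormal rows. They are completed by a
    Gram-Schmidt basis of the orthogonal complement of the row space. *)
Lemma unitary_extension r p (V : 'M[R[i]]_(r, p)) : V \is unitarymx ->
  exists2 U : 'M[R[i]]_p, U \is unitarymx & pid_mx r *m U = V.
Proof.
move=> Vu; have rV := mxrank_unitary Vu.
have [q [e [B [Bu BV]]]] : exists (q : nat) (e : (r + q)%N = p)
    (B : 'M[R[i]]_(q, p)), B \is unitarymx /\ B *m V^t* = 0.
  pose Vo := orthomx Num.conj (mx_of_hermitian (hermitian1mx p)) V.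
  exists (\rank Vo); exists; first by rewrite -[in LHS]rV add_rank_ortho.
  exists (schmidt (row_base Vo)); split.
    by rewrite schmidt_unitarymx// rank_leq_col.
  apply/orthomx1P; rewrite eqmx_schmidt_free ?row_base_free//.
  by rewrite eq_row_base.
case: p / e V Vu rV B Bu BV => V Vu _ B Bu BV.
exists (col_mx V B); last by rewrite pid_mx_row mul_row_col mul1mx mul0mx addr0.
apply/unitarymxP; rewrite tr_col_mx map_row_mx mul_col_row.
rewrite !(unitarymxP _)// BV (_ : V *m _ = 0) ?scalar_mx_block//.
by rewrite -[LHS]trmxCK trmx_mul map_mxM trmxCK BV trmx0 map_mx0.
Qed.

Lemma unitary_trmxC p (U : 'M[R[i]]_p) : U \is unitarymx -> U^t* \is unitarymx.
Proof. by move=> Uu; rewrite (trmxC_unitary U). Qed.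

(** Transitivity of the unitary group on orthonormal r-frames: this is how Haar invariance is
    exploited, with r = 1 for entries and r = 2 for conjugates. *)
Lemma unitary_transport r p (E V : 'M[R[i]]_(r, p)) :
  E \is unitarymx -> V \is unitarymx ->
  exists2 U : 'M[R[i]]_p, U \is unitarymx & E *m U = V.
Proof.
move=> /unitary_extension[UE UEu <-] /unitary_extension[UV UVu <-].
have UEu' := unitary_trmxC UEu.
exists (UE^t* *m UV); first exact: (mul_unitarymx UEu' UVu).
by rewrite mulmxA -(mulmxA _ UE) (unitarymxP UEu) mulmx1.
Qed.

Lemma mxdiag_fro a b (A : 'M[R[i]]_(a, b)) i :
  (A *m A^t*) i i = (fro (row i A))%:C.
Proof.
rewrite mxE /fro big_ord1 rmorph_sum; apply: eq_bigr => j _.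
by rewrite !mxE mulCJ.
Qed.

Lemma herm_normal a (A : 'M[R[i]]_a) : A^t* = A -> A \is normalmx.
Proof. by move=> e; apply/normalmxP; rewrite e. Qed.

Lemma spectral_decomp a (A : 'M[R[i]]_a) : A^t* = A ->
  spectralmx A *m A *m (spectralmx A)^t* = diag_mx (spectral_diag A).
Proof.
move=> /herm_normal /orthomx_spectralP e.
have u := spectral_unitarymx A.
rewrite [X in _ *m X *m _]e invmx_unitary// !mulmxA.
by rewrite (unitarymxP u) mul1mx -mulmxA (unitarymxP u) mulmx1.
Qed.

(** The eigenvalues are the squared norms of the rows of [U *m A], hence real and nonnegative, so
    that [Num.sqrt] of their real parts is a true square root. *)
Lemma sqrtmx_spectral p (A U : 'M[R[i]]_p) (lam : 'rV[R[i]]_p) :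
  U \is unitarymx -> U *m (A *m A^t*) *m U^t* = diag_mx lam ->
  exists s : 'I_p -> R, [/\ forall i, 0 <= s i,
    diag_mx (map_mx (fun z : R[i] => (Num.sqrt (complex.Re z))%:C) lam) =
      diag_mx (\row_i (s i)%:C) &
    diag_mx lam = diag_mx (\row_i (s i ^+ 2)%:C)].
Proof.
move=> Uu lamE.
have lamR i : lam 0 i = (fro (row i (U *m A)))%:C.
  have /matrixP/(_ i i) := lamE.
  rewrite [RHS]mxE eqxx mulr1n => <-.
  by rewrite -mxdiag_fro trmxC_mul !mulmxA.
exists (fun i => Num.sqrt (fro (row i (U *m A)))); split.
- by move=> i; exact: sqrtr_ge0.
- by congr diag_mx; apply/rowP => i; rewrite !mxE lamR.
- by congr diag_mx; apply/rowP => i; rewrite !mxE lamR sqr_sqrtr ?fro_ge0.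
Qed.

Lemma unitary_adjK p (U : 'M[R[i]]_p) : U \is unitarymx -> U^t* *m U = 1%:M.
Proof. by rewrite -trmxC_unitary => /unitarymxP; rewrite trmxCK. Qed.

Lemma mulmx_conj (F : comNzRingType) p (U V D E : 'M[F]_p) : U *m V = 1%:M ->
  (V *m D *m U) *m (V *m E *m U) = V *m (D *m E) *m U.
Proof. by move=> UV; rewrite !mulmxA -(mulmxA _ U) UV mulmx1. Qed.

Lemma mulmx_conjK (F : comNzRingType) p (U V D : 'M[F]_p) : U *m V = 1%:M ->
  U *m (V *m D *m U) *m V = D.
Proof. by move=> UV; rewrite !mulmxA UV mul1mx -mulmxA UV mulmx1. Qed.

Lemma absmx_herm p (A : 'M[R[i]]_p) : exists (U : 'M[R[i]]_p) (s : 'I_p -> R),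
  [/\ U \is unitarymx, forall i, 0 <= s i,
   absmx A = U^t* *m diag_mx (\row_i (s i)%:C) *m U &
   A *m A^t* = absmx A *m absmx A].
Proof.
have Mh : (A *m A^t*)^t* = A *m A^t* by rewrite trmxC_mul trmxCK.
have := spectral_decomp Mh; have := spectral_unitarymx (A *m A^t*).
rewrite /absmx /spectral_calc.
move: (spectralmx _) (spectral_diag _) => U lam Uu lamE.
have [s [s0 -> lamS]] := sqrtmx_spectral Uu lamE.
rewrite invmx_unitary//; exists U, s; split => //.
have e : diag_mx (\row_i (s i)%:C) *m diag_mx (\row_i (s i)%:C) = diag_mx lam.
  rewrite lamS mulmx_diag; apply: (congr1 diag_mx); apply/rowP => i.
  by rewrite !mxE -rmorphM expr2.
move: lamE; rewrite mulmx_conj; last exact/unitarymxP.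
rewrite e; move: (diag_mx lam) (A *m A^t*) => D M <-.
by rewrite mulmx_conjK// unitary_adjK.
Qed.

(** [spectral_calc f (absmx A)] diagonalizes [absmx A] afresh, in a basis [V] unrelated to the one
    used to build [absmx A]. Reality and sign of the eigenvalues must therefore be derived again in
    the basis [V]. *)
Lemma absmx_spectral p (A : 'M[R[i]]_p) : exists (V : 'M[R[i]]_p) (mu : 'I_p -> R),
  [/\ V \is unitarymx, forall i, 0 <= mu i,
   forall i, (V *m (A *m A^t*) *m V^t*) i i = (mu i ^+ 2)%:C &
   forall f, retr (spectral_calc f (absmx A)) = \sum_i f (mu i)].
Proof.
have [U [s [Uu s0 BE ->]]] := absmx_herm A.
move: (absmx A) BE => B BE.
have Bh : B^t* = B.
  rewrite BE !trmxC_mul trmxCK mulmxA tr_diag_mx map_diag_mx.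
  apply: (congr1 (fun X => _ *m diag_mx X *m _)); apply/rowP => i; rewrite !mxE.
  exact: conjc_real.
rewrite /spectral_calc; have := spectral_decomp Bh; have := spectral_unitarymx B.
move: (spectralmx _) (spectral_diag _) => V lam Vu lamE.
(* Each new eigenvalue is a combination of the old ones with weights [sqn _], hence real and
   nonnegative. *)
have lamR i : lam 0 i = (\sum_j sqn ((V *m U^t*) i j) * s j)%:C.
  have /matrixP/(_ i i) := lamE; rewrite [RHS]mxE eqxx mulr1n => <-.
  have -> : V *m B *m V^t* = (V *m U^t*) *m diag_mx (\row_i (s i)%:C) *m (V *m U^t*)^t*.
    by rewrite BE trmxC_mul trmxCK !mulmxA.
  rewrite mxE rmorph_sum; apply: eq_bigr => j _.
  rewrite mul_mx_diag !mxE; set x := \sum_(_ < _) _.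
  by rewrite mulrAC mulCJ; exact/esym/rmorphM.
exists V, (fun i => complex.Re (lam 0 i)); split => //.
- move=> i; rewrite lamR /=; apply: sumr_ge0 => j _.
  by rewrite mulr_ge0 ?sqn_ge0.
- move=> i.
  have -> : V *m (B *m B) *m V^t* = (V *m B *m V^t*) *m (V *m B *m V^t*).
    by rewrite mulmx_conj// unitary_adjK.
  by rewrite lamE mulmx_diag !mxE eqxx mulr1n lamR -rmorphM expr2.
- move=> f; rewrite /retr -mulmxA mxtrace_mulC invmx_unitary//.
  rewrite -mulmxA (unitarymxP Vu) mulmx1 Re_sum.
  by apply: eq_bigr => i _; rewrite !mxE eqxx.
Qed.

Definition trunc (t : R) : R := Num.max 0 (t - 1) ^+ 2.

Lemma retr_trunc_ge0 p (A : 'M[R[i]]_p) : 0 <= retr (spectral_calc trunc (absmx A)).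
Proof.
have [V [mu [_ _ _ ->]]] := absmx_spectral A.
by apply: sumr_ge0 => i _; exact: sqr_ge0.
Qed.

Lemma retr_trunc_le_fro p (A : 'M[R[i]]_p) :
  retr (spectral_calc trunc (absmx A)) <= fro A.
Proof.
have [V [mu [Vu mu0 muE ->]]] := absmx_spectral A.
rewrite -(fro_unitary_mulmx _ Vu) fro_row; apply: ler_sum => i _.
have : (fro (row i (V *m A)))%:C = (mu i ^+ 2)%:C.
  by rewrite -mxdiag_fro -muE trmxC_mul !mulmxA.
move=> /complexI ->; rewrite /trunc ler_pXn2r ?nnegrE ?le_max ?lexx//.
by rewrite ge_max mu0 /= lerBlDr lerDl.
Qed.

(** In the eigenbasis of |A| the i-th diagonal entry of A A^* - Y has real part at least mu_i^2 - 1,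
    as Y lies below I. If mu_i > 1 then (mu_i^2 - 1)^2 = (mu_i - 1)^2 (mu_i + 1)^2 >= 4 (mu_i -
    1)^2. Only diagonal entries are kept, so Y need not commute with A A^*. *)
Lemma retr_trunc_le_dist p (A Y : 'M[R[i]]_p) :
  (forall v : 'rV[R[i]]_p, complex.Re ((v *m Y *m v^t*) 0 0) <= fro v) ->
  retr (spectral_calc trunc (absmx A)) <= 4^-1 * fro (A *m A^t* - Y).
Proof.
move=> Y1; have [V [mu [Vu mu0 muE ->]]] := absmx_spectral A.
rewrite -(fro_unitary_mulmx _ Vu) -(@fro_mulmx_unitary _ _ _ _ (V^t*)) ?trmxC_unitary//.
set M := _ *m _ *m V^t*; rewrite mulr_sumr; apply: ler_sum => i _.
apply: (@le_trans _ _ (4^-1 * sqn (M i i))); last first.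
  by rewrite ler_pM2l// (bigD1 i)//= lerDl sumr_ge0// => *; exact: sqn_ge0.
apply: (@le_trans _ _ (4^-1 * complex.Re (M i i) ^+ 2)); last first.
  by rewrite ler_pM2l// Re_sqr_le.
have MR : mu i ^+ 2 - 1 <= complex.Re (M i i).
  have -> : M i i = (V *m (A *m A^t*) *m V^t*) i i - (V *m Y *m V^t*) i i.
    by rewrite /M mulmxBr mulmxBl [LHS]mxE; congr (_ + _); rewrite [LHS]mxE.
  rewrite muE ReD /= lerD2l.
  have -> : complex.Re (- (V *m Y *m V^t*) i i) = - complex.Re ((V *m Y *m V^t*) i i).
    by case: (_ i i).
  rewrite lerN2.
  have -> : (V *m Y *m V^t*) i i = (row i V *m Y *m (row i V)^t*) 0 0.
    by rewrite -row_mul !mxE; apply: eq_bigr => j _; rewrite !mxE.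
  apply: le_trans (Y1 _) _.
  have /matrixP/(_ i i) := unitarymxP Vu; rewrite mxdiag_fro mxE eqxx.
  by move=> /(@complexI R) ->.
rewrite /trunc; have [h|h] := leP (mu i) 1.
  rewrite (max_l _) ?subr_le0// expr0n/= mulr_ge0// sqr_ge0//.
rewrite max_r; last by rewrite subr_ge0 ltW.
have h2 : 0 <= mu i ^+ 2 - 1 by rewrite subr_ge0 exprn_ege1// ltW.
have h3 : (mu i ^+ 2 - 1) ^+ 2 <= complex.Re (M i i) ^+ 2.
  by rewrite ler_pXn2r ?nnegrE// (le_trans h2).
apply: (@le_trans _ _ (4^-1 * (mu i ^+ 2 - 1) ^+ 2)); last by rewrite ler_pM2l.
rewrite (_ : (mu i ^+ 2 - 1) ^+ 2 = (mu i - 1) ^+ 2 * (mu i + 1) ^+ 2); last by ring.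
rewrite mulrCA ler_peMr ?sqr_ge0//.
have : 2 ^+ 2 <= (mu i + 1) ^+ 2 by rewrite ler_pXn2r ?nnegrE//; lra.
lra.
Qed.

End spectral.

(** * Measurability and integrals *)

Section measurability.
Context {R : realType} {d : measure_display} {T : measurableType d}.

Definition cmeas (f : T -> R[i]) : Prop :=
  measurable_fun setT (fun w => complex.Re (f w)) /\
  measurable_fun setT (fun w => complex.Im (f w)).

Definition mxmeas a b (F : T -> 'M[R[i]]_(a, b)) : Prop :=
  forall i j, cmeas (fun w => F w i j).

Lemma cmeas_cst z : cmeas (fun=> z).
Proof. by split; exact: measurable_cst. Qed.

Lemma cmeasD f g : cmeas f -> cmeas g -> cmeas (fun w => f w + g w).
Proof.
move=> [f1 f2] [g1 g2]; split.
  by under eq_fun do rewrite ReD; exact: measurable_funD.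
by under eq_fun do rewrite ImD; exact: measurable_funD.
Qed.

Lemma cmeasM f g : cmeas f -> cmeas g -> cmeas (fun w => f w * g w).
Proof.
move=> [f1 f2] [g1 g2].
have ReM (x y : R[i]) : complex.Re (x * y) =
    complex.Re x * complex.Re y - complex.Im x * complex.Im y.
  by case: x => ? ?; case: y.
have ImM (x y : R[i]) : complex.Im (x * y) =
    complex.Re x * complex.Im y + complex.Im x * complex.Re y.
  by case: x => ? ?; case: y.
split.
  under eq_fun do rewrite ReM.
  by apply: measurable_funB; exact: measurable_funM.
under eq_fun do rewrite ImM.
by apply: measurable_funD; exact: measurable_funM.
Qed.

Lemma cmeasJ f : cmeas f -> cmeas (fun w => (f w)^*).
Proof.
move=> [f1 f2]; split.
  rewrite (_ : (fun _ => _) = fun w => complex.Re (f w))//.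
  by apply/funext => w; case: (f w).
rewrite (_ : (fun _ => _) = fun w => - complex.Im (f w)).
  exact: measurable_funN.
by apply/funext => w; case: (f w).
Qed.

Lemma cmeas_sum I (r : seq I) (F : I -> T -> R[i]) :
  (forall i, cmeas (F i)) -> cmeas (fun w => \sum_(i <- r) F i w).
Proof.
move=> mF; elim: r => [|i r IH].
  by under eq_fun do rewrite big_nil; exact: cmeas_cst.
by under eq_fun do rewrite big_cons; exact: cmeasD.
Qed.

Lemma measurable_sqn f : cmeas f -> measurable_fun setT (fun w => sqn (f w)).
Proof. by move=> [f1 f2]; apply: measurable_funD; exact: measurable_funX. Qed.

Lemma mxmeas_cst a b (A : 'M[R[i]]_(a, b)) : mxmeas (fun=> A).
Proof. by move=> i j; exact: cmeas_cst. Qed.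

Lemma mxmeasD a b (F G : T -> 'M[R[i]]_(a, b)) :
  mxmeas F -> mxmeas G -> mxmeas (fun w => F w + G w).
Proof. by move=> mF mG i j; under eq_fun do rewrite mxE; exact: cmeasD. Qed.

Lemma mxmeasZ a b f (F : T -> 'M[R[i]]_(a, b)) :
  cmeas f -> mxmeas F -> mxmeas (fun w => f w *: F w).
Proof. by move=> mf mF i j; under eq_fun do rewrite mxE; exact: cmeasM. Qed.

Lemma mxmeasN a b (F : T -> 'M[R[i]]_(a, b)) :
  mxmeas F -> mxmeas (fun w => - F w).
Proof.
move=> mF; under eq_fun do rewrite -scaleN1r.
by apply: mxmeasZ => //; exact: cmeas_cst.
Qed.

Lemma mxmeasB a b (F G : T -> 'M[R[i]]_(a, b)) :
  mxmeas F -> mxmeas G -> mxmeas (fun w => F w - G w).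
Proof. by move=> mF mG; apply: mxmeasD => //; exact: mxmeasN. Qed.

Lemma mxmeasM a b c (F : T -> 'M[R[i]]_(a, b)) (G : T -> 'M[R[i]]_(b, c)) :
  mxmeas F -> mxmeas G -> mxmeas (fun w => F w *m G w).
Proof.
move=> mF mG i j; under eq_fun do rewrite mxE.
by apply: cmeas_sum => k; exact: cmeasM.
Qed.

Lemma mxmeas_adj a b (F : T -> 'M[R[i]]_(a, b)) :
  mxmeas F -> mxmeas (fun w => (F w)^t*).
Proof. by move=> mF i j; under eq_fun do rewrite !mxE; exact: cmeasJ. Qed.

Lemma mxmeas_sum a b I (r : seq I) (F : I -> T -> 'M[R[i]]_(a, b)) :
  (forall i, mxmeas (F i)) -> mxmeas (fun w => \sum_(i <- r) F i w).
Proof.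
move=> mF i j; under eq_fun do rewrite summxE.
by apply: cmeas_sum => k; exact: mF.
Qed.

Lemma cmeas_tr a (F : T -> 'M[R[i]]_a) : mxmeas F -> cmeas (fun w => \tr (F w)).
Proof. by move=> mF; apply: cmeas_sum => i; exact: mF. Qed.

Lemma mxmeas_scalar a f : cmeas f -> mxmeas (fun w => (f w)%:M : 'M[R[i]]_a).
Proof.
move=> mf; under eq_fun do rewrite -scalemx1.
by apply: mxmeasZ => //; exact: mxmeas_cst.
Qed.

Lemma measurable_fro a b (F : T -> 'M[R[i]]_(a, b)) :
  mxmeas F -> measurable_fun setT (fun w => fro (F w)).
Proof.
move=> mF; apply: measurable_sum => i; apply: measurable_sum => j.
exact/measurable_sqn/mF.
Qed.

Lemma mxmeas_amp a k (F : T -> 'M[R[i]]_a) :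
  mxmeas F -> mxmeas (fun w => ampliation k (F w)).
Proof.
move=> mF i j; under eq_fun do rewrite /ampliation mxE.
by apply: cmeasM; [exact: mF|exact: cmeas_cst].
Qed.

Lemma mx_measurable n (F : T -> 'M[R[i]]_n) :
  mxmeas F -> measurable_fun setT (F : T -> cmx R n).
Proof.
move=> mF; apply: (@measurability _ _ T (cmx R n) setT F (@cmx_cylinders R n)) => //.
move=> _ [_ [i [j [B [mB [->|->]]]]] <-].
- exact: (mF i j).1.
- exact: (mF i j).2.
Qed.

End measurability.

Section measurability_comp.
Context {R : realType} {d1 d2 : measure_display}.
Context {T1 : measurableType d1} {T2 : measurableType d2}.

Lemma mxmeas_comp a b (F : T2 -> 'M[R[i]]_(a, b)) (g : T1 -> T2) :
  mxmeas F -> measurable_fun setT g -> mxmeas (fun w => F (g w)).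
Proof.
move=> mF mg i j; split.
- exact: (measurableT_comp (mF i j).1 mg).
- exact: (measurableT_comp (mF i j).2 mg).
Qed.

Lemma mxmeas_id n : mxmeas (fun g : cmx R n => (g : 'M[R[i]]_n)).
Proof.
by move=> i j; split => _ B mB; rewrite setTI; apply: sub_sigma_algebra;
  exists i, j, B; split => //; [left|right].
Qed.

End measurability_comp.

(** The unitary group is the zero set of the measurable function [fro (U *m U^t* - 1%:M)]. *)
Lemma measurable_unitary (R : realType) (p : nat) :
  measurable [set U : cmx R p | (U : 'M[R[i]]_p) \is unitarymx].
Proof.
rewrite (_ : [set _ | _] =
  (fun U : cmx R p => fro ((U : 'M[R[i]]_p) *m U^t* - 1%:M)) @^-1` [set 0]).
  rewrite -[X in measurable X]setTI; apply: measurable_fro => //.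
  apply: mxmeasB; last exact: mxmeas_cst.
  by apply: mxmeasM; [|apply: mxmeas_adj]; exact: mxmeas_id.
apply/seteqP; split => U /=.
  by move=> /unitarymxP ->; rewrite subrr fro0.
by move=> /fro_eq0/subr0_eq/unitarymxP.
Qed.

(** * Integrals of nonnegative real functions *)

Section rint.
Context {R : realType} {d : measure_display} {T : measurableType d}.
Variable mu : {measure set T -> \bar R}.
Implicit Types f g : T -> R.
Local Open Scope ereal_scope.

Definition rint (f : T -> R) : \bar R := \int[mu]_w (f w)%:E.

Lemma rint_ge0 f : (forall w, (0 <= f w)%R) -> 0 <= rint f.
Proof. by move=> f0; apply: integral_ge0 => w _; rewrite lee_fin. Qed.

(* No measurability is needed: the integral of a nonnegative function is a
   supremum over the simple functions below it. *)
Lemma le_integral_any (f g : T -> \bar R) : (forall w, 0 <= f w) ->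
  (forall w, f w <= g w) -> \int[mu]_w f w <= \int[mu]_w g w.
Proof.
move=> f0 fg; rewrite !ge0_integralTE//; last by move=> w; exact: le_trans (fg w).
by apply: le_ereal_sup => _ [h hf <-]; exists h => // w; exact: le_trans (fg w).
Qed.

Lemma le_rint f g : (forall w, (0 <= f w)%R) -> (forall w, (f w <= g w)%R) ->
  rint f <= rint g.
Proof. by move=> f0 fg; apply: le_integral_any => w; rewrite lee_fin. Qed.

Lemma rintD f g : measurable_fun setT f -> measurable_fun setT g ->
  (forall w, (0 <= f w)%R) -> (forall w, (0 <= g w)%R) ->
  rint (fun w => f w + g w)%R = rint f + rint g.
Proof.
move=> mf mg f0 g0; rewrite /rint; under eq_integral do rewrite EFinD.
by rewrite ge0_integralD//; [move=> *; rewrite lee_fin|exact/measurable_EFinP|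
  move=> *; rewrite lee_fin|exact/measurable_EFinP].
Qed.

Lemma rintZ k f : measurable_fun setT f -> (0 <= k)%R ->
  (forall w, (0 <= f w)%R) -> rint (fun w => k * f w)%R = k%:E * rint f.
Proof.
move=> mf k0 f0; rewrite /rint; under eq_integral do rewrite EFinM.
rewrite ge0_integralZl//; [exact/measurable_EFinP|by move=> *; rewrite lee_fin].
Qed.

Lemma rint_sum I (r : seq I) (f : I -> T -> R) :
  (forall i, measurable_fun setT (f i)) -> (forall i w, (0 <= f i w)%R) ->
  rint (fun w => \sum_(i <- r) f i w)%R = \sum_(i <- r) rint (f i).
Proof.
move=> mf f0; rewrite /rint; under eq_integral do rewrite -sumEFin.
rewrite ge0_integral_sum//; first by move=> i; exact/measurable_EFinP.
by move=> *; rewrite lee_fin.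
Qed.

Lemma ae_le_rint f g : measurable_fun setT f -> measurable_fun setT g ->
  (forall w, (0 <= f w)%R) -> (forall w, (0 <= g w)%R) ->
  {ae mu, forall w, (f w <= g w)%R} -> rint f <= rint g.
Proof.
move=> mf mg f0 g0 fg; apply: ae_ge0_le_integral => //.
- by move=> *; rewrite lee_fin.
- exact/measurable_EFinP.
- by move=> *; rewrite lee_fin.
- exact/measurable_EFinP.
- by apply: filterS fg => w fg _; rewrite lee_fin.
Qed.

Lemma ae_eq_rint f g : measurable_fun setT f -> measurable_fun setT g ->
  (forall w, (0 <= f w)%R) -> (forall w, (0 <= g w)%R) ->
  {ae mu, forall w, f w = g w} -> rint f = rint g.
Proof.
move=> mf mg f0 g0 fg; apply/eqP; rewrite eq_le; apply/andP; split.
  by apply: ae_le_rint => //; apply: filterS fg => w ->.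
by apply: ae_le_rint => //; apply: filterS fg => w ->.
Qed.

End rint.

Lemma rint_cst (R : realType) d (T : measurableType d) (P : probability T R)
  (k : R) : rint P (fun=> k) = k%:E.
Proof.
rewrite /rint [LHS](integral_cst P (@measurableT _ T) k%:E) -[RHS]mule1.
by congr (_ * _)%E; exact: probability_setT.
Qed.

Section transfer.
Context {R : realType} {d1 d2 : measure_display}.
Context {X : measurableType d1} {Y : measurableType d2}.

(** Change of variables when [nu] is only known to agree with the image of [mu] on measurable sets;
    it serves both the invariance of Haar measure and the computation of joint laws. *)
Lemma rint_transfer (mu : {measure set X -> \bar R})
    (nu : {measure set Y -> \bar R}) (phi : X -> Y) (f : Y -> R) :
  measurable_fun setT phi -> measurable_fun setT f -> (forall y, 0 <= f y) ->
  (forall A, measurable A -> mu (phi @^-1` A) = nu A) ->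
  rint mu (fun x => f (phi x)) = rint nu f.
Proof.
move=> mphi mf f0 munu.
pose mx := isMeasurableFun.Build _ _ _ _ _ mphi.
pose phi' : {mfun X >-> Y} := HB.pack phi mx.
transitivity (\int[pushforward mu phi']_y (f y)%:E)%E; last first.
  by apply: eq_measure_integral => A mA _; exact: munu.
rewrite ge0_integral_pushforward//; first exact/measurable_EFinP.
by move=> y _; rewrite lee_fin.
Qed.

End transfer.

Lemma rint_fin (R : realType) d (T : measurableType d)
    (mu : {measure set T -> \bar R}) (f : T -> R) (k : R) :
  (forall w, 0 <= f w) -> (rint mu f <= k%:E)%E ->
  exists r : R, [/\ 0 <= r, r <= k & rint mu f = r%:E].
Proof.
move=> f0; have := rint_ge0 mu f0; case: (rint mu f) => [r| |]//=.
by rewrite !lee_fin => r0 rk; exists r.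
Qed.

(** Nonnegative integrals with a finite sum are finite. The averaging arguments for Haar measure can
    then compute with real numbers. *)
Lemma rint_sum_fin (R : realType) d (T : measurableType d)
    (mu : {measure set T -> \bar R}) (I : finType) (f : I -> T -> R) (k : R) :
  (forall i, measurable_fun setT (f i)) -> (forall i w, 0 <= f i w) ->
  rint mu (fun w => \sum_i f i w) = k%:E ->
  exists r : I -> R, [/\ forall i, 0 <= r i, forall i, rint mu (f i) = (r i)%:E &
    \sum_i r i = k].
Proof.
move=> mf f0; rewrite rint_sum// => SI.
have /choice[r rE] : forall i, exists r : R, 0 <= r /\ rint mu (f i) = r%:E.
  move=> i; have [|r [r0 _ rE]] := @rint_fin _ _ _ mu (f i) k (f0 i).
    rewrite -SI (bigD1 i)//= leeDl// sume_ge0// => j _.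
    by apply: rint_ge0 => w; exact: f0.
  by exists r.
exists r; split; [by move=> i; case: (rE i)..|].
apply: EFin_inj; rewrite -SI -sumEFin; apply: eq_bigr => i _.
by case: (rE i).
Qed.

Ltac mxm := repeat first [exact: mxmeas_cst | exact: mxmeas_id | exact: cmeas_cst
  | assumption | apply: mxmeasM | apply: mxmeas_adj | apply: mxmeasB
  | apply: mxmeasD | apply: mxmeas_scalar | apply: mxmeas_amp
  | apply: mxmeasZ | apply: measurable_fro | apply: measurable_sqn
  | apply: cmeas_tr | apply: cmeasM ].

(** * Haar averages *)

(** Polarization. For orthonormal u and y the rows u + y and u - y are orthogonal, so a difference
    of two diagonal values of a form becomes a sum of two off-diagonal ones. *)
Lemma mulmx_polar (F : comNzRingType) a b c (U V : 'M[F]_(a, b)) (X Y : 'M[F]_(b, c)) :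
  (U + V) *m (X - Y) + (U - V) *m (X + Y) = 2%:R *: (U *m X - V *m Y).
Proof.
rewrite !mulmxDl !mulmxDr !mulmxN !mulNmx.
by apply/matrixP => i j; rewrite !mxE; ring.
Qed.

Section haar.
Context {R : realType} (p : nat) (nu : probability (cmx R p) R).
Hypothesis nuH : haar_unitary nu.
Implicit Types (a b : 'rV[R[i]]_p) (U D : 'M[R[i]]_p).

Lemma haar_left U (f : cmx R p -> R) : U \is unitarymx ->
  measurable_fun setT f -> (forall h, 0 <= f h) ->
  rint nu (fun h => f (U *m h)) = rint nu f.
Proof.
move=> Uu mf f0; apply: (rint_transfer (phi := fun h : cmx R p => U *m h : cmx R p)) => //.
  by apply: mx_measurable; mxm.
by move=> A mA; exact: (nuH.2 _ _ Uu mA).1.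
Qed.

Lemma haar_right U (f : cmx R p -> R) : U \is unitarymx ->
  measurable_fun setT f -> (forall h, 0 <= f h) ->
  rint nu (fun h : 'M[R[i]]_p => f (h *m U)) = rint nu f.
Proof.
move=> Uu mf f0.
apply: (rint_transfer (phi := fun h : cmx R p => (h : 'M[R[i]]_p) *m U : cmx R p)) => //.
  by apply: mx_measurable; mxm.
by move=> A mA; exact: (nuH.2 _ _ Uu mA).2.
Qed.

Lemma haar_ae_unitary : {ae nu, forall h : cmx R p, (h : 'M[R[i]]_p) \is unitarymx}.
Proof.
pose A := [set U : cmx R p | (U : 'M[R[i]]_p) \is unitarymx].
have mA : measurable A by exact: measurable_unitary.
exists (~` A); split; [exact: measurableC| |by move=> h].
have -> : nu (~` A) = (1 - nu A)%E by exact: probability_setC.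
by rewrite (_ : nu A = 1%E) ?subee//; exact: nuH.1.
Qed.

Lemma unitary_unit_row a : fro a = 1 -> a \is unitarymx.
Proof.
move=> a1; apply/unitarymxP/matrixP => i j; rewrite !ord1 mxdiag_fro.
by rewrite (_ : row 0 a = a) ?a1 ?mxE//; apply/rowP => k; rewrite mxE.
Qed.

Lemma fro_delta_row x : fro (delta_mx 0 x : 'rV[R[i]]_p) = 1.
Proof.
rewrite /fro big_ord1 (bigD1 x)//= mxE !eqxx sqn1 big1 ?addr0// => y yx.
by rewrite mxE (negbTE yx) andbF sqn0.
Qed.

Lemma row_polar a : exists (c : R) (u : 'rV[R[i]]_p),
  a = c%:C *: u /\ (c = 0 \/ fro u = 1) /\ c ^+ 2 = fro a.
Proof.
have [a0|a0] := eqVneq (fro a) 0.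
  exists 0, 0; rewrite a0 expr0n (fro_eq0 a0) scaler0; split => //; split => //.
  by left.
exists (Num.sqrt (fro a)), ((Num.sqrt (fro a))^-1%:C *: a).
have s0 : Num.sqrt (fro a) != 0.
  by rewrite gt_eqF// sqrtr_gt0 lt_neqAle eq_sym a0 fro_ge0.
rewrite scalerA -rmorphM divff// scale1r sqr_sqrtr ?fro_ge0//; split => //.
split => //; right; rewrite froZ sqnR exprVn sqr_sqrtr ?fro_ge0//.
by rewrite mulVf.
Qed.

(** By right invariance a unit row b may be replaced by any basis vector x, so all the entries of a
    h have the same second moment. These moments add up to [fro a], since h is unitary almost
    everywhere. *)
Lemma haar_entry a b : (0 < p)%N ->
  (rint nu (fun h : 'M[R[i]]_p => sqn ((a *m h *m b^t*) ord0 ord0)) <=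
   (fro a * fro b / p%:R)%:E)%E.
Proof.
move=> p0; have [c [u [-> [cu <-]]]] := row_polar b.
set B := rint _ _.
have Bx x : B = ((c ^+ 2)%:E * rint nu (fun h : 'M[R[i]]_p => sqn ((a *m h) ord0 x)))%E.
  rewrite -rintZ ?sqr_ge0//; last 2 first.
  - by mxm.
  - by move=> h; exact: sqn_ge0.
  rewrite /B; case: cu => [->|u1].
    apply: eq_integral => h _; rewrite !scale0r trmx0 map_mx0 mulmx0 mxE sqn0.
    by rewrite expr0n mul0r.
  have [U Uu Ue] := unitary_transport (unitary_unit_row u1)
    (unitary_unit_row (fro_delta_row x)).
  rewrite -(@haar_right (U^t*)) ?trmxC_unitary//; last 2 first.
  - by mxm.
  - by move=> h; exact: sqn_ge0.
  apply: eq_integral => h _; congr (_%:E).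
  rewrite trmxCZ -scalemxAr mxE sqnM sqnC sqnR; congr (_ * sqn _).
  rewrite -!mulmxA -trmxC_mul Ue mulmxA; move: (a *m h) => v; rewrite mxE.
  rewrite (bigD1 x)//= big1 ?addr0; last first.
    by move=> y yx; rewrite !mxE (negbTE yx) andbF conjC0 mulr0.
  by rewrite !mxE !eqxx conjC1 mulr1.
have [r [_ rE Sr]] : exists r : 'I_p -> R, [/\ forall x, 0 <= r x,
    forall x, rint nu (fun h : 'M[R[i]]_p => sqn ((a *m h) ord0 x)) = (r x)%:E &
    \sum_x r x = fro a].
  apply: rint_sum_fin => [x|x h|]; [by mxm|exact: sqn_ge0|].
  rewrite -(rint_cst nu (fro a)); apply: ae_eq_rint => //.
  - by apply: measurable_sum => x; mxm.
  - by move=> h; apply: sumr_ge0 => x _; exact: sqn_ge0.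
  - by move=> _; exact: fro_ge0.
  apply: filterS haar_ae_unitary => h hu.
  by rewrite -[RHS](fro_mulmx_unitary _ hu) /fro big_ord1.
have Br x : B = (c ^+ 2 * r x)%:E by rewrite (Bx x) rE.
pose x0 := Ordinal p0; rewrite (Br x0) lee_fin.
rewrite ler_pdivlMr ?ltr0n// -Sr mulr_suml mulr_natr -[X in _ *+ X]card_ord -sumr_const.
apply: ler_sum => x _; rewrite [leRHS]mulrC.
by have [->] : (c ^+ 2 * r x0)%:E = (c ^+ 2 * r x)%:E by rewrite -!Br.
Qed.

Section conjugation.
Variable D : 'M[R[i]]_p.
Let N (h : 'M[R[i]]_p) := h *m D *m h^t*.
Let B a b := rint nu (fun h : 'M[R[i]]_p => sqn ((a *m N h *m b^t*) ord0 ord0)).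

Let mB a b : measurable_fun setT
  (fun h : cmx R p => sqn ((a *m N h *m b^t*) ord0 ord0)).
Proof. by rewrite /N; mxm. Qed.

Let B0 a b (h : cmx R p) : 0 <= sqn ((a *m N h *m b^t*) ord0 ord0).
Proof. exact: sqn_ge0. Qed.

Lemma conj_formU U a b : U \is unitarymx -> B (a *m U) (b *m U) = B a b.
Proof.
move=> Uu; rewrite -[RHS](haar_left Uu (mB a b) (B0 a b)).
apply: eq_integral => h _; congr (sqn (_ ord0 ord0))%:E.
by rewrite /N !trmxC_mul !mulmxA.
Qed.

Lemma conj_formZ (x y : R) a b : B (x%:C *: a) (y%:C *: b) =
  ((x ^+ 2 * y ^+ 2)%:E * B a b)%E.
Proof.
rewrite -rintZ//; last by rewrite mulr_ge0 ?sqr_ge0.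
apply: eq_integral => h _; congr (_%:E).
rewrite trmxCZ -!scalemxAl -scalemxAr scalerA mxE sqnM sqnM sqnC !sqnR.
by [].
Qed.

Lemma conj_form_delta h x y :
  sqn (((delta_mx 0 x : 'rV[R[i]]_p) *m N h *m (delta_mx 0 y : 'rV[R[i]]_p)^t*) ord0 ord0)
  = sqn (N h x y).
Proof.
congr sqn; rewrite mxE (bigD1 y)//= big1 ?addr0; last first.
  by move=> z zy; rewrite !mxE (negbTE zy) andbF conjC0 mulr0.
by rewrite -rowE !mxE !eqxx conjC1 mulr1.
Qed.

Lemma unitary_pair a b : fro a = 1 -> fro b = 1 -> a *m b^t* = 0 ->
  col_mx a b \is unitarymx.
Proof.
move=> a1 b1 ab; apply/unitarymxP; rewrite tr_col_mx map_row_mx mul_col_row.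
rewrite ab (_ : b *m _ = 0); last by rewrite -[LHS]trmxCK trmxC_mul trmxCK ab trmx0 map_mx0.
rewrite (unitarymxP (unitary_unit_row a1)) (unitarymxP (unitary_unit_row b1)).
by rewrite -scalar_mx_block.
Qed.

Lemma delta_ortho x y : x != y ->
  (delta_mx 0 x : 'rV[R[i]]_p) *m (delta_mx 0 y : 'rV[R[i]]_p)^t* = 0.
Proof.
move=> xy; apply/matrixP => i j; rewrite !ord1 !mxE big1// => z _.
rewrite !mxE eqxx /=; have [->|] := eqVneq z x; last by rewrite mul0r.
by rewrite (negbTE xy) conjC0 mulr0.
Qed.

(* By invariance all the values at orthonormal pairs agree, and the sum of the
   values at pairs of distinct basis vectors is at most fro D. *)
Lemma conj_form_ortho a b : (1 < p)%N -> a *m b^t* = 0 ->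
  (B a b <= (fro D / (p%:R * (p%:R - 1)) * (fro a * fro b))%:E)%E.
Proof.
move=> p1 ab.
have p1' : 0 < p%:R * (p%:R - 1) :> R.
  by rewrite mulr_gt0 ?ltr0n ?(ltn_trans _ p1)// subr_gt0 ltr1n.
have [c [u [aE [cu ca]]]] := row_polar a.
have [e [v [bE [ev eb]]]] := row_polar b.
rewrite -ca -eb aE bE conj_formZ.
case: cu => [c0|u1]; first by rewrite c0 expr0n !mul0r mulr0 mul0e.
case: ev => [e0|v1]; first by rewrite e0 expr0n !mulr0 mul0e.
have [c0|c0] := eqVneq c 0; first by rewrite c0 expr0n !mul0r mulr0 mul0e.
have [e0|e0] := eqVneq e 0; first by rewrite e0 expr0n !mulr0 mul0e.
have uv : u *m v^t* = 0.
  move: ab; rewrite aE bE trmxCZ -scalemxAl -scalemxAr scalerA => /eqP.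
  rewrite scaler_eq0 mulf_eq0 conjC_eq0 => /orP[|/eqP//].
  by rewrite !fmorph_eq0 (negbTE c0) (negbTE e0).
suff Buv : (B u v <= (fro D / (p%:R * (p%:R - 1)))%:E)%E.
  rewrite [X in (_ <= X%:E)%E]mulrC [leRHS]EFinM lee_wpmul2l//.
  by rewrite lee_fin mulr_ge0// sqr_ge0.
have Bxy x y : x != y -> B u v = rint nu (fun h : 'M[R[i]]_p => sqn (N h x y)).
  move=> xy; have de := delta_ortho xy.
  have [U Uu] := unitary_transport
    (unitary_pair (fro_delta_row x) (fro_delta_row y) de) (unitary_pair u1 v1 uv).
  rewrite mul_col_mx => /eq_col_mx[<- <-]; rewrite conj_formU//.
  by apply: eq_integral => h _; rewrite conj_form_delta.
have [r [r0 rE Sr]] : exists r : 'I_p * 'I_p -> R, [/\ forall x, 0 <= r x,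
    forall x, rint nu (fun h : 'M[R[i]]_p => sqn (N h x.1 x.2)) = (r x)%:E &
    \sum_x r x = fro D].
  apply: rint_sum_fin => [x|x h|]; [by rewrite /N; mxm|exact: sqn_ge0|].
  rewrite -(rint_cst nu (fro D)); apply: ae_eq_rint => //.
  - by apply: measurable_sum => x; rewrite /N; mxm.
  - by move=> h; apply: sumr_ge0 => x _; exact: sqn_ge0.
  - by move=> _; exact: fro_ge0.
  apply: filterS haar_ae_unitary => h hu.
  rewrite -[RHS](fro_unitary_mulmx _ hu) -(fro_mulmx_unitary _ (unitary_trmxC hu)).
  by rewrite /fro pair_bigA.
have {}Bxy x y : x != y -> B u v = (r (x, y))%:E by move=> /Bxy ->; rewrite -rE.
have p0 : (0 < p)%N by exact: ltn_trans p1.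
have : Ordinal p0 != Ordinal p1 by [].
move=> /Bxy BE; rewrite BE lee_fin ler_pdivlMr//.
set t := r _ in BE *.
rewrite -Sr (_ : \sum_x r x = \sum_x \sum_y r (x, y)); last first.
  by rewrite pair_bigA; apply: eq_bigr => -[].
have -> : t * (p%:R * (p%:R - 1)) = \sum_(x < p) \sum_(y < p | y != x) t.
  under eq_bigr => x _ do rewrite sumr_const cardC1 card_ord.
  rewrite sumr_const card_ord -mulrnA -[RHS]mulr_natr natrM; congr (_ * _).
  rewrite mulrC; congr (_ * _).
  by apply/eqP; rewrite subr_eq natr1 prednK.
apply: ler_sum => x _; rewrite [leRHS](bigD1 x)//=.
rewrite (eq_bigr (fun y => r (x, y))) ?lerDr// => y yx.
by apply: EFin_inj; rewrite -BE; apply: Bxy; rewrite eq_sym.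
Qed.

(* Since the trace vanishes, a N a^* is the mean of a N a^* - f N f^* over an
   orthonormal basis, and polarization makes these off-diagonal values. *)
Lemma conj_form_diag a : (1 < p)%N -> \tr D = 0 ->
  (B a a <= (4 * (fro D / (p%:R * (p%:R - 1))) * fro a ^+ 2)%:E)%E.
Proof.
move=> p1 D0; set beta := fro D / _.
have beta0 : 0 <= beta.
  by rewrite divr_ge0 ?fro_ge0// mulr_ge0// subr_ge0 ler1n ltnW.
have [c [u [-> [cu <-]]]] := row_polar a; rewrite conj_formZ.
case: cu => [->|u1]; first by rewrite expr0n mul0r mul0e expr0n mulr0.
rewrite -expr2 [X in (_ <= X%:E)%E]mulrC [leRHS]EFinM lee_wpmul2l ?lee_fin ?sqr_ge0//.
have p0 : (0 < p)%N by exact: ltn_trans p1.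
have [U Uu Ue] := unitary_transport
  (unitary_unit_row (fro_delta_row (Ordinal p0))) (unitary_unit_row u1).
pose f x := delta_mx 0 x *m U : 'rV[R[i]]_p.
have f1 x : fro (f x) = 1 by rewrite /f fro_mulmx_unitary// fro_delta_row.
have [x0 fx0] : exists x0, f x0 = u by exists (Ordinal p0).
have ff x : x != x0 -> u *m (f x)^t* = 0.
  move=> xx; rewrite -fx0 /f trmxC_mul mulmxA -(mulmxA _ U) (unitarymxP Uu) mulmx1.
  by rewrite delta_ortho// eq_sym.
pose F x (h : 'M[R[i]]_p) :=
  sqn ((u *m N h *m u^t* - f x *m N h *m (f x)^t*) ord0 ord0).
have mF x : measurable_fun setT (F x : cmx R p -> R) by rewrite /F /N; mxm.
have F0 x h : 0 <= F x h by exact: sqn_ge0.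
have Fle x : (rint nu (F x) <= (4 * beta)%:E)%E.
  have [->|xx] := eqVneq x x0.
    rewrite -(rint_cst nu (4 * beta)); apply: le_rint => // h.
    by rewrite /F fx0 subrr mxE sqn0 mulr_ge0.
  pose y := f x; have fy : fro y = 1 by exact: f1.
  have uy : u *m y^t* = 0 by exact: ff.
  have yu : y *m u^t* = 0 by rewrite -[LHS]trmxCK trmxC_mul trmxCK uy trmx0 map_mx0.
  have froP : fro (u + y) = 2.
    apply: (@complexI R); rewrite -fro_mxtrace trmxCD mulmxDl !mulmxDr uy yu.
    by rewrite addr0 add0r raddfD /= !fro_mxtrace u1 fy -rmorphD.
  have froM : fro (u - y) = 2.
    apply: (@complexI R); rewrite -fro_mxtrace trmxCD trmxCN mulmxDl !mulmxDr !mulNmx.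
    rewrite !mulmxN uy yu opprK !oppr0.
    by rewrite addr0 add0r raddfD /= !fro_mxtrace u1 fy -rmorphD.
  have pm1 : (u + y) *m (u - y)^t* = 0.
    apply/matrixP => i j; rewrite !ord1 trmxCD trmxCN mulmxDl !mulmxDr !mulmxN uy yu.
    rewrite oppr0 addr0 add0r !mxE.
    have /matrixP/(_ 0 0) := unitarymxP (unitary_unit_row u1).
    have /matrixP/(_ 0 0) := unitarymxP (unitary_unit_row fy).
    by rewrite !mxE => -> ->; rewrite subrr.
  have pm2 : (u - y) *m (u + y)^t* = 0.
    by rewrite -[LHS]trmxCK trmxC_mul trmxCK pm1 trmx0 map_mx0.
  have B1 := conj_form_ortho p1 pm1; have B2 := conj_form_ortho p1 pm2.
  rewrite froP froM -/beta in B1 B2.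
  (* Each off-diagonal value is at most [beta * (2 * 2)], both rows having [fro] equal to 2; the two
     halves add up to [4 * beta]. *)
  apply: (@le_trans _ _ (rint nu (fun h : 'M[R[i]]_p =>
      2^-1 * sqn (((u + y) *m N h *m (u - y)^t*) ord0 ord0) +
      2^-1 * sqn (((u - y) *m N h *m (u + y)^t*) ord0 ord0)))).
    apply: le_rint => // h; rewrite /F -/y.
    set P := (u + y) *m _ *m _; set M := (u - y) *m _ *m _.
    have -> : u *m N h *m u^t* - y *m N h *m y^t* = (2^-1)%:C *: (P + M).
      rewrite /P /M !trmxCD trmxCN !(mulmxDl _ _ (N h)) mulNmx mulmx_polar scalerA.
      by rewrite -(rmorph_nat (real_complex R)) -rmorphM mulVf ?scale1r.
    rewrite mxE sqnM sqnR mxE.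
    by have := sqnD_le (P ord0 ord0) (M ord0 ord0); lra.
  rewrite rintD; last 4 first.
  - by apply: measurable_funM; [exact: measurable_cst|exact: mB].
  - by apply: measurable_funM; [exact: measurable_cst|exact: mB].
  - by move=> h; rewrite mulr_ge0 ?sqn_ge0.
  - by move=> h; rewrite mulr_ge0 ?sqn_ge0.
  rewrite !rintZ//.
  apply: (@le_trans _ _ (2^-1%:E * (beta * (2 * 2))%:E + 2^-1%:E * (beta * (2 * 2))%:E)%E).
    apply: leeD; (apply: lee_wpmul2l; first by rewrite lee_fin).
    - exact: B1.
    - exact: B2.
  by rewrite -!EFinM -EFinD lee_fin; lra.
apply: (@le_trans _ _ (rint nu (fun h : 'M[R[i]]_p => p%:R^-1 * \sum_x F x h))).
  apply: ae_le_rint => //.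
  - apply: measurable_funM; first exact: measurable_cst.
    exact: measurable_sum.
  - by move=> h; rewrite mulr_ge0 ?invr_ge0// sumr_ge0.
  apply: filterS haar_ae_unitary => h hu.
  have pn0 : p%:R != 0 :> R[i] by rewrite pnatr_eq0 -lt0n.
  have -> : (u *m N h *m u^t*) ord0 ord0 = p%:R^-1 *
      \sum_x (u *m N h *m u^t* - f x *m N h *m (f x)^t*) ord0 ord0.
    under eq_bigr do rewrite mxE.
    rewrite big_split /= sumr_const card_ord; set X := (u *m _ *m _) _ _.
    rewrite mulrDr -[X *+ p]mulr_natl mulrA mulVf// mul1r.
    rewrite -[LHS]addr0; congr (_ + _); apply/esym.
    rewrite (_ : \sum_ _ _ = - \tr (U *m N h *m U^t*)).
      rewrite mxtrace_mulC mulmxA unitary_adjK// mul1mx mxtrace_mulC mulmxA.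
      by rewrite unitary_adjK// mul1mx D0 oppr0 mulr0.
    rewrite -sumrN; apply: eq_bigr => x _; rewrite mxE; congr (- _).
    rewrite /f -rowE -row_mul !mxE; apply: eq_bigr => j _.
    by rewrite !mxE.
  rewrite sqnM sqn_inv_nat; apply: le_trans (ler_wpM2l _ (sqn_sum_le _)) _.
    by rewrite sqr_ge0.
  by rewrite card_ord mulrA expr2 -(mulrA _ _ p%:R) mulVf ?mulr1// pnatr_eq0 -lt0n.
rewrite rintZ ?invr_ge0//; last 2 first.
- exact: measurable_sum.
- by move=> h; rewrite sumr_ge0.
rewrite rint_sum// lee_pdivrMl ?ltr0n//.
apply: (@le_trans _ _ (\sum_(x < p) (4 * beta)%:E)%E); first exact: lee_sum.
by rewrite sumEFin sumr_const card_ord -[_ *+ p]mulr_natl.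
Qed.

(** Split b into its component along a and a row f orthogonal to a, and use the diagonal bound for
    the first and the orthogonal bound for the second. The 8 is 4 from [conj_form_diag] times 2 from
    [sqnD_le]. *)
Lemma conj_form_le a b : (1 < p)%N -> \tr D = 0 ->
  (B a b <= (8 * (fro D / (p%:R * (p%:R - 1))) * (fro a * fro b))%:E)%E.
Proof.
move=> p1 D0; set beta := fro D / _.
have beta0 : 0 <= beta.
  by rewrite divr_ge0 ?fro_ge0// mulr_ge0// subr_ge0 ler1n ltnW.
have [a0|a0] := eqVneq (fro a) 0.
  rewrite -(rint_cst nu (8 * beta * (fro a * fro b))); apply: le_rint => // h.
  by rewrite a0 mul0r mulr0 (fro_eq0 a0) !mul0mx mxE sqn0.
pose c := (b *m a^t*) 0 0 / (fro a)%:C; pose f := b - c *: a.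
have aa : a *m a^t* = (fro a)%:C%:M.
  apply/matrixP => i j; rewrite !ord1 mxdiag_fro mxE eqxx mulr1n.
  by congr (fro _)%:C; apply/rowP => k; rewrite mxE.
have fa : f *m a^t* = 0.
  rewrite mulmxBl -scalemxAl aa [b *m _]mx11_scalar scale_scalar_mx.
  rewrite /c divfK; first by rewrite subrr. by rewrite fmorph_eq0.
have af : a *m f^t* = 0 by rewrite -[LHS]trmxCK trmxC_mul trmxCK fa trmx0 map_mx0.
have bE : b = c *: a + f by rewrite /f addrC subrK.
have froB : fro b = sqn c * fro a + fro f.
  apply: (@complexI R); rewrite -fro_mxtrace bE trmxCD mulmxDl !mulmxDr.
  rewrite trmxCZ -!scalemxAl -!scalemxAr af fa !scaler0 addr0 add0r raddfD /=.
  by rewrite scalerA mulCJ mxtraceZ !fro_mxtrace -rmorphM -rmorphD.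
apply: (@le_trans _ _ (rint nu (fun h : 'M[R[i]]_p =>
    (2 * sqn c) * sqn ((a *m N h *m a^t*) ord0 ord0) +
    2 * sqn ((a *m N h *m f^t*) ord0 ord0)))).
  apply: le_rint => // h.
  rewrite bE trmxCD trmxCZ mulmxDr -scalemxAr mxE; apply: le_trans (sqnD_le _ _) _.
  by rewrite mxE sqnM sqnC mulrA.
rewrite rintD; last 4 first.
- by apply: measurable_funM; [exact: measurable_cst|exact: mB].
- by apply: measurable_funM; [exact: measurable_cst|exact: mB].
- by move=> h; rewrite !mulr_ge0 ?sqn_ge0.
- by move=> h; rewrite mulr_ge0 ?sqn_ge0.
have c0 := sqn_ge0 c.
rewrite !rintZ ?mulr_ge0//.
apply: (@le_trans _ _ ((2 * sqn c)%:E * (4 * beta * fro a ^+ 2)%:E +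
    2%:E * (beta * (fro a * fro f))%:E)%E).
  apply: leeD; (apply: lee_wpmul2l; first by rewrite lee_fin ?mulr_ge0).
  - exact: conj_form_diag.
  - exact: conj_form_ortho.
rewrite -!EFinM -EFinD lee_fin froB.
have : 0 <= beta * (fro a * fro f).
  by apply: mulr_ge0 => //; apply: mulr_ge0; exact: fro_ge0.
have -> : 8 * beta * (fro a * (sqn c * fro a + fro f)) =
    2 * sqn c * (4 * beta * fro a ^+ 2) + 8 * (beta * (fro a * fro f)) by ring.
by move=> x0; rewrite lerD2l ler_wpM2r// ler_nat.
Qed.

End conjugation.

(** Conjugation by a unitary fixes scalars, so D may be replaced by its traceless part [D0]. The 64
    is 8 from [conj_form_le], times 4 from [fro_traceless_le], times 2 from p <= 2 (p - 1). *)
Lemma haar_conj D a b : (0 < p)%N ->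
  (rint nu (fun h : 'M[R[i]]_p =>
      sqn ((a *m (h *m D *m h^t* - (\tr D / p%:R)%:M) *m b^t*) ord0 ord0)) <=
   (64 * fro D / p%:R ^+ 2 * (fro a * fro b))%:E)%E.
Proof.
move=> p0; pose D0 := D - (\tr D / p%:R)%:M.
have pn0 : p%:R != 0 :> R[i] by rewrite pnatr_eq0 -lt0n.
have trD0 : \tr D0 = 0.
  by rewrite /D0 raddfB /= mxtrace_scalar -[(_ / _) *+ p]mulr_natr divfK// subrr.
apply: (@le_trans _ _ (rint nu (fun h : 'M[R[i]]_p =>
    sqn ((a *m (h *m D0 *m h^t*) *m b^t*) ord0 ord0)))).
  apply: ae_le_rint.
  - by mxm.
  - by mxm.
  - by move=> h; exact: sqn_ge0.
  - by move=> h; exact: sqn_ge0.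
  apply: filterS haar_ae_unitary => h hu.
  rewrite (_ : h *m D0 *m h^t* = h *m D *m h^t* - (\tr D / p%:R)%:M)//.
  by rewrite /D0 mulmxBr mulmxBl mul_mx_scalar -scalemxAl (unitarymxP hu) scalemx1.
have [p1|p1] := ltnP 1 p.
  apply: le_trans (conj_form_le _ _ p1 trD0) _; rewrite lee_fin.
  rewrite ler_wpM2r ?mulr_ge0 ?fro_ge0//.
  have pR : 0 < p%:R :> R by rewrite ltr0n.
  have p2 : p%:R <= 2 * (p%:R - 1) :> R.
    have : 2 <= p%:R :> R by rewrite ler_nat.
    by lra.
  have pR1 : 0 < p%:R - 1 :> R by lra.
  rewrite mulrA ler_pdivrMr ?mulr_gt0//.
  apply: (@le_trans _ _ (32 * fro D)).
    by have := fro_traceless_le D; rewrite -/D0; lra.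
  have -> : 64 * fro D / p%:R ^+ 2 * (p%:R * (p%:R - 1)) =
      64 * fro D * ((p%:R - 1) / p%:R) by field; rewrite gt_eqF.
  have : 2^-1 <= (p%:R - 1) / p%:R :> R by rewrite ler_pdivlMr//; lra.
  by have := fro_ge0 D; nra.
(* For p = 1 the bound on conjugates is void, but a traceless matrix of size 1 vanishes. *)
have -> : D0 = 0.
  have p11 (i j : 'I_p) : i = j.
    apply: val_inj; have := leq_trans (ltn_ord i) p1.
    have := leq_trans (ltn_ord j) p1.
    by rewrite !ltnS !leqn0 /= => /eqP -> /eqP ->.
  apply/matrixP => i j; rewrite [RHS]mxE (p11 j i) -trD0 /mxtrace (bigD1 i)//=.
  by rewrite big1 ?addr0// => k; rewrite (p11 k i) eqxx.
rewrite -(rint_cst nu (64 * fro D / p%:R ^+ 2 * (fro a * fro b))).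
apply: le_rint => h; first exact: sqn_ge0.
rewrite mulmx0 mul0mx mulmx0 mul0mx mxE sqn0.
by rewrite !mulr_ge0 ?fro_ge0// invr_ge0 exprn_ge0.
Qed.

End haar.

(** * Independence and Tonelli *)

Section independence.
Context {R : realType} {d d' : measure_display} {T : measurableType d}
  {Y : measurableType d'} (P : probability T R) (I : finType).
Variables (F : I -> set (set T)) (i0 : I).
Hypothesis Fm : forall i A, F i A -> measurable A.
Hypothesis FT : forall i, F i setT.
Hypothesis FI : forall i, setI_closed (F i).
Hypothesis indF : mutually_independent P F.

(** A pi-system generating the sigma-algebra of all the families but the [i0]-th one. *)
Definition cyl_but : set (set T) :=
  [set A | exists E : I -> set T, (forall i, F i (E i)) /\
    A = \bigcap_(i in [set i | i \in [set~ i0]%SET]) E i].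

Lemma cyl_but_measurable : cyl_but `<=` measurable.
Proof.
move=> _ [E [FE ->]]; apply: fin_bigcap_measurable => //.
by move=> i _; exact: (Fm (FE i)).
Qed.

Lemma cyl_butT : cyl_but setT.
Proof. by exists (fun=> setT); split => //; rewrite bigcapT. Qed.

Lemma cyl_butI : setI_closed cyl_but.
Proof.
move=> _ _ [E [FE ->]] [E' [FE' ->]]; exists (fun i => E i `&` E' i).
by split=> [i|]; [exact: FI|rewrite bigcapI].
Qed.

Lemma cyl_but_single i A : i != i0 -> F i A -> cyl_but A.
Proof.
move=> ii FA; exists (fun j => if j == i then A else setT); split.
  by move=> j; case: eqP => [->|].
apply/seteqP; split=> [w Aw j _|w]; first by case: ifP.
by move/(_ i); rewrite /= eqxx; apply; rewrite !inE.
Qed.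

(** Uniqueness of measures: for fixed B, the restriction of P to B and the multiple of P by P B are
    finite measures agreeing on the pi-system [cyl_but]. *)
Lemma cyl_but_indep A B : <<s cyl_but >> A -> F i0 B ->
  P (A `&` B) = (P A * P B)%E.
Proof.
move=> sA FB; have mB := Fm FB.
have PB : P B \is a fin_num by exact: fin_num_measure.
pose c := NngNum (fine_ge0 (measure_ge0 P B)).
have ms A' : mscale c P A' = (P A' * P B)%E by rewrite /mscale /= fineK// muleC.
rewrite -ms.
have -> : P (A `&` B) = mrestr P mB A by [].
apply: (g_sigma_algebra_measure_unique cyl_but _ (fun=> setT) _ _ (mrestr P mB)) sA.
- exact: cyl_but_measurable.
- by move=> _; exact: cyl_butT.
- by rewrite bigcup_const.
- exact: cyl_butI.
- move=> _ [E [FE ->]]; apply: etrans (esym (ms _)).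
  set C := \bigcap_(_ in _) _; suff : P (C `&` B) = (P C * P B)%E by [].
  rewrite {}/C.
  (* Mutual independence is used twice, without [i0] and with B inserted at [i0]; the two products
     differ by the factor [P B]. *)
  pose E' i := if i == i0 then B else E i.
  have := indF (J := [set~ i0]%SET) (E := E) (fun i _ => FE i).
  have := indF (J := [set: I]%SET) (E := E').
  move=> h; have {h} : P (\bigcap_(i in [set i | i \in [set: I]%SET]) E' i) =
      (\prod_(i in [set: I]%SET) P (E' i))%E.
    by apply: h => i _; rewrite /E'; case: eqP => [->|].
  rewrite (_ : \bigcap_(i in [set i | i \in [set: I]%SET]) E' i =
     \bigcap_(i in [set i | i \in [set~ i0]%SET]) E i `&` B); last first.
    apply/seteqP; split=> w.
      move=> h; split; last by have := h i0 (finset.in_setT _); rewrite /E' eqxx.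
      move=> i; rewrite /= !inE => ii; have := h i (finset.in_setT _).
      by rewrite /E' (negbTE ii).
    move=> [h wB] i _; rewrite /E'; case: eqP => // /eqP ii.
    by apply: h; rewrite /= !inE.
  move=> -> ->; rewrite (bigD1 i0) ?inE//= {1}/E' eqxx muleC; congr (_ * _)%E.
  apply: eq_big => i; first by rewrite !inE.
  by rewrite /E' !inE => /negbTE ->.
- by move=> _; rewrite -ge0_fin_numE// fin_num_measure.
Qed.

Let TK := g_sigma_algebraType cyl_but.

Lemma measurable_cyl_but_id : measurable_fun setT (fun w : T => w : TK).
Proof.
move=> _ A sA; rewrite setTI; apply: (smallest_sub _ _ sA).
  exact: sigma_algebra_measurable.
exact: cyl_but_measurable.
Qed.

Variables (X : T -> Y) (law : probability Y R).
Hypothesis mX : measurable_fun setT X.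
Hypothesis FX : forall B, measurable B -> F i0 (X @^-1` B).
Hypothesis Xlaw : forall B, measurable B -> P (X @^-1` B) = law B.

Let idmx := isMeasurableFun.Build _ _ _ _ _ measurable_cyl_but_id.
Let idK : {mfun T >-> TK} := HB.pack (fun w : T => w : TK) idmx.
Let PK : probability TK R := distribution P idK.

Let psi w : TK * Y := (w, X w).

Let mpsi : measurable_fun setT psi.
Proof. by apply: measurable_fun_pair => //; exact: measurable_cyl_but_id. Qed.

Let psimx := isMeasurableFun.Build _ _ _ _ _ mpsi.
Let psiK : {mfun T >-> (TK * Y)%type} := HB.pack psi psimx.

(** The pair (w, X w), with w seen only through the other families, has the product law: by
    uniqueness of the product measure rectangles suffice, and these are [cyl_but_indep]. *)
Lemma joint_law (A : set (TK * Y)) : measurable A ->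
  P (psi @^-1` A) = (PK \x law)%E A.
Proof.
move=> mA; apply/esym.
apply: (@product_measure_unique _ _ _ _ _ PK law (distribution P psiK)) mA.
move=> B C mB mC; suff : P ((B : set T) `&` X @^-1` C) = (P B * law C)%E by [].
rewrite -Xlaw//; apply: cyl_but_indep => //.
exact: FX.
Qed.

(** Integrates X out while everything else is frozen at w. The dependence of [phi] on w must be
    measurable for the smaller sigma-algebra of [TK], which is what makes w and X w independent. *)
Lemma indep_tonelli (phi : TK * Y -> R) : measurable_fun setT phi ->
  (forall z, 0 <= phi z) ->
  rint P (fun w => phi (w, X w)) = (\int[P]_w rint law (fun y => phi (w, y)))%E.
Proof.
move=> mphi phi0; have mphi' := (measurable_EFinP _ _).2 mphi.
have phi0' z : (0 <= (phi z)%:E)%E by rewrite lee_fin.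
rewrite (rint_transfer mpsi mphi phi0 joint_law) /rint fubini_tonelli1//.
rewrite ge0_integral_distribution//.
- exact: measurable_fun_fubini_tonelli_F.
- by move=> w; exact: integral_ge0.
Qed.

Lemma indep_rint_le (phi : TK * Y -> R) (b : T -> R) : measurable_fun setT phi ->
  (forall z, 0 <= phi z) ->
  (forall w, rint law (fun y => phi (w, y)) <= (b w)%:E)%E ->
  (rint P (fun w => phi (w, X w)) <= rint P b)%E.
Proof.
move=> mphi phi0 phib; rewrite indep_tonelli//.
by apply: le_integral_any => // w; exact: rint_ge0.
Qed.

Lemma indep_rintM (f : TK -> R) (g : Y -> R) (r : R) :
  measurable_fun setT f -> measurable_fun setT g ->
  (forall w, 0 <= f w) -> (forall y, 0 <= g y) -> rint law g = r%:E ->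
  rint P (fun w => f w * g (X w)) = (r%:E * rint P f)%E.
Proof.
move=> mf mg f0 g0 gr.
rewrite (indep_tonelli (phi := fun z => f z.1 * g z.2)); last 2 first.
- apply: measurable_funM.
  + exact: (measurableT_comp mf measurable_fst).
  + exact: (measurableT_comp mg measurable_snd).
- by move=> z; rewrite mulr_ge0.
have r0 : 0 <= r by rewrite -lee_fin -gr rint_ge0.
rewrite -rintZ//; last exact: (measurableT_comp mf measurable_cyl_but_id).
by apply: eq_integral => w _; rewrite [LHS](rintZ law mg (f0 w) g0) gr -EFinM mulrC.
Qed.

End independence.

(** * Ampliations *)

Lemma trmxCE (R : realType) a b (A : 'M[R[i]]_(a, b)) i j : (A^t*) i j = (A j i)^*.
Proof. by rewrite !mxE. Qed.

Section ampliation.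
Context {R : realType} (n k : nat).
Implicit Types A B : 'M[R[i]]_n.

Lemma sum_mxtens (V : nmodType) (f : 'I_(n * k) -> V) :
  \sum_q f q = \sum_(i < n) \sum_(c < k) f (mxtens.mxtens_index (i, c)).
Proof.
rewrite pair_big (reindex (@mxtens.mxtens_index n k)) /=; last first.
  by exists (@mxtens.mxtens_unindex n k) => x _;
    [exact: mxtens.mxtens_indexK|exact: mxtens.mxtens_unindexK].
by apply: eq_bigr => -[].
Qed.

Lemma ampliationE A i j c e :
  ampliation k A (mxtens.mxtens_index (i, c)) (mxtens.mxtens_index (j, e)) =
  A i j * (c == e)%:R.
Proof. by rewrite /ampliation mxtens.tensmxE mxE. Qed.

Lemma ampliation_mul A B : ampliation k (A *m B) = ampliation k A *m ampliation k B.
Proof. by rewrite /ampliation mxtens.tensmx_mul mulmx1. Qed.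

Lemma ampliation_trmxC A : (ampliation k A)^t* = ampliation k (A^t*).
Proof.
rewrite /ampliation mxtens.trmx_tens trmx1 mxtens.map_mxT; congr mxtens.tensmx.
by rewrite map_mx1.
Qed.

Lemma ampliation1 : ampliation k (1%:M : 'M[R[i]]_n) = 1%:M.
Proof.
apply/matrixP => p q; rewrite -(mxtens.mxtens_unindexK p) -(mxtens.mxtens_unindexK q).
case: (mxtens.mxtens_unindex p) (mxtens.mxtens_unindex q) => [i c] [j e].
rewrite ampliationE !mxE (can_eq (@mxtens.mxtens_indexK n k)) xpair_eqE -natrM.
by rewrite mulnb.
Qed.

Lemma ampliationZ x A : ampliation k (x *: A) = x *: ampliation k A.
Proof. by apply/matrixP => i j; rewrite !mxE mulrA. Qed.

Lemma ampliation0 : ampliation k (0 : 'M[R[i]]_n) = 0.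
Proof. by rewrite /ampliation mxtens.tens0mx. Qed.

Lemma ampliation_tr A : \tr (ampliation k A) = k%:R * \tr A.
Proof.
rewrite /mxtrace sum_mxtens mulr_sumr; apply: eq_bigr => i _.
under eq_bigr do rewrite ampliationE eqxx mulr1.
by rewrite sumr_const card_ord mulr_natl.
Qed.

(** A (x) I acts on each of the k slices of a row separately, so the factor is [fro A] and not
    [fro (ampliation k A)], which is k times larger and would cost the decay in p. *)
Lemma fro_mul_ampliation a (v : 'M[R[i]]_(a, n * k)) A :
  fro (v *m ampliation k A) <= fro v * fro A.
Proof.
rewrite /fro mulr_suml; apply: ler_sum => i _.
rewrite !sum_mxtens exchange_big /= [X in _ <= X * _]exchange_big /= mulr_suml.
apply: ler_sum => c _; rewrite [X in _ <= _ * X]exchange_big mulr_sumr.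
apply: ler_sum => j _.
rewrite (_ : (v *m _) _ _ = \sum_(l < n) v i (mxtens.mxtens_index (l, c)) * A l j).
  exact: cauchy_schwarz_sqn.
rewrite mxE sum_mxtens; apply: eq_bigr => l _; rewrite (bigD1 c)//= big1 ?addr0.
  by rewrite ampliationE eqxx mulr1.
by move=> e ec; rewrite ampliationE (negbTE ec) mulr0 mulr0.
Qed.

Lemma fro_ampliation A : fro (ampliation k A) = k%:R * fro A.
Proof.
apply: (@complexI R); rewrite -fro_mxtrace ampliation_trmxC -ampliation_mul.
by rewrite ampliation_tr fro_mxtrace rmorphM /= rmorph_nat.
Qed.

Lemma pid_corner (B : 'M[R[i]]_(n * k)) (k0 : (0 < k)%N) (x y : 'I_n) :
  let w (z : 'I_n) := widen_ord (leq_pmulr n k0) z in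
  ((pid_mx n : 'M[R[i]]_(n, n * k)) *m B *m (pid_mx n : 'M[R[i]]_(n, n * k))^t*) x y
  = B (w x) (w y).
Proof.
move=> w.
have pidE (i : 'I_n) q : (pid_mx n : 'M[R[i]]_(n, n * k)) i q = (q == w i)%:R.
  by rewrite mxE ltn_ord andbT -val_eqE /= eq_sym.
rewrite mxE (bigD1 (w y))//= big1 ?addr0; last first.
  by move=> q qy; rewrite trmxCE pidE (negbTE qy) conjc0 mulr0.
rewrite trmxCE pidE eqxx conjc1 mulr1 mxE (bigD1 (w x))//= big1 ?addr0; last first.
  by move=> q qx; rewrite pidE (negbTE qx) mul0r.
by rewrite pidE eqxx mul1r.
Qed.

Lemma fro_pid_row (k0 : (0 < k)%N) x : fro (row x (pid_mx n : 'M[R[i]]_(n, n * k))) = 1.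
Proof.
apply: (@complexI R); rewrite -mxdiag_fro -[X in X *m _]mulmx1 (pid_corner _ k0).
by rewrite mxE eqxx.
Qed.

(** For n <= k the first n indices of ['I_(n * k)] all have first tensor coordinate 0, and their
    second coordinates are distinct. *)
Lemma pid_ampliation A (o x y : 'I_n) : val o = 0%N -> (n <= k)%N ->
  ((pid_mx n : 'M[R[i]]_(n, n * k)) *m ampliation k A *m
     (pid_mx n : 'M[R[i]]_(n, n * k))^t*) x y = A o o * (x == y)%:R.
Proof.
move=> o0 nk; have k0 : (0 < k)%N by rewrite (leq_trans _ nk)// (leq_trans _ (ltn_ord x)).
rewrite (pid_corner _ k0).
have wE (z : 'I_n) : widen_ord (leq_pmulr n k0) z =
    mxtens.mxtens_index (o, widen_ord nk z).
  by apply: val_inj; rewrite /= o0 mul0n.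
by rewrite !wE ampliationE.
Qed.

Lemma pid_ampliation_le A (k0 : (0 < k)%N) (x y : 'I_n) :
  sqn (((pid_mx n : 'M[R[i]]_(n, n * k)) *m ampliation k A *m
     (pid_mx n : 'M[R[i]]_(n, n * k))^t*) x y) <= fro A.
Proof.
rewrite (pid_corner _ k0).
rewrite -[widen_ord _ x]mxtens.mxtens_unindexK -[widen_ord _ y]mxtens.mxtens_unindexK.
case: (mxtens.mxtens_unindex _) (mxtens.mxtens_unindex _) => [i c] [j e].
rewrite ampliationE sqnM -[leRHS]mulr1; apply: ler_pM.
- exact: sqn_ge0.
- exact: sqn_ge0.
- exact: sqn_le_fro.
by case: (_ == _); rewrite ?sqn1 ?sqn0.
Qed.

End ampliation.

(** * Concentration of words in the random matrices *)

Section words.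
Context {R : realType} (m n k : nat).
Hypotheses (n0 : (0 < n)%N) (k0 : (0 < k)%N).
Local Notation p := (n * k)%N.
Local Notation C := R[i].
Implicit Types (g : 'I_m -> 'M[C]_n) (h : 'I_m -> 'M[C]_p) (S : {set 'I_m}).
Implicit Types (s r : seq 'I_m) (x y : 'I_n).

Local Notation Pn := (pid_mx n : 'M[C]_(n, p)).

Definition wprod g h S s : 'M[C]_p :=
  \prod_(i <- s | i \in S) (ampliation k (g i) *m h i).

(* Averaging out the Haar unitaries indexed by the suffix r concentrates the
   product of the r-parts of X_S and X_S'^* near the ampliation of this matrix. *)
Fixpoint dmx g S S' r : 'M[C]_n :=
  if r is j :: r' then
    if (j \in S) && (j \in S') then
      (\tr (dmx g S S' r') / n%:R) *: (g j *m (g j)^t*)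
    else if (j \in S) || (j \in S') then 0 else dmx g S S' r'
  else 1%:M.

(** The Haar estimates concern row vectors, so the corners Z are treated entry by entry. *)
Definition wrow g h S s x : 'rV[C]_p := row x (Pn *m wprod g h S s).

(** Interpolates between the entry of Z_(S, S'), when s lists all the letters and r is empty, and a
    quantity free of Haar unitaries, when s is empty: the letters of s are still random products,
    those of r have been averaged into [dmx]. *)
Definition zform g h S S' s r x y : C :=
  (wrow g h S s x *m ampliation k (dmx g S S' r) *m (wrow g h S' s y)^t*) ord0 ord0.

(** With f = [fro (g i)], the factor 1 + f^2 dominates both f (a letter in one of the sets) and f^2
    (a letter in both), so a single weight serves all the cases. *)
Definition wt g S S' s : R :=
  \prod_(i <- s | (i \in S) || (i \in S')) (1 + fro (g i) ^+ 2).

Lemma wt_ge0 g S S' s : 0 <= wt g S S' s.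
Proof. by apply: prodr_ge0 => i _; rewrite addr_ge0// sqr_ge0. Qed.

Lemma wt_cat g S S' s r : wt g S S' (s ++ r) = wt g S S' s * wt g S S' r.
Proof. by rewrite /wt big_cat. Qed.

Lemma wt_cons g S S' j r : wt g S S' (j :: r) =
  (if (j \in S) || (j \in S') then 1 + fro (g j) ^+ 2 else 1) * wt g S S' r.
Proof. by rewrite /wt big_cons; case: ifP; rewrite ?mul1r. Qed.

Lemma wrow_rcons g h S s j x : wrow g h S (rcons s j) x =
  if j \in S then wrow g h S s x *m ampliation k (g j) *m h j else wrow g h S s x.
Proof.
rewrite /wrow /wprod big_rcons /=; case: ifP => _; last first.
  by congr (row x (_ *m _)); exact: mulmx1.
by rewrite -!row_mul; congr row; rewrite -!mulmxA.
Qed.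

Lemma fro_wrow g h S s x : (forall i, h i \is unitarymx) ->
  fro (wrow g h S s x) <= \prod_(i <- s | i \in S) fro (g i).
Proof.
move=> hu; elim/last_ind: s => [|s j IH].
  rewrite /wrow /wprod !big_nil (_ : Pn *m 1 = Pn); last exact: mulmx1.
  by rewrite fro_pid_row.
rewrite wrow_rcons big_rcons /=; case: ifP => _; last by rewrite mulr1.
rewrite fro_mulmx_unitary//; apply: le_trans (fro_mul_ampliation _ _) _.
by rewrite ler_wpM2r// fro_ge0.
Qed.

Lemma prod_fro_wt g S S' s :
  (\prod_(i <- s | i \in S) fro (g i)) * (\prod_(i <- s | i \in S') fro (g i))
  <= wt g S S' s.
Proof.
elim: s => [|j s IH]; first by rewrite /wt !big_nil mulr1.
rewrite wt_cons !big_cons.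
set a := \prod_(i <- s | i \in S) _ in IH *.
set b := \prod_(i <- s | i \in S') _ in IH *.
have a0 : 0 <= a by apply: prodr_ge0 => *; exact: fro_ge0.
have b0 : 0 <= b by apply: prodr_ge0 => *; exact: fro_ge0.
have w0 := wt_ge0 g S S' s.
have f0 := fro_ge0 (g j); move: (fro (g j)) f0 => f f0.
have f1 : f <= 1 + f ^+ 2 by have := sqr_ge0 (f - 1); nra.
have ab0 : 0 <= a * b by rewrite mulr_ge0.
case: (j \in S); case: (j \in S') => /=; rewrite ?mul1r//.
- have -> : f * a * (f * b) = f ^+ 2 * (a * b) by ring.
  by apply: ler_pM; rewrite ?sqr_ge0// lerDr.
- by rewrite -mulrA; apply: ler_pM.
- by rewrite mulrCA; apply: ler_pM.
Qed.

(** The normalized trace satisfies |tr D / n|^2 <= fro D / n, so no power of n accumulates along r;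
    the single n is [fro] of the identity at the end. *)
Lemma fro_dmx g S S' r : fro (dmx g S S' r) <= n%:R * wt g S S' r.
Proof.
have nR : 1 <= n%:R :> R by rewrite ler1n.
elim: r => [|j r IH]; first by rewrite /wt big_nil mulr1 /= fro_scalar1.
rewrite wt_cons /=; have w0 := wt_ge0 g S S' r.
case: (boolP (j \in S)); case: (boolP (j \in S')) => _ _ /=; rewrite ?mul1r//.
- rewrite froZ sqnM sqn_inv_nat.
  have h1 := mxtrace_sqn_le (dmx g S S' r).
  have h2 := fro_mulmx_le (g j) ((g j)^t*); rewrite fro_trmxC -expr2 in h2.
  set f := fro (g j) in h2 *; have f0 : 0 <= f ^+ 2 by rewrite sqr_ge0.
  have -> : n%:R * ((1 + f ^+ 2) * wt g S S' r) =
    (n%:R * wt g S S' r) * (1 + f ^+ 2) by ring.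
  apply: ler_pM; last by apply: le_trans h2 _; rewrite lerDr.
  + by rewrite mulr_ge0 ?sqn_ge0 ?sqr_ge0.
  + exact: fro_ge0.
  apply: le_trans IH; rewrite exprVn ler_pdivrMr ?exprn_gt0 ?ltr0n//.
  apply: le_trans h1 _; rewrite mulrC ler_wpM2l ?fro_ge0// expr2 ler_peMr//.
- by rewrite fro0 !mulr_ge0// addr_ge0 ?sqr_ge0.
- by rewrite fro0 !mulr_ge0// addr_ge0 ?sqr_ge0.
Qed.

(** The difference is zero when n <= k. When k < n one has p <= n^2, so the right-hand side is at
    least 64 n times the weight, and the trivial bound 4 n is enough. *)
Lemma zform_nil g h S S' r (o x y : 'I_n) : val o = 0%N ->
  sqn (zform g h S S' [::] r x y - dmx g S S' r o o * (x == y)%:R) <=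
  64 * n%:R ^+ 3 / p%:R * wt g S S' r.
Proof.
move=> o0.
have -> : zform g h S S' [::] r x y =
    (Pn *m ampliation k (dmx g S S' r) *m Pn^t*) x y.
  rewrite /zform /wrow /wprod !big_nil (_ : Pn *m 1 = Pn); last exact: mulmx1.
  rewrite -row_mul [LHS]mxE [RHS]mxE; apply: eq_bigr => j _.
  by rewrite !trmxCE mxE; congr (_ * (_)^*); rewrite mxE.
have w0 := wt_ge0 g S S' r.
have n3 : 0 <= 64 * n%:R ^+ 3 / p%:R :> R.
  by rewrite divr_ge0// mulr_ge0// exprn_ge0.
have [nk|kn] := leqP n k.
  by rewrite (pid_ampliation _ _ _ o0 nk) subrr sqn0 mulr_ge0.
apply: le_trans (sqnD_le _ _) _; rewrite sqnN sqnM.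
have h1 := pid_ampliation_le (dmx g S S' r) k0 x y.
have h2 : sqn (dmx g S S' r o o) * sqn ((x == y)%:R : C) <= fro (dmx g S S' r).
  rewrite -[leRHS]mulr1; apply: ler_pM; [exact: sqn_ge0|exact: sqn_ge0|exact: sqn_le_fro|].
  by case: (_ == _); rewrite ?sqn1 ?sqn0.
apply: (@le_trans _ _ (4 * (n%:R * wt g S S' r))).
  by have := fro_dmx g S S' r; lra.
rewrite mulrA ler_wpM2r//.
have p0 : 0 < p%:R :> R by rewrite ltr0n muln_gt0 n0.
rewrite ler_pdivlMr// natrM.
have kn' : k%:R <= n%:R :> R by rewrite ler_nat ltnW.
rewrite -!mulrA; apply: ler_pM; [by []|by rewrite !mulr_ge0|by rewrite ler_nat|].
by rewrite exprS expr2 ler_wpM2l// ler_wpM2l.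
Qed.

End words.

(** * Averaging one letter of a word *)

Section word_steps.
Context {R : realType} (m n k : nat).
Hypotheses (n0 : (0 < n)%N) (k0 : (0 < k)%N).
Local Notation p := (n * k)%N.
Local Notation C := R[i].
Implicit Types (g : 'I_m -> 'M[C]_n) (h : 'I_m -> 'M[C]_p) (S : {set 'I_m}).
Implicit Types (s r : seq 'I_m) (x y : 'I_n).

(** The scalar that [dmx] extracts at j is exactly the Haar mean of the conjugate by h j, so the
    difference has the centered form bounded by [haar_conj]. *)
Lemma zform_both g h S S' s j r x y : j \in S -> j \in S' ->
  zform g h S S' (rcons s j) r x y - zform g h S S' s (j :: r) x y =
  ((wrow g h S s x *m ampliation k (g j)) *m
     (h j *m ampliation k (dmx g S S' r) *m (h j)^t* -
      (\tr (ampliation k (dmx g S S' r)) / p%:R)%:M) *m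
   (wrow g h S' s y *m ampliation k (g j))^t*) ord0 ord0.
Proof.
move=> jS jS'; rewrite /zform !wrow_rcons jS jS' /= jS jS' /=.
rewrite ampliation_tr ampliationZ ampliation_mul -ampliation_trmxC.
have -> : k%:R * \tr (dmx g S S' r) / p%:R = \tr (dmx g S S' r) / n%:R.
  by rewrite natrM [k%:R * _]mulrC -mulf_div divff ?mulr1// pnatr_eq0 -lt0n.
move: (wrow g h S s x) (wrow g h S' s y) (ampliation k (dmx g S S' r)) => a b D.
move: (ampliation k (g j)) (h j) (\tr _ / _) => A X t.
rewrite !trmxC_mul mulmxBr mulmxBl mul_mx_scalar !mulmxA.
rewrite -!scalemxAr -!scalemxAl.
rewrite [RHS]mxE [X in _ = _ + X]mxE; congr (_ - _).
by rewrite !mulmxA.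
Qed.

(** Here [dmx] vanishes on j :: r and the whole form is the error. It is linear in h j, as
    [haar_entry] requires; the case of j in S' only is its conjugate. *)
Lemma zform_left g h S S' s j r x y : j \in S -> j \notin S' ->
  zform g h S S' (rcons s j) r x y - zform g h S S' s (j :: r) x y =
  ((wrow g h S s x *m ampliation k (g j)) *m h j *m
   (wrow g h S' s y *m (ampliation k (dmx g S S' r))^t*)^t*) ord0 ord0.
Proof.
move=> jS jS'; rewrite /zform !wrow_rcons jS (negbTE jS') /= jS (negbTE jS') /=.
rewrite ampliation0 mulmx0 mul0mx [X in _ - X]mxE subr0.
by rewrite trmxC_mul trmxCK !mulmxA.
Qed.

Lemma zform_right g h S S' s j r x y : j \notin S -> j \in S' ->
  zform g h S S' (rcons s j) r x y - zform g h S S' s (j :: r) x y =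
  (((wrow g h S' s y *m ampliation k (g j)) *m h j *m
   (wrow g h S s x *m ampliation k (dmx g S S' r))^t*) ord0 ord0)^*.
Proof.
move=> jS jS'; rewrite /zform !wrow_rcons jS' (negbTE jS) /= jS' (negbTE jS) /=.
rewrite ampliation0 mulmx0 mul0mx [X in _ - X]mxE subr0.
rewrite -trmxCE; congr (_ ord0 ord0).
by rewrite [in RHS]trmxC_mul trmxCK.
Qed.

Lemma zform_none g h S S' s j r x y : j \notin S -> j \notin S' ->
  zform g h S S' (rcons s j) r x y = zform g h S S' s (j :: r) x y.
Proof.
by move=> jS jS'; rewrite /zform !wrow_rcons (negbTE jS) (negbTE jS') /= (negbTE jS) (negbTE jS').
Qed.

Context {d : measure_display} {W : measurableType d}.
Variables (g : 'I_m -> W -> 'M[C]_n) (h : 'I_m -> W -> 'M[C]_p).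

Lemma mxmeas_row a b (A : W -> 'M[C]_(a, b)) i :
  mxmeas A -> mxmeas (fun w => row i (A w)).
Proof. by move=> mA u v; under eq_fun do rewrite mxE; exact: mA. Qed.

Lemma mxmeas_wrow S s x : {in s, forall i, mxmeas (g i)} ->
  {in s, forall i, mxmeas (h i)} -> mxmeas (fun w => wrow (g^~ w) (h^~ w) S s x).
Proof.
elim/last_ind: s => [|s j IH] gs hs.
  rewrite /wrow /wprod; under eq_fun do rewrite big_nil.
  exact: mxmeas_cst.
have ms : mxmeas (fun w => wrow (g^~ w) (h^~ w) S s x).
  by apply: IH => i si; [apply: gs|apply: hs]; rewrite mem_rcons inE si orbT.
under eq_fun do rewrite wrow_rcons; case: (j \in S) => //.
apply: mxmeasM; last by apply: hs; rewrite mem_rcons inE eqxx.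
apply: mxmeasM => //; apply: mxmeas_amp; apply: gs.
by rewrite mem_rcons inE eqxx.
Qed.

Lemma mxmeas_dmx S S' r : {in r, forall i, mxmeas (g i)} ->
  mxmeas (fun w => dmx (g^~ w) S S' r).
Proof.
elim: r => [|j r IH] gr /=; first exact: mxmeas_cst.
have mr : mxmeas (fun w => dmx (g^~ w) S S' r).
  by apply: IH => i ri; apply: gr; rewrite inE ri orbT.
case: (_ && _); last by case: (_ || _) => //; exact: mxmeas_cst.
have gj : mxmeas (g j) by apply: gr; rewrite inE eqxx.
apply: mxmeasZ; last by apply: mxmeasM => //; exact: mxmeas_adj.
by apply: cmeasM; [exact: cmeas_tr|exact: cmeas_cst].
Qed.

Lemma measurable_wt S S' s : {in s, forall i, mxmeas (g i)} ->
  measurable_fun setT (fun w => wt (g^~ w) S S' s).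
Proof.
elim: s => [|j s IH] gs.
  by rewrite /wt; under eq_fun do rewrite big_nil; exact: measurable_cst.
under eq_fun do rewrite wt_cons; apply: measurable_funM.
  case: (_ || _); last exact: measurable_cst.
  apply: measurable_funD; first exact: measurable_cst.
  by apply/measurable_funX/measurable_fro/gs; rewrite inE eqxx.
by apply: IH => i si; apply: gs; rewrite inE si orbT.
Qed.

Lemma cmeas_zform S S' s r x y : {in s, forall i, mxmeas (g i)} ->
  {in s, forall i, mxmeas (h i)} -> {in r, forall i, mxmeas (g i)} ->
  cmeas (fun w => zform (g^~ w) (h^~ w) S S' s r x y).
Proof.
move=> gs hs gr; apply: mxmeasM; [apply: mxmeasM|apply: mxmeas_adj].
- exact: mxmeas_wrow.
- exact/mxmeas_amp/mxmeas_dmx.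
- exact: mxmeas_wrow.
Qed.

End word_steps.

(** * Integrating the Haar unitaries out *)

Section model.
Context {R : realType} (m n k : nat).
Hypotheses (n0 : (0 < n)%N) (k0 : (0 < k)%N).
Local Notation p := (n * k)%N.
Local Notation C := R[i].
Context {disp : measure_display} {T : measurableType disp} (P : probability T R).
Variables (G : 'I_m -> {RV P >-> cmx R n}) (H : 'I_m -> {RV P >-> cmx R p}).
Hypothesis H_law : forall i, haar_unitary (distribution P (H i)).

(** The same match as in the independence hypothesis of the theorem, so that the two are
    convertible. *)
Definition gh_events (i : 'I_m + 'I_m) : set (set T) :=
  match i with inl a => rv_events (G a) | inr b => rv_events (H b) end.

Hypothesis GH_indep : mutually_independent P gh_events.

Lemma gh_events_measurable i A : gh_events i A -> measurable A.
Proof.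
by case: i => i [B mB <-]; exact: measurable_funPT.
Qed.

Lemma gh_eventsT i : gh_events i setT.
Proof. by case: i => i; exists setT => //; rewrite setTI preimage_setT. Qed.

Lemma gh_eventsI i : setI_closed (gh_events i).
Proof.
by case: i => i _ _ [A mA <-] [B mB <-]; (exists (A `&` B); first exact: measurableI);
  rewrite !setTI preimage_setI.
Qed.

(* T equipped with the sigma-algebra of all the matrices but the i0-th one:
   Tonelli can then be applied to the pair (w, i0-th matrix). *)
Definition but (i0 : 'I_m + 'I_m) : Type := g_sigma_algebraType (cyl_but gh_events i0).
HB.instance Definition _ i0 := Measurable.on (but i0).

Lemma measurable_but_id i0 : measurable_fun setT (fun w : T => w : but i0).
Proof. exact: (measurable_cyl_but_id gh_events_measurable). Qed.

Lemma mxmeas_but_G i0 i : inl i != i0 -> mxmeas (fun w : but i0 => (G i w : 'M[C]_n)).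
Proof.
move=> ii; have mG : measurable_fun setT (fun w : but i0 => G i w).
  move=> _ B mB; rewrite setTI; apply: sub_sigma_algebra.
  apply: (cyl_but_single gh_eventsT (i := inl i)) => //.
  by exists B => //; rewrite setTI.
exact: (mxmeas_comp (mxmeas_id (R := R) (n := n)) mG).
Qed.

Lemma mxmeas_but_H i0 i : inr i != i0 -> mxmeas (fun w : but i0 => (H i w : 'M[C]_p)).
Proof.
move=> ii; have mH : measurable_fun setT (fun w : but i0 => H i w).
  move=> _ B mB; rewrite setTI; apply: sub_sigma_algebra.
  apply: (cyl_but_single gh_eventsT (i := inr i)) => //.
  by exists B => //; rewrite setTI.
exact: (mxmeas_comp (mxmeas_id (R := R) (n := p)) mH).
Qed.

Lemma mxmeas_G i : mxmeas (fun w : T => (G i w : 'M[C]_n)).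
Proof. by apply: (mxmeas_comp (mxmeas_id (R := R) (n := n))); exact: measurable_funPT. Qed.

Lemma mxmeas_H i : mxmeas (fun w : T => (H i w : 'M[C]_p)).
Proof. by apply: (mxmeas_comp (mxmeas_id (R := R) (n := p))); exact: measurable_funPT. Qed.

Lemma haar_step j (phi : but (inr j) * cmx R p -> R) (b : T -> R) :
  measurable_fun setT phi -> (forall z, 0 <= phi z) ->
  (forall w, rint (distribution P (H j)) (fun y => phi (w, y)) <= (b w)%:E)%E ->
  (rint P (fun w => phi (w, H j w)) <= rint P b)%E.
Proof.
move=> mphi phi0 phib.
apply: (indep_rint_le gh_events_measurable gh_eventsT gh_eventsI GH_indep
  (law := distribution P (H j)) _ _ _ mphi phi0 phib) => //.
by move=> B mB; exists B => //; rewrite setTI.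
Qed.

Lemma ae_unitary : {ae P, forall w, forall i, (H i w : 'M[C]_p) \is unitarymx}.
Proof.
apply: filter_forall => i.
pose B := [set U : cmx R p | (U : 'M[C]_p) \is unitarymx].
have mB : measurable B by exact: measurable_unitary.
pose A := H i @^-1` B.
have mA : measurable A by exact: measurable_funPTI.
exists (~` A); split; [exact: measurableC| |by move=> w].
have -> : P (~` A) = (1 - P A)%E by exact: probability_setC.
by rewrite (_ : P A = 1%E) ?subee//; exact: (H_law i).1.
Qed.

Section pair.
Variables (S S' : {set 'I_m}).
Let z s r x y w := zform (fun i => G i w : 'M[C]_n) (fun i => H i w : 'M[C]_p) S S' s r x y.
Let wts s w := wt (fun i => G i w : 'M[C]_n) S S' s.
Let kap : R := 64 * n%:R ^+ 3 / p%:R.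

Let p0 : (0 < p)%N. Proof. by rewrite muln_gt0 n0. Qed.

(** As j does not occur in s, the rows [a], [b] and the matrices [A], [D] do not involve H j. They
    are frozen while H j is integrated by the estimate that fits the membership of j in S and S'. *)
Lemma zform_step s j r x y : uniq (s ++ j :: r) ->
  (rint P (fun w => sqn (z (rcons s j) r x y w - z s (j :: r) x y w))%R <=
   rint P (fun w => kap * wts (s ++ j :: r) w)%R)%E.
Proof.
move=> us.
have Gs i : i \in s -> mxmeas (fun w : but (inr j) => (G i w : 'M[C]_n)).
  by move=> _; exact: mxmeas_but_G.
have Gr i : i \in r -> mxmeas (fun w : but (inr j) => (G i w : 'M[C]_n)).
  by move=> _; exact: mxmeas_but_G.
have Hs i : i \in s -> mxmeas (fun w : but (inr j) => (H i w : 'M[C]_p)).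
  move=> si; apply: mxmeas_but_H; apply/eqP => -[ij]; move: us.
  by rewrite cat_uniq => /and3P[_ /hasPn/(_ j)]; rewrite inE eqxx -ij si => /(_ isT).
pose g w := fun i => G i w : 'M[C]_n; pose h w := fun i => H i w : 'M[C]_p.
pose a w := wrow (g w) (h w) S s x; pose b w := wrow (g w) (h w) S' s y.
pose A w := ampliation k (G j w : 'M[C]_n); pose D w := ampliation k (dmx (g w) S S' r).
have ma : mxmeas (a : but (inr j) -> _) by exact: (mxmeas_wrow (W := but (inr j))).
have mb : mxmeas (b : but (inr j) -> _) by exact: (mxmeas_wrow (W := but (inr j))).
have mA : mxmeas (A : but (inr j) -> _).
  by apply: mxmeas_amp; exact: mxmeas_but_G.
have mD : mxmeas (D : but (inr j) -> _).
  by apply: mxmeas_amp; exact: (mxmeas_dmx (W := but (inr j))).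
have toT q1 q2 (F : T -> 'M[C]_(q1, q2)) : mxmeas (F : but (inr j) -> _) -> mxmeas F.
  by move=> mF; exact: (mxmeas_comp mF (measurable_but_id (i0 := inr j))).
have ma' := toT _ _ _ ma; have mb' := toT _ _ _ mb.
have mA' := toT _ _ _ mA; have mD' := toT _ _ _ mD.
have mw : measurable_fun setT (fun w => kap * wts (s ++ j :: r) w).
  apply: measurable_funM; first exact: measurable_cst.
  by apply: (measurable_wt (W := T)) => i _; exact: mxmeas_G.
have kap0 : 0 <= kap by rewrite divr_ge0// mulr_ge0// exprn_ge0.
(* Common end of the three nontrivial cases: once H j is integrated, the norms of the rows are
   replaced by weights, which is legitimate only where all the H i are unitary, hence almost
   everywhere. *)
have fin (phi : but (inr j) * cmx R p -> R) (B : T -> R) :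
    (j \in S) || (j \in S') ->
    measurable_fun setT phi -> measurable_fun setT B -> (forall z, 0 <= phi z) ->
    (forall w, sqn (z (rcons s j) r x y w - z s (j :: r) x y w) = phi (w, H j w)) ->
    (forall w, rint (distribution P (H j)) (fun y => phi (w, y)) <= (B w)%:E)%E ->
    (forall w, 0 <= B w <= 64 * n%:R / p%:R * (fro (a w) * fro (b w) *
       (1 + fro (g w j) ^+ 2) * wts r w)) ->
    (rint P (fun w => sqn (z (rcons s j) r x y w - z s (j :: r) x y w))%R <=
     rint P (fun w => kap * wts (s ++ j :: r) w)%R)%E.
  move=> jSS mphi mB phi0 phiE phiB BE.
  rewrite (_ : (fun w => sqn _) = fun w => phi (w, H j w)); last exact/funext.
  apply: le_trans (haar_step mphi phi0 phiB) _.
  apply: ae_le_rint => //.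
  - by move=> w; case/andP: (BE w).
  - by move=> w; rewrite mulr_ge0// wt_ge0.
  apply: filterS ae_unitary => w hu; case/andP: (BE w) => _ /le_trans; apply.
  apply: (@le_trans _ _ (64 * n%:R / p%:R * (wts (s ++ j :: r) w))).
    rewrite ler_wpM2l ?divr_ge0// /wts wt_cat wt_cons jSS mulrA.
    rewrite ler_wpM2r ?wt_ge0// ler_wpM2r ?addr_ge0 ?sqr_ge0//.
    apply: le_trans (prod_fro_wt _ _ _ _); apply: ler_pM; rewrite ?fro_ge0//.
    + exact: fro_wrow.
    + exact: fro_wrow.
  (* A step costs only n; the cube in [kap] stems from [zform_nil]. *)
  rewrite ler_wpM2r ?wt_ge0// ler_wpM2r ?invr_ge0// ler_wpM2l// -[leLHS]expr1.
  by rewrite ler_weXn2l// ler1n.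
have kn : n%:R * k%:R = p%:R :> R by rewrite natrM.
have pR : 0 < p%:R :> R by rewrite ltr0n.
have one_sided w (A1 B1 a1 b1 : R) : 0 <= A1 -> 0 <= B1 -> 0 <= a1 -> 0 <= b1 ->
    A1 <= a1 * fro (g w j) -> B1 <= b1 * (n%:R * wts r w) ->
    A1 * B1 / p%:R <=
    64 * n%:R / p%:R * (a1 * b1 * (1 + fro (g w j) ^+ 2) * wts r w).
  move=> A0 B0 a0 b0 hA hB.
  have w0 : 0 <= wts r w by exact: wt_ge0.
  have f1 : fro (g w j) <= 1 + fro (g w j) ^+ 2.
    by have := sqr_ge0 (fro (g w j) - 1); have := fro_ge0 (g w j); nra.
  apply: (@le_trans _ _ ((a1 * (1 + fro (g w j) ^+ 2)) * (b1 * (n%:R * wts r w)) / p%:R)).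
    rewrite ler_wpM2r ?invr_ge0//; apply: ler_pM => //.
    by apply: le_trans hA _; rewrite ler_wpM2l.
  have -> : 64 * n%:R / p%:R * (a1 * b1 * (1 + fro (g w j) ^+ 2) * wts r w) =
    64 * ((a1 * (1 + fro (g w j) ^+ 2)) * (b1 * (n%:R * wts r w)) / p%:R) by ring.
  rewrite ler_peMl ?ler1n//.
  by rewrite divr_ge0// !mulr_ge0// addr_ge0 ?sqr_ge0.
have la : mxmeas (fun z : but (inr j) * cmx R p => a z.1).
  exact: (mxmeas_comp ma measurable_fst).
have lb : mxmeas (fun z : but (inr j) * cmx R p => b z.1).
  exact: (mxmeas_comp mb measurable_fst).
have lA : mxmeas (fun z : but (inr j) * cmx R p => A z.1).
  exact: (mxmeas_comp mA measurable_fst).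
have lD : mxmeas (fun z : but (inr j) * cmx R p => D z.1).
  exact: (mxmeas_comp mD measurable_fst).
have l2 : mxmeas (fun z : but (inr j) * cmx R p => (z.2 : 'M[C]_p)).
  exact: (mxmeas_comp (mxmeas_id (R := R) (n := p)) measurable_snd).
have fa w : fro (a w *m A w) <= fro (a w) * fro (g w j) by exact: fro_mul_ampliation.
have fb w : fro (b w *m A w) <= fro (b w) * fro (g w j) by exact: fro_mul_ampliation.
have w0 w : 0 <= wts r w by exact: wt_ge0.
have f1 w : fro (g w j) <= 1 + fro (g w j) ^+ 2.
  by have := sqr_ge0 (fro (g w j) - 1); have := fro_ge0 (g w j); nra.
have [jS|jS] := boolP (j \in S); have [jS'|jS'] := boolP (j \in S').
- apply: (fin (fun z => sqn ((a z.1 *m A z.1 *m ((z.2 : 'M[C]_p) *m D z.1 *m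
      (z.2 : 'M[C]_p)^t* - (\tr (D z.1) / p%:R)%:M) *m (b z.1 *m A z.1)^t*) ord0 ord0))
    (fun w => 64 * fro (D w) / p%:R ^+ 2 * (fro (a w *m A w) * fro (b w *m A w)))).
  + by rewrite jS.
  + by mxm.
  + by repeat apply: measurable_funM => //; mxm.
  + by move=> z0; exact: sqn_ge0.
  + by move=> w; rewrite /z zform_both.
  + by move=> w; exact: (haar_conj (H_law j) (D w) (a w *m A w) (b w *m A w) p0).
  + move=> w; apply/andP; split.
      by rewrite !mulr_ge0 ?fro_ge0// invr_ge0 exprn_ge0.
    rewrite /D fro_ampliation.
    apply: (@le_trans _ _ (64 * (k%:R * (n%:R * wts r w)) / p%:R ^+ 2 *
        ((fro (a w) * fro (g w j)) * (fro (b w) * fro (g w j))))).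
      apply: ler_pM.
      * by rewrite !mulr_ge0 ?fro_ge0// invr_ge0 exprn_ge0.
      * by rewrite mulr_ge0 ?fro_ge0.
      * rewrite ler_wpM2r ?invr_ge0 ?exprn_ge0// ler_wpM2l// ler_wpM2l//.
        exact: fro_dmx.
      * by apply: ler_pM; rewrite ?fro_ge0.
    have -> : 64 * (k%:R * (n%:R * wts r w)) / p%:R ^+ 2 *
        ((fro (a w) * fro (g w j)) * (fro (b w) * fro (g w j))) =
        64 / p%:R * (fro (a w) * fro (b w) * fro (g w j) ^+ 2 * wts r w).
      by rewrite -kn; field; rewrite ?pnatr_eq0 -?lt0n ?n0 ?k0.
    apply: ler_pM.
    * by rewrite divr_ge0.
    * by rewrite !mulr_ge0 ?fro_ge0 ?sqr_ge0.
    * by rewrite ler_wpM2r ?invr_ge0// ler_peMr// ler1n.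
    * by rewrite ler_wpM2r// ler_wpM2l ?mulr_ge0 ?fro_ge0// lerDr.
- apply: (fin (fun z => sqn ((a z.1 *m A z.1 *m (z.2 : 'M[C]_p) *m
      (b z.1 *m (D z.1)^t*)^t*) ord0 ord0))
    (fun w => fro (a w *m A w) * fro (b w *m (D w)^t*) / p%:R)).
  + by rewrite jS.
  + by mxm.
  + apply: measurable_funM => //; apply: measurable_funM; mxm.
  + by move=> z0; exact: sqn_ge0.
  + by move=> w; rewrite /z zform_left.
  + by move=> w; exact: (haar_entry (H_law j) (a w *m A w) (b w *m (D w)^t*) p0).
  + move=> w; apply/andP; split.
      by rewrite !mulr_ge0 ?fro_ge0// invr_ge0.
    have fbD : fro (b w *m (D w)^t*) <= fro (b w) * (n%:R * wts r w).
      rewrite /D ampliation_trmxC; apply: le_trans (fro_mul_ampliation _ _) _.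
      by rewrite fro_trmxC ler_wpM2l ?fro_ge0// fro_dmx.
    by apply: one_sided; rewrite ?fro_ge0.
- apply: (fin (fun z => sqn ((b z.1 *m A z.1 *m (z.2 : 'M[C]_p) *m
      (a z.1 *m D z.1)^t*) ord0 ord0))
    (fun w => fro (b w *m A w) * fro (a w *m D w) / p%:R)).
  + by rewrite jS' orbT.
  + by mxm.
  + apply: measurable_funM => //; apply: measurable_funM; mxm.
  + by move=> z0; exact: sqn_ge0.
  + by move=> w; rewrite /z zform_right// sqnC.
  + by move=> w; exact: (haar_entry (H_law j) (b w *m A w) (a w *m D w) p0).
  + move=> w; apply/andP; split.
      by rewrite !mulr_ge0 ?fro_ge0// invr_ge0.
    have faD : fro (a w *m D w) <= fro (a w) * (n%:R * wts r w).
      rewrite /D; apply: le_trans (fro_mul_ampliation _ _) _.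
      by rewrite ler_wpM2l ?fro_ge0// fro_dmx.
    by rewrite (mulrC (fro (a w))); apply: one_sided; rewrite ?fro_ge0.
- apply: le_rint => w; first exact: sqn_ge0.
  by rewrite /z zform_none// subrr sqn0 mulr_ge0// wt_ge0.
Qed.

(** Telescoping: the last letter of s moves to the head of r, which leaves s ++ r, and hence the
    limit and the weight, unchanged. *)
Lemma zform_concentration s r (o x y : 'I_n) : val o = 0%N -> uniq (s ++ r) ->
  (rint P (fun w => sqn (z s r x y w -
     dmx (fun i => G i w : 'M[C]_n) S S' (s ++ r) o o * (x == y)%:R))%R <=
   rint P (fun w => 4 ^+ size s * (kap * wts (s ++ r) w))%R)%E.
Proof.
move=> o0; elim/last_ind: s r => [|s j IH] r us.
  by apply: le_rint => w; [exact: sqn_ge0|rewrite expr0 mul1r; exact: zform_nil].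
rewrite cat_rcons in us *; have IHr := IH _ us; have st := zform_step x y us.
pose d w := dmx (fun i => G i w : 'M[C]_n) S S' (s ++ j :: r) o o * (x == y)%:R.
have kap0 : 0 <= kap by rewrite divr_ge0// mulr_ge0// exprn_ge0.
have mz s' r' : cmeas (z s' r' x y).
  by apply: (cmeas_zform (W := T)) => i _; [exact: mxmeas_G|exact: mxmeas_H|exact: mxmeas_G].
have md : cmeas d.
  apply: cmeasM; last exact: cmeas_cst.
  by apply: (mxmeas_dmx (W := T)) => i _; exact: mxmeas_G.
have mB (f h : T -> C) : cmeas f -> cmeas h -> measurable_fun setT (fun w => sqn (f w - h w)).
  move=> mf mh; apply: measurable_sqn; apply: cmeasD => //.
  under eq_fun do rewrite -mulN1r; apply: cmeasM => //; exact: cmeas_cst.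
have mw : measurable_fun setT (fun w => kap * wts (s ++ j :: r) w).
  apply: measurable_funM; first exact: measurable_cst.
  by apply: (measurable_wt (W := T)) => i _; exact: mxmeas_G.
have w0 w : 0 <= kap * wts (s ++ j :: r) w by rewrite mulr_ge0// wt_ge0.
apply: (@le_trans _ _ (rint P (fun w => 2 * sqn (z (rcons s j) r x y w - z s (j :: r) x y w) +
    2 * sqn (z s (j :: r) x y w - d w)))).
  apply: le_rint => w; first exact: sqn_ge0.
  apply: le_trans (sqnD_le _ _); rewrite le_eqVlt; apply/orP; left; apply/eqP.
  by congr sqn; rewrite addrA subrK.
rewrite rintD; last 4 first.
- by apply: measurable_funM => //; exact: mB.
- by apply: measurable_funM => //; exact: mB.
- by move=> w; rewrite mulr_ge0 ?sqn_ge0.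
- by move=> w; rewrite mulr_ge0 ?sqn_ge0.
rewrite rintZ//; [|exact: mB|by move=> w; exact: sqn_ge0].
rewrite rintZ//; [|exact: mB|by move=> w; exact: sqn_ge0].
apply: (@le_trans _ _ (2%:E * rint P (fun w => kap * wts (s ++ j :: r) w)%R +
   2%:E * rint P (fun w => 4 ^+ size s * (kap * wts (s ++ j :: r) w))%R)%E).
  by apply: leeD; apply: lee_wpmul2l => //; rewrite lee_fin.
have m4 : measurable_fun setT (fun w => 4 ^+ size s * (kap * wts (s ++ j :: r) w)).
  by apply: measurable_funM.
have w4 w : 0 <= 4 ^+ size s * (kap * wts (s ++ j :: r) w).
  by rewrite mulr_ge0// exprn_ge0.
rewrite -!rintZ// -rintD//; [|exact: measurable_funM|exact: measurable_funM|
  by move=> w; rewrite mulr_ge0|by move=> w; rewrite mulr_ge0].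
apply: le_rint => w; first by rewrite addr_ge0// mulr_ge0.
rewrite size_rcons exprS.
(* Each step turns the factor 4^l into 2 + 2 * 4^l, which is at most 4^(l+1). *)
have : 1 <= 4 ^+ size s :> R by rewrite exprn_ege1// ler1n.
by have := w0 w; nra.
Qed.

End pair.

End model.

(** * Operator norm and moments of the random matrices *)

Section opnorm.
Context {R : realType}.

Lemma l2normE n (x : 'cV[R[i]]_n) : l2norm x = Num.sqrt (fro x).
Proof.
rewrite /l2norm /fro; congr Num.sqrt; apply: eq_bigr => i _; rewrite big_ord1.
by case: (x i ord0) => a b; rewrite /Normc.normc sqr_sqrtr// addr_ge0 ?sqr_ge0.
Qed.

Lemma opnorm_ub n (A : 'M[R[i]]_n) (x : 'cV[R[i]]_n) : fro x <= 1 ->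
  Num.sqrt (fro (A *m x)) <= opnorm A.
Proof.
move=> x1; apply: ub_le_sup; last first.
  exists x; last by rewrite l2normE.
  by rewrite /= l2normE -sqrtr1 ler_wsqrtr.
(* The Frobenius norm bounds the set, so its [sup] is not a default value. *)
exists (Num.sqrt (fro A)) => _ [y y1 <-]; rewrite l2normE ler_wsqrtr//.
apply: le_trans (fro_mulmx_le _ _) _; rewrite ler_piMr ?fro_ge0//.
move: y1; rewrite /= l2normE -[X in _ <= X]sqrtr1 ler_sqrt//.
Qed.

Lemma fro_delta_col n (i : 'I_n) : fro (delta_mx i 0 : 'cV[R[i]]_n) = 1.
Proof.
rewrite -fro_trmxC trmx_delta map_delta_mx.
exact: fro_delta_row.
Qed.

Lemma Re_diag_le_opnorm n (A : 'M[R[i]]_n) i c : opnorm A <= c ->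
  complex.Re (A i i) <= c.
Proof.
move=> Ac; apply: le_trans Ac; apply: le_trans (opnorm_ub (x := delta_mx i 0) A _); last first.
  by rewrite fro_delta_col.
rewrite -colE; apply: le_trans (ler_norm _) _; rewrite -sqrtr_sqr ler_wsqrtr//.
apply: le_trans (Re_sqr_le _) _.
by have := sqn_le_fro (col i A) i 0; rewrite mxE.
Qed.

Lemma fro_mul_contraction n (A : 'M[R[i]]_n) (x : 'cV[R[i]]_n) : opnorm A <= 1 ->
  fro (A *m x) <= fro x.
Proof.
move=> A1; have [x0|x0] := eqVneq (fro x) 0.
  by rewrite (fro_eq0 x0) mulmx0.
have f0 : 0 < fro x by rewrite lt_neqAle eq_sym x0 fro_ge0.
pose c := (Num.sqrt (fro x))^-1.
have c2 : c ^+ 2 = (fro x)^-1 by rewrite /c exprVn sqr_sqrtr ?fro_ge0.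
have := opnorm_ub (x := c%:C *: x) A; rewrite froZ sqnR c2 mulVf// lexx => /(_ isT).
rewrite -scalemxAr froZ sqnR c2 => /le_trans/(_ A1).
rewrite -[X in _ <= X]sqrtr1 ler_sqrt// mulrC ler_pdivrMr// mul1r//.
Qed.

(** [opnorm] acts on columns. Put w = v A: then |w|^2 is the product of v with A w^*, so
    Cauchy-Schwarz and the column bound give |w|^4 <= |v|^2 |w|^2. *)
Lemma contraction_trmxC n (A : 'M[R[i]]_n) (v : 'rV[R[i]]_n) : opnorm A <= 1 ->
  fro (v *m A) <= fro v.
Proof.
move=> A1; have := fro_mul_contraction ((v *m A)^t*) A1.
set f := fro (v *m A); rewrite fro_trmxC -/f => h.
have f0 : 0 <= f by exact: fro_ge0.
have [fz|fz] := eqVneq f 0; first by rewrite fz fro_ge0.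
have fp : 0 < f by rewrite lt_neqAle eq_sym fz.
have e : f ^+ 2 <= fro v * f.
  apply: le_trans (_ : _ <= fro v * fro (A *m (v *m A)^t*)) _; last first.
    by rewrite ler_wpM2l ?fro_ge0.
  apply: le_trans (fro_mulmx_le _ _); rewrite mulmxA fro11 mxdiag_fro.
  rewrite sqnR (_ : row 0 _ = v *m A)//.
  by apply/rowP => i; rewrite mxE.
by move: e; rewrite expr2 ler_pM2r.
Qed.

End opnorm.

(** * Moments of a single matrix G *)

Section moments.
Context {R : realType} (n : nat) (o : 'I_n).
Local Notation C := R[i].
Variable calG : probability (cmx R n) R.
Variables (c2 : R).
Hypothesis c2_ge1 : 1 <= c2.
Hypothesis GG_int : mx_integrable calG (fun g : 'M[C]_n => g *m g ^t*).
Hypothesis GG_mean : mx_expectation calG (fun g : 'M[C]_n => g *m g ^t*) = 1%:M.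
Hypothesis GG2_int : mx_integrable calG (fun g : 'M[C]_n => (g *m g ^t*) ^+ 2).
Hypothesis GG2_le : opnorm
  (mx_expectation calG (fun g : 'M[C]_n => (g *m g ^t*) ^+ 2)) <= c2.

Lemma Re_mx_expectation (F : 'M[C]_n -> 'M[C]_n) i j :
  mx_integrable calG F ->
  rint calG (fun g => complex.Re (F g i j)) = (complex.Re (mx_expectation calG F i j))%:E.
Proof.
move=> Fint; rewrite mxE /= unlock /expectation.unlock fineK//.
exact: (integrable_fin_num _ (Fint i j).1).
Qed.

Lemma rint_row i : rint calG (fun g : 'M[C]_n => fro (row i g)) = 1%:E.
Proof.
have := Re_mx_expectation i i GG_int; rewrite GG_mean mxE eqxx /= => <-.
by apply: eq_integral => g _; rewrite mxdiag_fro.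
Qed.

(** Diagonal entries are bounded by the operator norm, so this turns the hypothesis on the fourth
    moment of G into a bound on the rows of g g^*. *)
Lemma sqr_mxdiag_fro (g : 'M[C]_n) i :
  complex.Re (((g *m g^t*) ^+ 2) i i) = fro (row i (g *m g^t*)).
Proof.
have -> : (g *m g^t*) ^+ 2 = (g *m g^t*) *m (g *m g^t*)^t*.
  by rewrite trmxC_mul trmxCK.
by rewrite mxdiag_fro.
Qed.

Lemma rint_row2 i : (rint calG (fun g : 'M[C]_n => fro (row i (g *m g^t*))) <= c2%:E)%E.
Proof.
have := Re_mx_expectation i i GG2_int.
have -> : rint calG (fun g => complex.Re (((g *m g ^t*) ^+ 2) i i)) =
  rint calG (fun g : 'M[C]_n => fro (row i (g *m g^t*))).
  by apply: eq_integral => g _; rewrite sqr_mxdiag_fro.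
by move=> ->; rewrite lee_fin; exact: Re_diag_le_opnorm.
Qed.

(** The factor that one letter contributes to y_S: the normalized trace of g g^* for [true], its (o,
    o) entry for [false], which concerns the first letter of S. *)
Definition qf (b : bool) (g : 'M[C]_n) : R :=
  if b then fro g / n%:R else fro (row o g).

Lemma qf_ge0 b g : 0 <= qf b g.
Proof. by case: b; rewrite /= ?divr_ge0 ?fro_ge0. Qed.

Lemma measurable_fro_row i : measurable_fun setT (fun g : cmx R n => fro (row i (g : 'M[C]_n))).
Proof. exact/measurable_fro/mxmeas_row/mxmeas_id. Qed.

Lemma measurable_qf b : measurable_fun setT (qf b : cmx R n -> R).
Proof.
case: b => /=; last exact: measurable_fro_row.
apply: measurable_funM => //; exact/measurable_fro/mxmeas_id.
Qed.

Let n0 : (0 < n)%N. Proof. by rewrite (leq_trans _ (ltn_ord o)). Qed.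
Let nR : 0 < n%:R :> R. Proof. by rewrite ltr0n. Qed.

Lemma rint_qf b : rint calG (qf b) = 1%:E.
Proof.
case: b; last exact: rint_row.
transitivity (rint calG (fun g : 'M[C]_n => n%:R^-1 * \sum_i fro (row i g))).
  by apply: eq_integral => g _; rewrite /= mulrC fro_row.
rewrite rintZ; last 3 first.
- by apply: measurable_sum => i; exact: measurable_fro_row.
- by rewrite invr_ge0.
- by move=> g; apply: sumr_ge0 => i _; exact: fro_ge0.
rewrite rint_sum; last 2 first.
- by move=> i; exact: measurable_fro_row.
- by move=> i g; exact: fro_ge0.
under eq_bigr do rewrite rint_row.
by rewrite sumEFin sumr_const card_ord -EFinM mulVf// gt_eqF.
Qed.

Lemma fro_row_sqr_le (g : 'M[C]_n) i : fro (row i g) ^+ 2 <= fro (row i (g *m g^t*)).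
Proof.
rewrite -sqnR -mxdiag_fro.
by have := sqn_le_fro (row i (g *m g^t*)) 0 i; rewrite mxE.
Qed.

Lemma fro_sqr_le (g : 'M[C]_n) : fro g ^+ 2 <= n%:R * \sum_i fro (row i (g *m g^t*)).
Proof.
rewrite fro_row -sqnR rmorph_sum; apply: le_trans (sqn_sum_le _) _.
rewrite card_ord ler_wpM2l//; apply: ler_sum => i _.
by rewrite sqnR fro_row_sqr_le.
Qed.

Let measurable_row2 i :
  measurable_fun setT (fun g : cmx R n => fro (row i ((g : 'M[C]_n) *m (g : 'M[C]_n)^t*))).
Proof.
apply/measurable_fro/mxmeas_row/mxmeasM; first exact: mxmeas_id.
exact/mxmeas_adj/mxmeas_id.
Qed.

Lemma rint_sum_row2 :
  (rint calG (fun g : 'M[C]_n => \sum_i fro (row i (g *m g^t*)))%R <= (n%:R * c2)%:E)%E.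
Proof.
rewrite rint_sum//; last by move=> i g; exact: fro_ge0.
apply: (@le_trans _ _ (\sum_(i < n) c2%:E)%E); first by apply: lee_sum => i _; exact: rint_row2.
by rewrite sumEFin sumr_const card_ord mulr_natl.
Qed.

Lemma rint_qf_sqr b : (rint calG (fun g : 'M[C]_n => qf b g ^+ 2)%R <= c2%:E)%E.
Proof.
case: b => /=; last first.
  apply: le_trans (rint_row2 o); apply: le_rint => g; first exact: sqr_ge0.
  exact: fro_row_sqr_le.
apply: (@le_trans _ _ (rint calG (fun g : 'M[C]_n =>
    n%:R^-1 * \sum_i fro (row i (g *m g^t*)))%R)).
  apply: le_rint => g; first exact: sqr_ge0.
  rewrite exprMn exprVn ler_pdivrMr ?exprn_gt0//.
  apply: le_trans (fro_sqr_le g) _; rewrite le_eqVlt; apply/orP; left; apply/eqP.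
  by field; rewrite gt_eqF.
rewrite rintZ ?invr_ge0//; last 2 first.
- exact: measurable_sum.
- by move=> g; apply: sumr_ge0 => i _; exact: fro_ge0.
by rewrite lee_pdivrMl// -EFinM; exact: rint_sum_row2.
Qed.

Lemma rint_qfM b b' : (rint calG (fun g : 'M[C]_n => qf b g * qf b' g)%R <= c2%:E)%E.
Proof.
apply: (@le_trans _ _ (rint calG (fun g : 'M[C]_n =>
    2^-1 * qf b g ^+ 2 + 2^-1 * qf b' g ^+ 2)%R)).
  apply: le_rint => g; first by rewrite mulr_ge0// qf_ge0.
  by have := sqr_ge0 (qf b g - qf b' g); nra.
have mq b0 : measurable_fun setT (fun g : cmx R n => qf b0 g ^+ 2).
  by apply: measurable_funX; exact: (measurable_qf b0).
rewrite rintD; last 4 first.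
- exact: measurable_funM.
- exact: measurable_funM.
- by move=> g; rewrite mulr_ge0// sqr_ge0.
- by move=> g; rewrite mulr_ge0// sqr_ge0.
rewrite !rintZ//; try by move=> g; exact: sqr_ge0.
apply: (@le_trans _ _ (2^-1%:E * c2%:E + 2^-1%:E * c2%:E)%E).
  by apply: leeD; apply: lee_wpmul2l; rewrite ?lee_fin//; exact: rint_qf_sqr.
by rewrite -!EFinM -EFinD lee_fin; lra.
Qed.

Lemma rint_weight : (rint calG (fun g : 'M[C]_n => 1 + fro g ^+ 2)%R <=
  (2 * n%:R ^+ 2 * c2)%:E)%E.
Proof.
have mf : measurable_fun setT (fun g : cmx R n => fro (g : 'M[C]_n) ^+ 2).
  exact/measurable_funX/measurable_fro/mxmeas_id.
rewrite rintD//; last by move=> g; exact: sqr_ge0.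
rewrite rint_cst.
apply: (@le_trans _ _ (1%:E + (n%:R * (n%:R * c2))%:E)%E).
  rewrite leeD2l//; apply: (@le_trans _ _ (rint calG (fun g : 'M[C]_n =>
    n%:R * \sum_i fro (row i (g *m g^t*)))%R)).
    by apply: le_rint => g; [exact: sqr_ge0|exact: fro_sqr_le].
  rewrite rintZ//; last 2 first.
  - exact: measurable_sum.
  - by move=> g; apply: sumr_ge0 => i _; exact: fro_ge0.
  by rewrite EFinM lee_wpmul2l// ?rint_sum_row2// lee_fin.
rewrite -EFinD lee_fin.
have -> : n%:R * (n%:R * c2) = n%:R ^+ 2 * c2 by ring.
have -> : 2 * n%:R ^+ 2 * c2 = 2 * (n%:R ^+ 2 * c2) by ring.
have : 1 <= n%:R ^+ 2 * c2 by rewrite mulr_ege1// exprn_ege1// ler1n.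
by move: (_ * c2) => x; lra.
Qed.

End moments.

(** * The scalars y_S and their first two moments *)

Section weights.
Context {R : realType} (m n : nat) (o : 'I_n).
Local Notation C := R[i].
Implicit Types (g : 'I_m -> 'M[C]_n) (S : {set 'I_m}) (r : seq 'I_m).

(* The normalized trace (b = true) and the (o, o) entry (b = false) of
   dmx g S S r. *)
Fixpoint ysc (b : bool) g S r : R :=
  if r is j :: r' then
    if j \in S then ysc true g S r' * qf o b (g j) else ysc b g S r'
  else 1.

Lemma ysc_ge0 b g S r : 0 <= ysc b g S r.
Proof.
elim: r b => [|j r IH] b //=; case: ifP => _ //.
by rewrite mulr_ge0// qf_ge0.
Qed.

Lemma dmx_ysc g S r : \tr (dmx g S S r) / n%:R = (ysc true g S r)%:C /\
  dmx g S S r o o = (ysc false g S r)%:C.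
Proof.
have n0 : (0 < n)%N by rewrite (leq_trans _ (ltn_ord o)).
elim: r => [|j r [IH1 IH2]] /=.
  by rewrite mxtrace1 divff ?pnatr_eq0 -?lt0n// mxE eqxx.
rewrite andbb orbb; case: (j \in S) => /=; last by split.
split.
  rewrite mxtraceZ IH1 fro_mxtrace -mulrA; apply/esym.
  by rewrite /= rmorphM /= rmorphM fmorphV rmorph_nat.
by rewrite mxE IH1 mxdiag_fro -rmorphM.
Qed.

(** A letter in exactly one of the sets makes [dmx] vanish, and each step further out only rescales
    a trace or keeps the zero. *)
Lemma dmx_neq g S S' r : has (fun j => (j \in S) != (j \in S')) r ->
  dmx g S S' r = 0.
Proof.
elim: r => [|j r IH] //= /orP[|/IH ->].
  by case: (j \in S); case: (j \in S').
by case: ifP => _; [rewrite mxtrace0 mul0r scale0r|case: ifP].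
Qed.

Context {d : measure_display} {W : measurableType d} (g : 'I_m -> W -> 'M[C]_n).

Lemma measurable_ysc b S r : {in r, forall i, mxmeas (g i)} ->
  measurable_fun setT (fun w => ysc b (g^~ w) S r).
Proof.
elim: r b => [|j r IH] b gr /=; first exact: measurable_cst.
have gr' : {in r, forall i, mxmeas (g i)} by move=> i ri; apply: gr; rewrite inE ri orbT.
have gj : mxmeas (g j) by apply: gr; rewrite inE eqxx.
case: (j \in S); last exact: IH.
apply: measurable_funM; first exact: IH.
exact: (measurableT_comp (measurable_qf o b) (mx_measurable gj)).
Qed.

End weights.

Section expectations.
Context {R : realType} (m n k : nat) (o : 'I_n).
Local Notation p := (n * k)%N.
Local Notation C := R[i].
Context {disp : measure_display} {T : measurableType disp} (P : probability T R).
Variables (G : 'I_m -> {RV P >-> cmx R n}) (H : 'I_m -> {RV P >-> cmx R p}).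
Hypothesis GH_indep : mutually_independent P (gh_events G H).
Variable calG : probability (cmx R n) R.
Hypothesis G_law : forall (i : 'I_m) (A : set (cmx R n)), measurable A ->
  distribution P (G i) A = calG A.
Variable c2 : R.
Hypothesis c2_ge1 : 1 <= c2.
Hypothesis GG_int : mx_integrable calG (fun g : 'M[C]_n => g *m g ^t*).
Hypothesis GG_mean : mx_expectation calG (fun g : 'M[C]_n => g *m g ^t*) = 1%:M.
Hypothesis GG2_int : mx_integrable calG (fun g : 'M[C]_n => (g *m g ^t*) ^+ 2).
Hypothesis GG2_le : opnorm
  (mx_expectation calG (fun g : 'M[C]_n => (g *m g ^t*) ^+ 2)) <= c2.

Let Gm w : 'I_m -> 'M[C]_n := fun i => G i w.

(** Integrates G j out of a product whose other factor is measurable for the remaining matrices. *)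
Lemma g_step j (f : T -> R) (q : 'M[C]_n -> R) c :
  measurable_fun setT (f : but G H (inl j) -> R) ->
  measurable_fun setT (q : cmx R n -> R) ->
  (forall w, 0 <= f w) -> (forall g, 0 <= q g) -> rint calG q = c%:E ->
  rint P (fun w => f w * q (Gm w j)) = (c%:E * rint P f)%E.
Proof.
move=> mf mq f0 q0 qc.
apply: (indep_rintM (gh_events_measurable (G := G) (H := H)) (@gh_eventsT _ _ _ _ _ _ _ G H)
  (@gh_eventsI _ _ _ _ _ _ _ G H) GH_indep (i0 := inl j) (X := G j) (law := calG)) => //.
- by move=> B mB; exists B => //; rewrite setTI.
- by move=> B mB; rewrite -(G_law j).
Qed.

Lemma mxmeas_butG j i : i != j -> mxmeas (fun w : but G H (inl j) => (G i w : 'M[C]_n)).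
Proof.
by move=> ij; apply: mxmeas_but_G; apply: contra ij => /eqP[->].
Qed.

Let butr j r : uniq (j :: r) ->
  {in r, forall i, mxmeas (fun w : but G H (inl j) => (G i w : 'M[C]_n))}.
Proof.
move=> /= /andP[jr _] i ir; apply: mxmeas_butG; apply: contraNneq jr => <-.
by [].
Qed.

Lemma rint_ysc b S r : uniq r -> rint P (fun w => ysc o b (Gm w) S r) = 1%:E.
Proof.
elim: r b => [|j r IH] b /=; first by rewrite rint_cst.
move=> ur; have /andP[_ ur'] := ur; case: (j \in S); last exact: IH.
rewrite (g_step (j := j) (f := fun w => ysc o true (Gm w) S r) (q := qf o b) (c := 1)).
- by rewrite IH// mule1.
- exact: (measurable_ysc (W := but G H (inl j)) (g := fun i w => G i w) _ _ _ (butr ur)).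
- exact: measurable_qf.
- by move=> w; exact: ysc_ge0.
- by move=> g; exact: qf_ge0.
- exact: rint_qf.
Qed.

(** A common letter contributes a mixed second moment, at most c_2; a letter of only one set
    contributes a mean, which is 1. For disjoint sets the bound is thus 1, the product of the
    means. *)
Lemma rint_yscM b b' S S' r : uniq r ->
  (rint P (fun w => ysc o b (Gm w) S r * ysc o b' (Gm w) S' r)%R <=
   (c2 ^+ count (fun i => (i \in S) && (i \in S')) r)%:E)%E.
Proof.
elim: r b b' => [|j r IH] b b' /=; first by rewrite mulr1 rint_cst.
move=> ur; have /andP[_ ur'] := ur.
have my b0 S0 : measurable_fun setT (fun w : but G H (inl j) => ysc o b0 (Gm w) S0 r).
  exact: (measurable_ysc (W := but G H (inl j)) (g := fun i w => G i w) _ _ _ (butr ur)).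
case: (j \in S); case: (j \in S') => /=; rewrite ?add0n; [|..|exact: IH].
- have [c [c0 cc cE]] := rint_fin (fun g : cmx R n => mulr_ge0 (qf_ge0 o b g) (qf_ge0 o b' g))
    (rint_qfM o GG2_int GG2_le b b').
  rewrite (_ : (fun w => _) = (fun w => (ysc o true (Gm w) S r * ysc o true (Gm w) S' r) *
    (qf o b (Gm w j) * qf o b' (Gm w j)))); last by apply/funext => w; ring.
  rewrite (g_step (j := j) (f := fun w => ysc o true (Gm w) S r * ysc o true (Gm w) S' r)
    (q := fun g => qf o b g * qf o b' g) _ _ _ _ cE); last 4 first.
  + exact: measurable_funM.
  + by apply: measurable_funM; exact: measurable_qf.
  + by move=> w; rewrite mulr_ge0// ysc_ge0.
  + by move=> g; rewrite mulr_ge0// qf_ge0.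
  rewrite add1n exprS EFinM; apply: lee_pmul; rewrite ?lee_fin//; last exact: IH.
  by apply: rint_ge0 => w; rewrite mulr_ge0// ysc_ge0.
- rewrite (_ : (fun w => _) = (fun w => (ysc o true (Gm w) S r * ysc o b' (Gm w) S' r) *
    qf o b (Gm w j))); last by apply/funext => w; ring.
  rewrite (g_step (j := j) (f := fun w => ysc o true (Gm w) S r * ysc o b' (Gm w) S' r)
    (q := qf o b) _ _ _ _ (rint_qf o GG_int GG_mean b)); last 4 first.
  + exact: measurable_funM.
  + exact: measurable_qf.
  + by move=> w; rewrite mulr_ge0// ysc_ge0.
  + by move=> g; exact: qf_ge0.
  by rewrite mul1e; exact: IH.
- rewrite (_ : (fun w => _) = (fun w => (ysc o b (Gm w) S r * ysc o true (Gm w) S' r) *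
    qf o b' (Gm w j))); last by apply/funext => w; ring.
  rewrite (g_step (j := j) (f := fun w => ysc o b (Gm w) S r * ysc o true (Gm w) S' r)
    (q := qf o b') _ _ _ _ (rint_qf o GG_int GG_mean b')); last 4 first.
  + exact: measurable_funM.
  + exact: measurable_qf.
  + by move=> w; rewrite mulr_ge0// ysc_ge0.
  + by move=> g; exact: qf_ge0.
  by rewrite mul1e; exact: IH.
Qed.

Lemma rint_wt S S' r : uniq r ->
  (rint P (fun w => wt (Gm w) S S' r) <=
   ((2 * n%:R ^+ 2 * c2) ^+ count (fun i => (i \in S) || (i \in S')) r)%R%:E)%E.
Proof.
elim: r => [|j r IH].
  by move=> _; rewrite /wt; under eq_fun do rewrite big_nil; rewrite rint_cst.
move=> ur; have /andP[_ ur'] := ur.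
have mwr : measurable_fun setT (fun w : but G H (inl j) => wt (Gm w) S S' r).
  exact: (measurable_wt (W := but G H (inl j)) (g := fun i w => G i w) _ _ (butr ur)).
under eq_fun do rewrite wt_cons; rewrite /=; case: (_ || _); last first.
  by under eq_fun do rewrite mul1r; rewrite add0n; exact: IH.
have q0 (g : cmx R n) : 0 <= 1 + fro (g : 'M[C]_n) ^+ 2 by rewrite addr_ge0// sqr_ge0.
have [c [c0 cc cE]] := rint_fin q0 (rint_weight o c2_ge1 GG2_int GG2_le).
under eq_fun do rewrite mulrC.
rewrite (g_step (j := j) (f := fun w => wt (Gm w) S S' r)
    (q := fun g => 1 + fro g ^+ 2) _ _ _ _ cE)//; last 2 first.
- apply: measurable_funD => //; exact/measurable_funX/measurable_fro/mxmeas_id.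
- by move=> w; exact: wt_ge0.
rewrite add1n exprS EFinM; apply: lee_pmul; rewrite ?lee_fin//; last exact: IH.
by apply: rint_ge0 => w; exact: wt_ge0.
Qed.

End expectations.

(** * Polynomials of bounded norm *)

Lemma mxtrace_cycle (F : comNzRingType) n (A B C D : 'M[F]_n) :
  \tr (A *m B *m C *m D) = \tr (B *m C *m D *m A).
Proof. by rewrite -!(mulmxA A) mxtrace_mulC. Qed.

Section parseval.
Context {R : realType} (m : nat).
Local Notation C := R[i].

Definition sgn (e : {ffun 'I_m -> bool}) (i : 'I_m) : C := if e i then -1 else 1.

(** The sum over signs factors into a product over the indices, and an index in exactly one of the
    two sets gives a factor 1 - 1. *)
Lemma sgn_orthogonal (S S' : {set 'I_m}) :
  \sum_(e : {ffun 'I_m -> bool})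
    (\prod_(i in S) sgn e i) * (\prod_(i in S') sgn e i) =
  if S == S' then 2 ^+ m else 0 :> C.
Proof.
pose c i (b : bool) : C := (if i \in S then (if b then -1 else 1) else 1) *
  (if i \in S' then (if b then -1 else 1) else 1).
transitivity (\sum_(e : {ffun 'I_m -> bool}) \prod_i c i (e i)).
  apply: eq_bigr => e _; rewrite big_split /=.
  by congr (_ * _); rewrite big_mkcond.
rewrite -bigA_distr_bigA /=.
have cE i : \sum_(b : bool) c i b = if (i \in S) == (i \in S') then 2 else 0.
  rewrite big_bool /c; case: (i \in S); case: (i \in S') => /=;
    rewrite ?mulr1 ?mul1r ?mulrNN ?mulr1 ?addNr//.
case: eqVneq => [SE|/eqP SS].
  under eq_bigr do rewrite cE SE eqxx.
  by rewrite prodr_const card_ord.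
have [i iSS] : exists i, (i \in S) != (i \in S').
  apply/existsP; rewrite -negb_forall; apply/negP => /forallP h.
  by apply: SS; apply/setP => i; apply/eqP; exact: h.
by rewrite (bigD1 i)//= cE (negbTE iSS) mul0r.
Qed.

Lemma sqn_parseval (f : {set 'I_m} -> C) :
  \sum_(e : {ffun 'I_m -> bool}) sqn (\sum_(S : {set 'I_m}) (\prod_(i in S) sgn e i) * f S) =
  2 ^+ m * \sum_S sqn (f S).
Proof.
apply: (@complexI R); rewrite rmorph_sum rmorphM rmorphXn /= rmorph_nat rmorph_sum /=.
transitivity (\sum_(e : {ffun 'I_m -> bool}) \sum_(S : {set 'I_m}) \sum_(S' : {set 'I_m})
    ((\prod_(i in S) sgn e i) * (\prod_(i in S') sgn e i)) * (f S * (f S')^*)).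
  apply: eq_bigr => e _; rewrite -mulCJ rmorph_sum mulr_suml; apply: eq_bigr => S _.
  rewrite mulr_sumr; apply: eq_bigr => S' _.
  rewrite rmorphM rmorph_prod /= (_ : \prod_(i in S') (sgn e i)^* =
    \prod_(i in S') sgn e i); first by rewrite mulrACA.
  by apply: eq_bigr => i _; rewrite /sgn; case: (e i); rewrite ?rmorphN rmorph1.
rewrite exchange_big mulr_sumr; apply: eq_bigr => S _.
rewrite exchange_big (bigD1 S)//= -mulr_suml sgn_orthogonal eqxx mulCJ.
rewrite [X in _ + X]big1 ?addr0// => S' SS.
by rewrite -mulr_suml sgn_orthogonal eq_sym (negbTE SS) mul0r.
Qed.

Lemma fro_parseval a b (f : {set 'I_m} -> 'M[C]_(a, b)) :
  \sum_(e : {ffun 'I_m -> bool}) fro (\sum_(S : {set 'I_m}) (\prod_(i in S) sgn e i) *: f S) =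
  2 ^+ m * \sum_S fro (f S).
Proof.
rewrite /fro exchange_big /= [in RHS]exchange_big mulr_sumr; apply: eq_bigr => x _.
rewrite exchange_big /= [in RHS]exchange_big mulr_sumr; apply: eq_bigr => y _.
rewrite -sqn_parseval; apply: eq_bigr => e _; rewrite summxE; congr sqn.
by apply: eq_bigr => S _; rewrite mxE.
Qed.

Section poly.
Variables (n : nat) (Q : ncpoly R m n).
Hypothesis normQ : forall sigma : 'I_m -> C,
  (forall i, sigma i = -1 \/ sigma i = 1) ->
  opnorm (nceval Q (fun i => (sigma i)%:M)) <= 1.

Lemma nceval_sgn e : nceval Q (fun i => (sgn e i)%:M) =
  \sum_(S : {set 'I_m}) (\prod_(i in S) sgn e i) *: Q S.
Proof.
apply: eq_bigr => S _; rewrite -mul_mx_scalar; congr (_ *m _).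
by elim/big_rec2: _ => // i x y _ ->; rewrite -mulmxE -scalar_mxM.
Qed.

(** By Parseval the left-hand side is the average of |v Q(sigma)|^2 over the signs, and each
    Q(sigma) is a contraction. *)
Lemma sum_fro_coef_le (v : 'rV[C]_n) : \sum_S fro (v *m Q S) <= fro v.
Proof.
have h : 2 ^+ m * \sum_S fro (v *m Q S) <= 2 ^+ m * fro v.
  rewrite -fro_parseval.
  have -> : 2 ^+ m * fro v = \sum_(e : {ffun 'I_m -> bool}) fro v.
    by rewrite sumr_const card_ffun card_bool card_ord -[RHS]mulr_natl natrX.
  apply: ler_sum => e _.
  have -> : \sum_(S : {set 'I_m}) (\prod_(i in S) sgn e i) *: (v *m Q S) =
      v *m nceval Q (fun i => (sgn e i)%:M).
    by rewrite nceval_sgn mulmx_sumr; apply: eq_bigr => S _; rewrite scalemxAr.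
  apply: contraction_trmxC; apply: normQ => i.
  by rewrite /sgn; case: (e i); [left|right].
by move: h; rewrite ler_pM2l// exprn_gt0.
Qed.

Lemma sum_fro_le : \sum_S fro (Q S) <= n%:R.
Proof.
under eq_bigr do rewrite fro_row.
rewrite exchange_big /= -[X in _ <= X%:R]card_ord -sumr_const.
apply: ler_sum => i _; rewrite -(fro_delta_row (R := R) i).
by apply: le_trans (sum_fro_coef_le _); apply: ler_sum => S _; rewrite -rowE.
Qed.

Let A S := Q S *m (Q S)^t*.

Lemma quad_form_le (v : 'rV[C]_n) :
  complex.Re ((v *m (\sum_S A S) *m v^t*) 0 0) <= fro v.
Proof.
apply: le_trans (sum_fro_coef_le v); rewrite mulmx_sumr mulmx_suml summxE Re_sum.
apply: ler_sum => S _.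
have -> : v *m A S *m v^t* = (v *m Q S) *m (v *m Q S)^t*.
  by rewrite trmxC_mul !mulmxA.
rewrite mxdiag_fro /= (_ : row 0 _ = v *m Q S)//.
by apply/rowP => i; rewrite mxE.
Qed.

(** The trace inner product of [A S] and [A S'], written so that its sign is evident; being
    nonnegative, it allows second moments to be bounded term by term. *)
Definition beta S S' : R := fro ((Q S)^t* *m Q S').

Lemma beta_ge0 S S' : 0 <= beta S S'.
Proof. exact: fro_ge0. Qed.

Lemma betaC S S' : beta S S' = beta S' S.
Proof. by rewrite /beta -fro_trmxC trmxC_mul trmxCK. Qed.

Lemma beta_le S S' : beta S S' <= fro (Q S) * fro (Q S').
Proof. by apply: le_trans (fro_mulmx_le _ _) _; rewrite fro_trmxC. Qed.

Lemma fro_comb (c : {set 'I_m} -> R) :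
  fro (\sum_S (c S)%:C *: A S) = \sum_S \sum_S' c S * c S' * beta S S'.
Proof.
apply: (@complexI R); rewrite -fro_mxtrace trmxC_sum mulmx_suml raddf_sum.
rewrite rmorph_sum; apply: eq_bigr => S _.
rewrite mulmx_sumr raddf_sum rmorph_sum; apply: eq_bigr => S' _ /=.
rewrite trmxCZ -scalemxAl -scalemxAr scalerA mxtraceZ /A trmxC_mul trmxCK.
rewrite rmorphM /= rmorphM /= -[X in _ * _ * _ = _ * X]/((beta S S')%:C) /beta -fro_mxtrace.
rewrite trmxC_mul trmxCK !mulmxA; congr (_ * _ * _); first exact: conjc_real.
exact: mxtrace_cycle.
Qed.

Variable tau : R.
Hypothesis tau0 : 0 <= tau.
Hypothesis tauP : forall i, \sum_(S : {set 'I_m} | i \in S) fro (Q S) <= tau.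

(** A pair of intersecting sets shares at least one index, so the sum is at most the sum over i of
    the squared influences. One factor is bounded by [tau]; the influences add up to at most d n,
    each S being counted |S| times. *)
Lemma sum_beta_le d : (ncdegree Q <= d)%N ->
  \sum_S \sum_(S' | S :&: S' != finset.set0) beta S S' <= tau * (d%:R * n%:R).
Proof.
move=> Qd; pose f S := fro (Q S); pose a i (S : {set 'I_m}) : R := (i \in S)%:R * f S.
have f0 S : 0 <= f S by exact: fro_ge0.
have a0 i S : 0 <= a i S by rewrite mulr_ge0.
have infE i : \sum_(S : {set 'I_m} | i \in S) f S = \sum_S a i S.
  rewrite big_mkcond; apply: eq_bigr => S _; rewrite /a.
  by case: (i \in S); rewrite ?mul1r ?mul0r.
apply: (@le_trans _ _ (\sum_S \sum_S' \sum_i a i S * a i S')).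
  apply: ler_sum => S _; rewrite big_mkcond; apply: ler_sum => S' _.
  case: ifP => [/set0Pn[l]|_]; last by apply: sumr_ge0 => i _; rewrite mulr_ge0.
  rewrite inE => /andP[lS lS']; rewrite (bigD1 l)//=.
  apply: le_trans (beta_le _ _) _; rewrite /a lS lS' !mul1r lerDl.
  by apply: sumr_ge0 => j _; exact: (mulr_ge0 (a0 _ _) (a0 _ _)).
have -> : \sum_S \sum_S' \sum_i a i S * a i S' = \sum_i (\sum_S a i S) * (\sum_S a i S).
  under [RHS]eq_bigr do rewrite mulr_suml.
  rewrite [RHS]exchange_big; apply: eq_bigr => S _.
  by rewrite exchange_big; apply: eq_bigr => i _; rewrite mulr_sumr.
apply: (@le_trans _ _ (tau * \sum_i \sum_S a i S)).
  rewrite mulr_sumr; apply: ler_sum => i _; rewrite ler_wpM2r ?sumr_ge0//.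
  by rewrite -infE; exact: tauP.
rewrite ler_wpM2l// exchange_big /=.
apply: (@le_trans _ _ (\sum_S d%:R * f S)); last first.
  by rewrite -mulr_sumr ler_wpM2l// sum_fro_le.
apply: ler_sum => S _; rewrite -mulr_suml.
have [Q0|Q0] := eqVneq (Q S) 0; first by rewrite /f Q0 fro0 !mulr0.
rewrite ler_wpM2r// -natr_sum ler_nat.
have -> : (\sum_(i < m) (i \in S) = #|S|)%N.
  by rewrite -sum1_card [in RHS]big_mkcond; apply: eq_bigr => i _; case: (i \in S).
by apply: leq_trans Qd; rewrite /ncdegree (bigD1 S)//= leq_maxl.
Qed.

End poly.

End parseval.

(** * Pointwise decomposition of the truncated trace *)

Section decomposition.
Context {R : realType} (m n k : nat) (o : 'I_n).
Hypothesis k0 : (0 < k)%N.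
Local Notation p := (n * k)%N.
Local Notation C := R[i].
Variables (Q : ncpoly R m n).
Hypothesis normQ : forall sigma : 'I_m -> C,
  (forall i, sigma i = -1 \/ sigma i = 1) ->
  opnorm (nceval Q (fun i => (sigma i)%:M)) <= 1.

Local Notation Pn := (pid_mx n : 'M[C]_(n, p)).
Local Notation Pt := (pid_mx n : 'M[C]_(p, n)).
Local Notation idx := (index_enum 'I_m).
Let A S := Q S *m (Q S)^t*.
Let Y := \sum_S A S.

Lemma pid_trmxC : Pn^t* = Pt.
Proof. by rewrite tr_pid_mx map_pid_mx. Qed.

Lemma pid_mul : Pn *m Pt = 1%:M.
Proof. by rewrite pid_mx_id ?leq_pmulr// pid_mx_1. Qed.

Lemma fro_pid_mul a (M : 'M[C]_(n, a)) : fro (Pt *m M) = fro M.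
Proof.
apply: (@complexI R); rewrite -!fro_mxtrace trmxC_mul -mulmxA mxtrace_mulC.
rewrite -[Pt in X in _ *m X^t*]pid_trmxC trmxCK -!mulmxA pid_mul mulmx1.
by [].
Qed.

Lemma fro_mul_pid a (M : 'M[C]_(a, n)) : fro (M *m Pn) = fro M.
Proof. by rewrite -fro_trmxC trmxC_mul pid_trmxC fro_pid_mul fro_trmxC. Qed.

Lemma fro_mul_pidT_le a (M : 'M[C]_(a, p)) : fro (M *m Pt) <= fro M.
Proof.
rewrite /fro; apply: ler_sum => i _.
have wE (j : 'I_n) : (M *m Pt) i j = M i (widen_ord (leq_pmulr n k0) j).
  rewrite mxE (bigD1 (widen_ord (leq_pmulr n k0) j))//= big1 ?addr0.
    by rewrite mxE /= eqxx ltn_ord mulr1.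
  move=> q qj; rewrite mxE (_ : (_ == _) = false) ?mulr0//.
  by apply: contraNF qj => /eqP h; apply/eqP/val_inj.
under eq_bigr do rewrite wE.
rewrite [leRHS](bigID (fun q : 'I_p => (q < n)%N)) /=.
rewrite -[leLHS]addr0; apply: lerD; last by apply: sumr_ge0 => *; exact: sqn_ge0.
by rewrite (big_ord_narrow (leq_pmulr n k0)).
Qed.

Section fixed.
Variables (g : 'I_m -> 'M[C]_n) (h : 'I_m -> 'M[C]_p).
Let q : 'M[C]_(n, p) := \sum_S Q S *m (Pn *m wprod g h S idx).
Let X := nceval (iotapoly p Q) (fun i => ampliation k (g i) *m h i).

Lemma nceval_iota : X = Pt *m q.
Proof.
rewrite /X /nceval /q mulmx_sumr; apply: eq_bigr => S _.
by rewrite ffunE /iotamx !mulmxA.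
Qed.

(** The deviation of Z_(S, S') from its limit, a scalar matrix that is 0 for S <> S' by [dmx_neq]
    and y_S for S = S' by [dmx_ysc]. *)
Definition cov S S' : 'M[C]_n :=
  \matrix_(x, y) (zform g h S S' idx [::] x y - dmx g S S' idx o o * (x == y)%:R).
Definition err : 'M[C]_n := \sum_S \sum_S' Q S *m cov S S' *m (Q S')^t*.
Definition mainmx : 'M[C]_n := \sum_S (ysc o false g S idx)%:C *: A S.

Lemma gram_decomp : q *m q^t* = err + mainmx.
Proof.
have zE S S' : (Pn *m wprod g h S idx) *m (Pn *m wprod g h S' idx)^t* =
    cov S S' + (dmx g S S' idx o o)%:M.
  apply/matrixP => x y; rewrite [RHS]mxE [cov _ _ _ _]mxE [X in _ + X]mxE.
  rewrite mulr_natr subrK /zform /= ampliation1 mulmx1 /wrow.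
  by rewrite [LHS]mxE [RHS]mxE; apply: eq_bigr => j _; rewrite !trmxCE !mxE.
have -> : q *m q^t* = \sum_S \sum_S'
    (Q S *m cov S S' *m (Q S')^t* + dmx g S S' idx o o *: (Q S *m (Q S')^t*)).
  rewrite /q trmxC_sum mulmx_suml; apply: eq_bigr => S _.
  rewrite mulmx_sumr; apply: eq_bigr => S' _.
  transitivity (Q S *m ((Pn *m wprod g h S idx) *m (Pn *m wprod g h S' idx)^t*)
      *m (Q S')^t*).
    by move: (Pn *m wprod g h S' idx) => V; rewrite (trmxC_mul (Q S')) !mulmxA.
  rewrite zE mulmxDr mulmxDl.
  by rewrite mul_mx_scalar -scalemxAl.
under eq_bigr do rewrite big_split.
rewrite big_split /=; congr (_ + _); apply: eq_bigr => S _.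
rewrite (bigD1 S)//= (dmx_ysc o g S idx).2 big1 ?addr0// => S' SS.
rewrite dmx_neq ?mxE ?scale0r//.
apply/hasP; have [l lS] : exists l, (l \in S) != (l \in S').
  apply/existsP; rewrite -negb_forall; apply/negP => /forallP e.
  by move/eqP: SS; apply; apply/setP => i; apply/esym/eqP; exact: e.
by exists l; rewrite ?mem_index_enum.
Qed.

(** Y is placed in the upper left corner of M_p, where it stays below I because [Pt] only truncates
    row vectors. The isometries then drop out of [fro]. *)
Lemma trunc_le_dist : retr (spectral_calc (@trunc R) (absmx X)) <=
  2^-1 * fro err + 2^-1 * fro (mainmx - Y).
Proof.
apply: le_trans (retr_trunc_le_dist X (Y := Pt *m Y *m Pn) _) _.
  move=> v; have -> : v *m (Pt *m Y *m Pn) *m v^t* = (v *m Pt) *m Y *m (v *m Pt)^t*.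
    by rewrite trmxC_mul -pid_trmxC trmxCK !mulmxA.
  exact: le_trans (quad_form_le normQ _) (fro_mul_pidT_le _).
have -> : X *m X^t* - Pt *m Y *m Pn = Pt *m (err + (mainmx - Y)) *m Pn.
  rewrite nceval_iota trmxC_mul -[in X in _ *m X^t*]pid_trmxC trmxCK.
  by rewrite addrA -gram_decomp mulmxBr mulmxBl !mulmxA.
rewrite fro_mul_pid fro_pid_mul.
by have := froD_le err (mainmx - Y); lra.
Qed.

(** The trace of [err] is at most the square root of n [fro err]; the parameter s linearizes this
    root, so that only the integral of [fro err] is required. It will be p^(-1/2). *)
Lemma trunc_le_trace (s : R) : 0 < s ->
  retr (spectral_calc (@trunc R) (absmx X)) <=
  2^-1 * (n%:R * s + fro err / s) + \sum_S fro (Q S) * ysc o false g S idx.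
Proof.
move=> s0; apply: le_trans (retr_trunc_le_fro _) _.
rewrite nceval_iota fro_pid_mul.
have -> : fro q = complex.Re (\tr (err + mainmx)) by rewrite -gram_decomp fro_mxtrace.
rewrite raddfD /= ReD; apply: lerD; last first.
  rewrite /mainmx (raddf_sum (@mxtrace C n)) /= Re_sum; apply: ler_sum => S _.
  by rewrite mxtraceZ fro_mxtrace -rmorphM /= mulrC.
have h1 := le_trans (Re_sqr_le _) (mxtrace_sqn_le err).
set x := complex.Re _ in h1 *; have e0 := fro_ge0 err.
set a := n%:R * s; set b := fro err / s.
have ab : x ^+ 2 <= a * b.
  by rewrite /a /b mulrACA divff ?gt_eqF// mulr1.
have a0 : 0 <= a by rewrite mulr_ge0// ltW.
have b0 : 0 <= b by rewrite divr_ge0// ltW.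
apply: le_trans (ler_norm _) _.
rewrite -(@ler_pXn2r _ 2) ?nnegrE ?mulr_ge0 ?addr_ge0// real_normK ?num_real//.
by have := sqr_ge0 (a - b); nra.
Qed.

(** Pairs with a vanishing coefficient are discarded: the remaining sets have at most d elements, so
    the power of c_2 in the error depends on d and not on m. *)
Lemma fro_err_le : fro err <= #|{: {set 'I_m} * {set 'I_m}}|%:R * n%:R ^+ 2 *
  \sum_(SS : {set 'I_m} * {set 'I_m} | (Q SS.1 != 0) && (Q SS.2 != 0))
     fro (cov SS.1 SS.2).
Proof.
rewrite /err pair_big /=; apply: le_trans (fro_sum_le _) _.
rewrite -mulrA ler_wpM2l// [X in _ <= _ * X]big_mkcond mulr_sumr.
apply: ler_sum => -[S S'] _ /=.
have Qn S0 : fro (Q S0) <= n%:R.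
  apply: le_trans (sum_fro_le normQ); rewrite (bigD1 S0)//= lerDl.
  by apply: sumr_ge0 => *; exact: fro_ge0.
case: ifP => [_|].
  apply: le_trans (fro_mulmx_le _ _) _; rewrite fro_trmxC.
  apply: (@le_trans _ _ (fro (Q S) * fro (cov S S') * fro (Q S'))).
    by rewrite ler_wpM2r ?fro_ge0// fro_mulmx_le.
  have -> : n%:R ^+ 2 * fro (cov S S') = n%:R * fro (cov S S') * n%:R by ring.
  apply: ler_pM; rewrite ?mulr_ge0 ?fro_ge0//.
  by rewrite ler_wpM2r ?fro_ge0.
move=> /negbT; rewrite negb_and !negbK => /orP[]/eqP ->.
  by rewrite !mul0mx fro0 mulr0.
by rewrite trmx0 map_mx0 mulmx0 fro0 mulr0.
Qed.

(** The expansion of a squared distance, with its negative term moved to the left: every term is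
    then nonnegative and can be integrated without an integrability proof. *)
Lemma fro_main_dist : fro (mainmx - Y) +
  2 * \sum_S \sum_S' ysc o false g S idx * beta Q S S' =
  \sum_S \sum_S' ysc o false g S idx * ysc o false g S' idx * beta Q S S' +
  \sum_S \sum_S' beta Q S S'.
Proof.
set y := fun S => ysc o false g S idx.
have -> : mainmx - Y = \sum_S (y S - 1)%:C *: A S.
  rewrite /mainmx /Y -sumrB; apply: eq_bigr => S _.
  by rewrite rmorphB /= rmorph1 scalerBl scale1r.
rewrite fro_comb mulrDl mul1r.
rewrite [X in _ + (_ + X)]exchange_big -!big_split /=; apply: eq_bigr => S _.
rewrite -!big_split /=; apply: eq_bigr => S' _.
by rewrite (betaC Q S' S) -/(y S) -/(y S'); ring.
Qed.

End fixed.

End decomposition.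

(** * The integrated bounds *)

Section integrals.
Context {R : realType} (m n k : nat) (o : 'I_n).
Hypotheses (o0 : val o = 0%N) (n0 : (0 < n)%N) (k0 : (0 < k)%N).
Local Notation p := (n * k)%N.
Local Notation C := R[i].
Variables (Q : ncpoly R m n) (d : nat).
Hypothesis degQ : (ncdegree Q <= d)%N.
Hypothesis normQ : forall sigma : 'I_m -> C,
  (forall i, sigma i = -1 \/ sigma i = 1) ->
  opnorm (nceval Q (fun i => (sigma i)%:M)) <= 1.
Variable tau : R.
Hypothesis tau0 : 0 <= tau.
Hypothesis tauP : forall i, \sum_(S : {set 'I_m} | i \in S) fro (Q S) <= tau.
Variable calG : probability (cmx R n) R.
Variable c2 : R.
Hypothesis c2_ge1 : 1 <= c2.
Hypothesis GG_int : mx_integrable calG (fun g : 'M[C]_n => g *m g ^t*).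
Hypothesis GG_mean : mx_expectation calG (fun g : 'M[C]_n => g *m g ^t*) = 1%:M.
Hypothesis GG2_int : mx_integrable calG (fun g : 'M[C]_n => (g *m g ^t*) ^+ 2).
Hypothesis GG2_le : opnorm
  (mx_expectation calG (fun g : 'M[C]_n => (g *m g ^t*) ^+ 2)) <= c2.
Context {disp : measure_display} {T : measurableType disp} (P : probability T R).
Variables (G : 'I_m -> {RV P >-> cmx R n}) (H : 'I_m -> {RV P >-> cmx R p}).
Hypothesis G_law : forall (i : 'I_m) (A : set (cmx R n)), measurable A ->
  distribution P (G i) A = calG A.
Hypothesis H_law : forall i, haar_unitary (distribution P (H i)).
Hypothesis GH_indep : mutually_independent P (gh_events G H).

Local Notation idx := (index_enum 'I_m).
Let g w : 'I_m -> 'M[C]_n := fun i => G i w.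
Let h w : 'I_m -> 'M[C]_p := fun i => H i w.
Let A S := Q S *m (Q S)^t*.
Let Y := \sum_S A S.

(** The factors come from the telescoping, from [kap], and from the part of [rint_wt] that does not
    involve c_2. Only m and n enter. *)
Let C0 : R := 4 ^+ size idx * (64 * n%:R ^+ 3) * (2 * n%:R ^+ 2) ^+ size idx.
Definition err_const : R :=
  #|{: {set 'I_m} * {set 'I_m}}|%:R * n%:R ^+ 2 *
  (#|{: {set 'I_m} * {set 'I_m}}|%:R * (n%:R * (n%:R * C0))).

Lemma count_mem_card (S : {set 'I_m}) : count (fun i => i \in S) idx = #|S|.
Proof. by rewrite -sum1_count sum1_card. Qed.

Lemma card_deg S : Q S != 0 -> (#|S| <= d)%N.
Proof.
by move=> QS; apply: leq_trans degQ; rewrite /ncdegree (bigD1 S)//= leq_maxl.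
Qed.

Lemma cmeas_cov S S' x y : cmeas (fun w => cov o (g w) (h w) S S' x y).
Proof.
under eq_fun do rewrite mxE.
apply: cmeasD.
  by apply: (cmeas_zform (W := T)) => i _; [exact: mxmeas_G|exact: mxmeas_H|exact: mxmeas_G].
under eq_fun do rewrite -mulN1r; apply: cmeasM; first exact: cmeas_cst.
apply: cmeasM; last exact: cmeas_cst.
by apply: (mxmeas_dmx (W := T)) => i _; exact: mxmeas_G.
Qed.

Lemma C0_ge0 : 0 <= C0.
Proof. by rewrite !mulr_ge0// exprn_ge0// mulr_ge0// exprn_ge0. Qed.

Lemma err_const_ge0 : 0 <= err_const.
Proof. by rewrite !mulr_ge0 ?C0_ge0// exprn_ge0. Qed.

Lemma rint_cov S S' : Q S != 0 -> Q S' != 0 ->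
  (rint P (fun w => fro (cov o (g w) (h w) S S')) <=
   (n%:R * (n%:R * C0) * c2 ^+ (2 * d) / p%:R)%:E)%E.
Proof.
move=> QS QS'; have p0 : 0 < p%:R :> R by rewrite ltr0n muln_gt0 n0.
have cnt : (count (fun i => (i \in S) || (i \in S')) idx <= 2 * d)%N.
  have := count_predUI (mem S) (mem S') idx.
  rewrite !count_mem_card => e; rewrite mul2n -addnn.
  apply: leq_trans (_ : _ <= #|S| + #|S'|)%N _; last by rewrite leq_add// card_deg.
  by rewrite -e; apply: leq_trans (leq_addr _ _).
have entry x y : (rint P (fun w => sqn (cov o (g w) (h w) S S' x y)) <=
    (C0 * c2 ^+ (2 * d) / p%:R)%:E)%E.
  have u : uniq (idx ++ [::]) by rewrite cats0 index_enum_uniq.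
  have zc := zform_concentration n0 k0 H_law GH_indep S S' x y o0 u.
  rewrite (_ : (fun w => sqn _) = (fun w => sqn (zform (g w) (h w) S S' idx [::] x y -
    dmx (g w) S S' (idx ++ [::]) o o * (x == y)%:R))); last first.
    by apply/funext => w; rewrite mxE cats0.
  apply: le_trans zc _; rewrite cats0.
  have mw : measurable_fun setT (fun w => wt (g w) S S' idx).
    by apply: (measurable_wt (W := T)) => i _; exact: mxmeas_G.
  have kap0 : 0 <= 64 * n%:R ^+ 3 / p%:R :> R by rewrite divr_ge0// mulr_ge0// exprn_ge0.
  rewrite rintZ; last 3 first.
  - by apply: measurable_funM.
  - by rewrite exprn_ge0.
  - by move=> w; rewrite mulr_ge0// wt_ge0.
  rewrite rintZ//; last by move=> w; exact: wt_ge0.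
  apply: (@le_trans _ _ ((4 ^+ size idx)%:E * ((64 * n%:R ^+ 3 / p%:R)%:E *
      ((2 * n%:R ^+ 2) ^+ size idx * c2 ^+ (2 * d))%:E))%E); last first.
    rewrite -!EFinM lee_fin /C0 le_eqVlt; apply/orP; left; apply/eqP.
    by ring.
  rewrite lee_wpmul2l ?lee_fin ?exprn_ge0// lee_wpmul2l ?lee_fin//.
  apply: le_trans (rint_wt o GH_indep G_law c2_ge1 GG2_int GG2_le S S' _) _.
    exact: index_enum_uniq.
  (* The two bases are treated differently: the exponent of 2 n^2 is raised to m, to go into the
     constant, while that of c_2 must stay at most 2 d. *)
  rewrite lee_fin exprMn; apply: ler_pM; rewrite ?exprn_ge0 ?mulr_ge0 ?exprn_ge0//.
  - exact: le_trans c2_ge1.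
  - apply: ler_weXn2l; last exact: count_size.
    by rewrite mulr_ege1// ?ler1n// exprn_ege1// ler1n.
  - exact: ler_weXn2l.
rewrite /fro rint_sum; last 2 first.
- by move=> x; apply: measurable_sum => y; exact/measurable_sqn/cmeas_cov.
- by move=> x w; apply: sumr_ge0 => y _; exact: sqn_ge0.
apply: (@le_trans _ _ (\sum_(x < n) \sum_(y < n) (C0 * c2 ^+ (2 * d) / p%:R)%:E)%E).
  apply: lee_sum => x _; rewrite rint_sum; last 2 first.
  - by move=> y; exact/measurable_sqn/cmeas_cov.
  - by move=> y w; exact: sqn_ge0.
  by apply: lee_sum => y _; exact: entry.
under eq_bigr do rewrite sumEFin; rewrite sumEFin lee_fin !sumr_const !card_ord.
rewrite -mulrnA -[leLHS]mulr_natl natrM le_eqVlt; apply/orP; left; apply/eqP.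
by ring.
Qed.

Lemma rint_err : (rint P (fun w => fro (err o Q (g w) (h w))) <=
  (err_const * (c2 ^+ (2 * d) / p%:R))%:E)%E.
Proof.
set N2 := #|{: {set 'I_m} * {set 'I_m}}|.
pose D := [seq SS <- index_enum ({set 'I_m} * {set 'I_m})%type | (Q SS.1 != 0) && (Q SS.2 != 0)].
have K0 : 0 <= n%:R * (n%:R * C0) * c2 ^+ (2 * d) / p%:R.
  by rewrite divr_ge0// !mulr_ge0 ?C0_ge0// exprn_ge0// (le_trans _ c2_ge1).
have mc SS : measurable_fun setT (fun w => fro (cov o (g w) (h w) SS.1 SS.2)).
  by apply: measurable_fro => x y; exact: cmeas_cov.
apply: (@le_trans _ _ (rint P (fun w => N2%:R * n%:R ^+ 2 *
    \sum_(SS <- D) fro (cov o (g w) (h w) SS.1 SS.2)))).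
  apply: le_rint => w; first exact: fro_ge0.
  by apply: le_trans (fro_err_le o normQ (g w) (h w)) _; rewrite /D big_filter.
rewrite rintZ; last 3 first.
- exact: measurable_sum.
- by rewrite mulr_ge0// exprn_ge0.
- by move=> w; apply: sumr_ge0 => *; exact: fro_ge0.
rewrite rint_sum//; last by move=> SS w; exact: fro_ge0.
apply: (@le_trans _ _ ((N2%:R * n%:R ^+ 2)%:E *
   (N2%:R * (n%:R * (n%:R * C0) * c2 ^+ (2 * d) / p%:R))%:E)%E); last first.
  rewrite -EFinM lee_fin /err_const -/N2 le_eqVlt; apply/orP; left; apply/eqP.
  by ring.
rewrite lee_wpmul2l ?lee_fin ?mulr_ge0 ?exprn_ge0//.
apply: (@le_trans _ _ (\sum_(SS <- D) (n%:R * (n%:R * C0) * c2 ^+ (2 * d) / p%:R)%:E)%E).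
  rewrite !big_filter; apply: lee_sum => -[S S'] /andP[/= QS QS'].
  exact: rint_cov.
rewrite /D big_filter [leLHS]big_mkcond /=.
apply: (@le_trans _ _ (\sum_(SS : {set 'I_m} * {set 'I_m})
  (n%:R * (n%:R * C0) * c2 ^+ (2 * d) / p%:R)%:E)%E).
  by apply: lee_sum => SS _; case: ifP => //; rewrite lee_fin.
by rewrite sumEFin lee_fin sumr_const -[leLHS]mulr_natl.
Qed.

Let y S w := ysc o false (g w) S idx.
Let cnt (S S' : {set 'I_m}) := count (fun i => (i \in S) && (i \in S')) idx.

Let measurable_y S : measurable_fun setT (y S).
Proof.
apply: (@measurable_ysc _ _ _ o _ T (fun i w => G i w : 'M[C]_n) false S idx) => i _.
exact: mxmeas_G.
Qed.

Let measurable_main : measurable_fun setT (fun w => fro (mainmx o Q (g w) - Y)).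
Proof.
apply: measurable_fro; apply: mxmeasB; last exact: mxmeas_cst.
apply: mxmeas_sum => S; apply: mxmeasZ; last exact: mxmeas_cst.
by split; [exact: measurable_y|exact: measurable_cst].
Qed.

Lemma rint_main : (rint P (fun w => fro (mainmx o Q (g w) - Y)%R) <=
  (c2 ^+ d * (tau * (d%:R * n%:R)))%:E)%E.
Proof.
have my := measurable_y.
have y0 S w : 0 <= y S w by exact: ysc_ge0.
have b0 := beta_ge0 Q.
have ub := index_enum_uniq 'I_m.
have mm := measurable_main.
pose B := \sum_S \sum_S' beta Q S S'.
have B0 : 0 <= B by apply: sumr_ge0 => S _; apply: sumr_ge0.
have e1 : rint P (fun w => fro (mainmx o Q (g w) - Y) +
      2 * \sum_S \sum_S' y S w * beta Q S S') =
    (rint P (fun w => fro (mainmx o Q (g w) - Y)%R) + (2 * B)%:E)%E.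
  rewrite rintD//; last 3 first.
  - apply: measurable_funM => //; apply: measurable_sum => S.
    by apply: measurable_sum => S'; apply: measurable_funM.
  - by move=> w; exact: fro_ge0.
  - move=> w; rewrite mulr_ge0//; apply: sumr_ge0 => S _; apply: sumr_ge0 => S' _.
    by rewrite mulr_ge0.
  congr (_ + _)%E; rewrite rintZ//; last 2 first.
  - by apply: measurable_sum => S; apply: measurable_sum => S'; apply: measurable_funM.
  - move=> w; apply: sumr_ge0 => S _; apply: sumr_ge0 => S' _; by rewrite mulr_ge0.
  rewrite EFinM; congr (_ * _)%E; rewrite rint_sum; last 2 first.
  - by move=> S; apply: measurable_sum => S'; apply: measurable_funM.
  - by move=> S w; apply: sumr_ge0 => S' _; rewrite mulr_ge0.
  rewrite /B -sumEFin; apply: eq_bigr => S _; rewrite rint_sum; last 2 first.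
  - by move=> S'; apply: measurable_funM.
  - by move=> S' w; rewrite mulr_ge0.
  rewrite -sumEFin; apply: eq_bigr => S' _.
  under eq_fun do rewrite mulrC; rewrite rintZ//.
  by rewrite (rint_ysc o GH_indep G_law GG_int GG_mean false S ub) mule1.
have e2 : (rint P (fun w => \sum_S \sum_S' y S w * y S' w * beta Q S S' + B)%R <=
    (\sum_S \sum_S' c2 ^+ cnt S S' * beta Q S S' + B)%:E)%E.
  rewrite rintD//; last 2 first.
  - apply: measurable_sum => S; apply: measurable_sum => S'.
    by apply: measurable_funM => //; apply: measurable_funM.
  - move=> w; apply: sumr_ge0 => S _; apply: sumr_ge0 => S' _; by rewrite !mulr_ge0.
  rewrite rint_cst EFinD leeD2r// rint_sum; last 2 first.
  - move=> S; apply: measurable_sum => S'.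
    by apply: measurable_funM => //; apply: measurable_funM.
  - by move=> S w; apply: sumr_ge0 => S' _; rewrite !mulr_ge0.
  rewrite -sumEFin; apply: lee_sum => S _; rewrite rint_sum; last 2 first.
  - by move=> S'; apply: measurable_funM => //; apply: measurable_funM.
  - by move=> S' w; rewrite !mulr_ge0.
  rewrite -sumEFin; apply: lee_sum => S' _.
  under eq_fun do rewrite mulrC; rewrite rintZ//; last 2 first.
  - by apply: measurable_funM.
  - by move=> w; rewrite mulr_ge0.
  rewrite [X in (_ <= X%:E)%E]mulrC [leRHS]EFinM lee_wpmul2l ?lee_fin//.
  exact: (rint_yscM o GH_indep G_law GG_int GG_mean GG2_int GG2_le false false S S' ub).
have e3 : (rint P (fun w => fro (mainmx o Q (g w) - Y)%R) + (2 * B)%:E <=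
    (\sum_S \sum_S' c2 ^+ cnt S S' * beta Q S S' + B)%:E)%E.
  rewrite -e1; apply: le_trans e2; rewrite le_eqVlt; apply/orP; left; apply/eqP.
  by apply: eq_integral => w _; rewrite fro_main_dist.
move: e3; rewrite -leeBrDr// => /le_trans; apply; rewrite -EFinB lee_fin.
apply: le_trans (_ : _ <= c2 ^+ d * \sum_S \sum_(S' | S :&: S' != finset.set0) beta Q S S') _; last first.
  by rewrite ler_wpM2l ?exprn_ge0 ?(le_trans _ c2_ge1)// (sum_beta_le normQ tau0 tauP).
(* Of the two copies of [B] on the left of [e3], one cancels that on the right; the other pays for
   the disjoint pairs, whose power of c_2 is 1. Intersecting pairs cost at most c_2^d each. *)
suff : \sum_S \sum_S' c2 ^+ cnt S S' * beta Q S S' <=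
    c2 ^+ d * (\sum_S \sum_(S' | S :&: S' != finset.set0) beta Q S S') + B.
  by move: (\sum_S _) (\sum_S \sum_(_ | _) _) (B) => u v t; lra.
rewrite /B mulr_sumr -big_split; apply: ler_sum => S _ /=.
rewrite [X in _ <= _ * X + _]big_mkcond mulr_sumr -big_split; apply: ler_sum => S' _ /=.
have [Q0|Q0] := eqVneq (Q S) 0.
  have -> : beta Q S S' = 0 by rewrite /beta Q0 trmx0 map_mx0 mul0mx fro0.
  by rewrite if_same !mulr0 addr0.
have cE : cnt S S' = #|S :&: S'|.
  by rewrite -count_mem_card; apply: eq_count => i; rewrite inE.
case: ifP => [_|/negbFE/eqP SS]; last by rewrite cE SS cards0 expr0 mul1r mulr0 add0r.
rewrite cE; apply: le_trans (_ : _ <= c2 ^+ d * beta Q S S') _; last by rewrite lerDl.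
rewrite ler_wpM2r// ler_weXn2l//; apply: leq_trans (card_deg Q0).
exact/subset_leq_card/subsetIl.
Qed.

Let F w : R := n%:R^-1 * retr (spectral_calc (@trunc R)
  (absmx (nceval (iotapoly p Q) (fun i => ampliation k (g w i) *m h w i)))).
Let nR : 0 < n%:R :> R. Proof. by rewrite ltr0n. Qed.

Let F_ge0 w : 0 <= F w.
Proof. by rewrite mulr_ge0 ?invr_ge0// retr_trunc_ge0. Qed.

Let measurable_err : measurable_fun setT (fun w => fro (err o Q (g w) (h w))).
Proof.
apply: measurable_fro; apply: mxmeas_sum => S; apply: mxmeas_sum => S'.
apply: mxmeasM; last exact: mxmeas_cst.
by apply: mxmeasM; [exact: mxmeas_cst|move=> x z; exact: cmeas_cov].
Qed.

Lemma rint_trunc_dist : (rint P F <=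
  (n%:R^-1 * (2^-1 * (err_const * (c2 ^+ (2 * d) / p%:R)) +
              2^-1 * (c2 ^+ d * (tau * (d%:R * n%:R)))))%:E)%E.
Proof.
apply: (@le_trans _ _ (rint P (fun w => n%:R^-1 *
    (2^-1 * fro (err o Q (g w) (h w)) + 2^-1 * fro (mainmx o Q (g w) - Y))))).
  apply: le_rint => // w; rewrite /F ler_pM2l ?invr_gt0//.
  exact: trunc_le_dist.
rewrite rintZ ?invr_ge0//; last 2 first.
- by apply: measurable_funD; apply: measurable_funM.
- by move=> w; rewrite addr_ge0 ?mulr_ge0 ?fro_ge0.
rewrite [leRHS]EFinM lee_wpmul2l ?lee_fin ?invr_ge0//.
rewrite rintD; last 4 first.
- exact: measurable_funM.
- exact: measurable_funM.
- by move=> w; rewrite mulr_ge0 ?fro_ge0.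
- by move=> w; rewrite mulr_ge0 ?fro_ge0.
rewrite EFinD; apply: leeD.
  rewrite rintZ//; last by move=> w; exact: fro_ge0.
  by rewrite [leRHS]EFinM lee_wpmul2l ?lee_fin// rint_err.
rewrite rintZ//; last by move=> w; exact: fro_ge0.
by rewrite [leRHS]EFinM lee_wpmul2l ?lee_fin// rint_main.
Qed.

Lemma rint_trunc_trace (s : R) : 0 < s -> (rint P F <=
  (n%:R^-1 * (2^-1 * (n%:R * s + err_const * (c2 ^+ (2 * d) / p%:R) / s) + n%:R))%:E)%E.
Proof.
move=> s0; have y0 S w : 0 <= y S w by exact: ysc_ge0.
have ub := index_enum_uniq 'I_m.
apply: (@le_trans _ _ (rint P (fun w => n%:R^-1 *
    ((2^-1 * (n%:R * s) + (2^-1 / s) * fro (err o Q (g w) (h w))) +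
     \sum_S fro (Q S) * y S w)))).
  apply: le_rint => // w; rewrite /F ler_pM2l ?invr_gt0//.
  apply: le_trans (trunc_le_trace o k0 Q (g w) (h w) s0) _.
  by rewrite lerD2r mulrDr lerD2l -mulrA [X in _ <= _ * X]mulrC.
have me : measurable_fun setT (fun w => (2^-1 / s) * fro (err o Q (g w) (h w))).
  exact: measurable_funM.
have mS S : measurable_fun setT (fun w => fro (Q S) * y S w) by exact: measurable_funM.
have e0 w : 0 <= (2^-1 / s) * fro (err o Q (g w) (h w)).
  by rewrite mulr_ge0 ?fro_ge0// divr_ge0// ltW.
have S0 S w : 0 <= fro (Q S) * y S w by rewrite mulr_ge0 ?fro_ge0.
have ns0 : 0 <= 2^-1 * (n%:R * s) by rewrite !mulr_ge0// ltW.
rewrite rintZ ?invr_ge0//; last 2 first.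
- by apply: measurable_funD; [apply: measurable_funD|apply: measurable_sum].
- by move=> w; rewrite !addr_ge0 ?sumr_ge0.
rewrite [leRHS]EFinM lee_wpmul2l ?lee_fin ?invr_ge0//.
rewrite rintD; last 4 first.
- exact: measurable_funD.
- exact: measurable_sum.
- by move=> w; rewrite addr_ge0.
- by move=> w; rewrite sumr_ge0.
rewrite [leRHS]EFinD; apply: leeD; last first.
  rewrite rint_sum//; apply: le_trans (_ : _ <= (\sum_S fro (Q S))%:E)%E _; last first.
    by rewrite lee_fin sum_fro_le.
  rewrite -sumEFin; apply: lee_sum => S _; rewrite rintZ ?fro_ge0//.
  by rewrite (rint_ysc o GH_indep G_law GG_int GG_mean false S ub) mule1.
rewrite rintD// rint_cst mulrDr [leRHS]EFinD leeD2l// rintZ//; last 2 first.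
- by rewrite divr_ge0// ltW.
- by move=> w; exact: fro_ge0.
rewrite [X in (_ <= X%:E)%E](_ : _ = 2^-1 / s * (err_const * (c2 ^+ (2 * d) / p%:R))); last by ring.
rewrite [leRHS]EFinM lee_wpmul2l ?rint_err// lee_fin divr_ge0// ltW//.
Qed.

End integrals.

(** * The inequality *)

(** If K z^2 <= K^3 / u^2, the second term suffices. Otherwise K < z u, so K z^2 s <= z^3 u, which
    fits in the first. It is used with z = c_2^d, u = tau^(1/6) and s = p^(-1/2). *)
Lemma amgm_absorb (R : realType) (K z u s : R) : 1 <= K -> 1 <= z -> 0 < u ->
  0 <= s -> s <= 1 ->
  K * z ^+ 2 * s <= 4 * z ^+ 9 * u + K ^+ 3 * ((u ^+ 2)^-1 * s).
Proof.
move=> K1 z1 u0 s0 s1.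
have K0 : 0 < K by lra.
have z0 : 0 < z by lra.
have u2 : 0 < u ^+ 2 by rewrite exprn_gt0.
have [h|h] := leP (K * z ^+ 2) (K ^+ 3 / u ^+ 2).
  apply: (@le_trans _ _ (K ^+ 3 / u ^+ 2 * s)); first by rewrite ler_wpM2r.
  by rewrite -[leLHS]mulrA lerDr !mulr_ge0 ?exprn_ge0 ?ltW.
have Kzu : K <= z * u.
  rewrite ltr_pdivrMr// in h.
  have : K ^+ 2 < (z * u) ^+ 2.
    rewrite -(ltr_pM2l K0) (_ : K * (z * u) ^+ 2 = K * z ^+ 2 * u ^+ 2) -?exprS//.
    by ring.
  have zu0 : 0 <= z * u by rewrite mulr_ge0 ?ltW.
  by rewrite ltr_pXn2r ?nnegrE ?(ltW K0)// => /ltW.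
apply: (@le_trans _ _ (z ^+ 9 * u)).
  apply: (@le_trans _ _ (K * z ^+ 2)).
    by rewrite ler_piMr// mulr_ge0 ?exprn_ge0 ?ltW.
  apply: (@le_trans _ _ ((z * u) * z ^+ 2)); first by rewrite ler_wpM2r// exprn_ge0// ltW.
  rewrite (_ : z * u * z ^+ 2 = z ^+ 3 * u); last by ring.
  by rewrite ler_wpM2r ?(ltW u0)// ler_weXn2l.
have : 0 <= z ^+ 9 * u by rewrite mulr_ge0 ?exprn_ge0 ?ltW.
have : 0 <= K ^+ 3 * ((u ^+ 2)^-1 * s).
  apply: mulr_ge0; first by rewrite exprn_ge0// ltW.
  by apply: mulr_ge0 => //; rewrite invr_ge0 ltW.
rewrite -mulrA; move: (z ^+ 9 * u) (K ^+ 3 * _) => a b; lra.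
Qed.

(** The power 8^(9d) pays for the numerical factors, 8 in the absorption and d in the variance. *)
Lemma exp_bounds (R : realType) (c2 c3 : R) d : (0 < d)%N -> 1 <= c2 -> 1 <= c3 ->
  8 * (c2 ^+ d) ^+ 9 <= (8 * c2 * c3) ^+ (9 * d) /\
  d%:R * c2 ^+ d <= (8 * c2 * c3) ^+ (9 * d).
Proof.
move=> d0 h2 h3; have c20 : 0 <= c2 by lra.
have z9 : (c2 ^+ d) ^+ 9 = c2 ^+ (9 * d) by rewrite -exprM mulnC.
have c3' : 1 <= c3 ^+ (9 * d) by rewrite exprn_ege1.
have e8 : 8 <= 8 ^+ (9 * d) :> R.
  by rewrite -[leLHS]expr1 ler_weXn2l ?ler1n// muln_gt0.
have ed : d%:R <= 8 ^+ (9 * d) :> R.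
  rewrite -natrX ler_nat; apply: leq_trans (_ : _ <= 9 * d)%N _.
    by rewrite leq_pmull.
  by rewrite ltnW// ltn_expl.
have zz : c2 ^+ d <= c2 ^+ (9 * d) by rewrite ler_weXn2l// leq_pmull.
rewrite !exprMn z9; split.
  apply: le_trans (_ : _ <= 8 ^+ (9 * d) * c2 ^+ (9 * d)) _.
    by rewrite ler_wpM2r// exprn_ge0.
  by rewrite ler_peMr// mulr_ge0 ?exprn_ge0.
apply: le_trans (_ : _ <= 8 ^+ (9 * d) * c2 ^+ (9 * d)) _.
  by apply: ler_pM; rewrite ?exprn_ge0.
by rewrite ler_peMr// mulr_ge0 ?exprn_ge0.
Qed.

Lemma retr_influence (R : realType) m n (Q : ncpoly R m n) i :
  \sum_(S : {set 'I_m} | i \in S) fro (Q S) <= max_influence Q.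
Proof.
rewrite /max_influence; under eq_bigr do rewrite -retr_fro.
exact: (le_bigmax _ _ i).
Qed.

Theorem theorem1p4 (R : realType) (m n : nat) (m_gt0 : (0 < m)%N)
    (n_gt0 : (0 < n)%N) :
  exists C : R, 0 < C /\
  forall (d k : nat) (d_gt0 : (0 < d)%N) (k_gt0 : (0 < k)%N)
    (Q : ncpoly R m n) (degQ : ncdegree Q = d)
    (normQ : forall sigma : 'I_m -> R[i],
       (forall i, sigma i = -1 \/ sigma i = 1) ->
       opnorm (nceval Q (fun i => (sigma i)%:M)) <= 1)
    (tau_gt0 : 0 < max_influence Q)
    (calG : probability (cmx R n) R)
    (G_int : mx_integrable calG (fun g : 'M[R[i]]_n => g))
    (G_mean : mx_expectation calG (fun g : 'M[R[i]]_n => g) = 0)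
    (GG_int : mx_integrable calG (fun g : 'M[R[i]]_n => g *m g ^t*))
    (GG_mean :
       mx_expectation calG (fun g : 'M[R[i]]_n => g *m g ^t*) = 1%:M)
    (c2 c3 : R) (c2_ge1 : 1 <= c2) (c3_ge1 : 1 <= c3)
    (GG2_int : mx_integrable calG (fun g : 'M[R[i]]_n => (g *m g ^t*) ^+ 2))
    (GG2_le : opnorm
       (mx_expectation calG (fun g : 'M[R[i]]_n => (g *m g ^t*) ^+ 2)) <= c2)
    (GG3_int : mx_integrable calG (fun g : 'M[R[i]]_n => (g *m g ^t*) ^+ 3))
    (GG3_le : opnorm
       (mx_expectation calG (fun g : 'M[R[i]]_n => (g *m g ^t*) ^+ 3)) <= c3)
    (disp : measure_display) (T : measurableType disp) (P : probability T R)
    (G : 'I_m -> {RV P >-> cmx R n})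
    (H : 'I_m -> {RV P >-> cmx R (n * k)%N})
    (G_law : forall (i : 'I_m) (A : set (cmx R n)), measurable A ->
       distribution P (G i) A = calG A)
    (H_law : forall i : 'I_m, haar_unitary (distribution P (H i)))
    (GH_indep : mutually_independent P
       (fun i : 'I_m + 'I_m =>
          match i with
          | inl a => rv_events (G a)
          | inr b => rv_events (H b)
          end)),
  ('E_P[(fun w : T => n%:R^-1 *
       retr (spectral_calc (fun t : R => Num.max 0 (t - 1) ^+ 2)
         (absmx (nceval (iotapoly (n * k) Q)
            (fun i : 'I_m => ampliation k (G i w) *m H i w)))))%R]
   <= ((8 * c2 * c3) ^+ (9 * d) * n%:R `^ (1 / 2)
         * max_influence Q `^ (1 / 6)
       + C * (max_influence Q `^ (- (1 / 3))
              * (n * k)%:R `^ (- (1 / 2))))%R%:E)%E.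
Proof.
have o0 : val (Ordinal n_gt0) = 0%N by [].
pose E : R := err_const m n.
have E0 : 0 <= E by exact: err_const_ge0.
(* This is K^3 of [amgm_absorb] for K = 1 + E. The added 1 ensures K >= 1 and covers the term s / 2
   of the trace bound. *)
exists ((1 + E) ^+ 3); split; first by rewrite exprn_gt0// ltr_wpDr.
move=> d k d0 k0 Q degQ normQ tau0 calG _ _ GG_int GG_mean c2 c3 c2_ge1 c3_ge1.
move=> GG2_int GG2_le _ _ disp T P G H G_law H_law GH_indep.
set tau := max_influence Q in tau0 *.
have degQ' : (ncdegree Q <= d)%N by rewrite degQ.
have tauP := retr_influence Q; rewrite -/tau in tauP.
rewrite unlock /expectation.unlock.
pose p := (n * k)%N; have p0 : (0 < p)%N by rewrite muln_gt0 n_gt0.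
set u := tau `^ (1 / 6); have u0 : 0 < u by rewrite powR_gt0.
have u6 : u ^+ 6 = tau.
  by rewrite -powR_mulrn ?powR_ge0// -powRrM divfK// powRr1// ltW.
have u2 : tau `^ (- (1 / 3)) = (u ^+ 2)^-1.
  rewrite powRN; congr (_^-1); rewrite -powR_mulrn ?powR_ge0// -powRrM.
  by congr (_ `^ _); field.
set s := (n * k)%:R `^ (- (1 / 2)).
have pR : 0 < p%:R :> R by rewrite ltr0n.
have s0 : 0 < s by rewrite powR_gt0.
have s2 : s ^+ 2 = p%:R^-1.
  by rewrite -powR_mulrn ?powR_ge0// -powRrM mulNr divfK// powRN powRr1.
have s1 : s <= 1.
  by rewrite -(@ler_pXn2r _ 2) ?nnegrE ?(ltW s0)// s2 expr1n invf_le1// ler1n.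
have rn : 1 <= n%:R `^ (1 / 2) :> R.
  rewrite -[leLHS](powRr0 n%:R); apply: ler_powR; first by rewrite ler1n.
  by rewrite divr_ge0.
rewrite u2.
have [hB1 hB2] := exp_bounds d0 c2_ge1 c3_ge1.
set B := (8 * c2 * c3) ^+ _ in hB1 hB2 *.
set z := c2 ^+ d in hB1 hB2; have z1 : 1 <= z by rewrite exprn_ege1.
have zz : c2 ^+ (2 * d) = z ^+ 2 by rewrite /z -exprM mulnC.
have K1 : 1 <= 1 + E by rewrite lerDl.
have am := amgm_absorb K1 z1 u0 (ltW s0) s1.
have B0 : 0 <= B by rewrite exprn_ge0// !mulr_ge0//; lra.
have a1 : B * u <= B * n%:R `^ (1 / 2) * u.
  by rewrite ler_wpM2r ?(ltW u0)// ler_peMr.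
have nR : 0 < n%:R :> R by rewrite ltr0n.
have z20 : 0 <= z ^+ 2 by rewrite exprn_ge0//; lra.
pose F (w : T) : R := n%:R^-1 * retr (spectral_calc (@trunc R)
  (absmx (nceval (iotapoly (n * k) Q)
    (fun i : 'I_m => ampliation k (G i w) *m H i w)))).
(* The budget B u is split evenly: one half for the main term M, the other for the 4 z^9 u that
   [amgm_absorb] produces from the error, since 8 z^9 <= B. *)
suff [M [M1 M2]] : exists M : R, M <= 2^-1 * (B * u) /\
    (rint P F <= (M + (1 + E) * z ^+ 2 * s)%R%:E)%E.
  apply: le_trans M2 _; rewrite lee_fin.
  have h8 : 8 * (z ^+ 9 * u) <= B * u by rewrite mulrA ler_wpM2r ?(ltW u0).
  have am' : (1 + E) * z ^+ 2 * s <=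
      4 * (z ^+ 9 * u) + (1 + E) ^+ 3 * ((u ^+ 2)^-1 * s) by rewrite (mulrA 4).
  set t1 := (1 + E) * z ^+ 2 * s in am' *; set t2 := z ^+ 9 * u in h8 am'.
  set t3 := (1 + E) ^+ 3 * _ in am' *; set t4 := B * _ * u in a1 *.
  set t5 := B * u in h8 a1 M1; move: am' h8 a1 M1; clear.
  by move: t1 t2 t3 t4 t5 => *; lra.
have sp : p%:R^-1 <= s by rewrite -s2 expr2 ler_piMr// ltW.
have psE : p%:R^-1 / s = s by rewrite -s2 expr2 mulfK// gt_eqF.
have zB : 0 <= z by lra.
have nE : n%:R^-1 * 2^-1 * E <= E.
  rewrite -[leRHS]mul1r ler_wpM2r// mulr_ile1 ?invr_ge0 ?invf_le1// ?ler1n//.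
have [t1|t1] := leP tau 1.
(* M is the contribution of [rint_main], whose n cancels against the normalization. It fits because
   tau = u^6 <= u when tau <= 1. *)
- exists (2^-1 * (z * (tau * d%:R))); split.
    rewrite ler_pM2l//; have ut : tau <= u.
      have u1 : u <= 1 by rewrite -(@ler_pXn2r _ 6) ?nnegrE ?(ltW u0)// u6 expr1n.
      by rewrite -u6 -[leRHS]expr1 ler_wiXn2l// ltW.
    rewrite (_ : z * (tau * d%:R) = (d%:R * z) * tau); last by ring.
    by apply: ler_pM => //; rewrite ?mulr_ge0// ltW.
  apply: le_trans (rint_trunc_dist o0 n_gt0 k0 degQ' normQ (ltW tau0) tauP c2_ge1 GG_int
    GG_mean GG2_int GG2_le G_law H_law GH_indep) _.
  rewrite lee_fin -/E -/z -/p zz mulrDr addrC; apply: lerD.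
    rewrite le_eqVlt; apply/orP; left; apply/eqP.
    by field; rewrite gt_eqF.
  rewrite [leRHS](_ : _ = (1 + E) * (z ^+ 2 * s)); last by ring.
  rewrite [leLHS](_ : _ = n%:R^-1 * 2^-1 * E * (z ^+ 2 * p%:R^-1)); last by ring.
  apply: ler_pM; rewrite ?mulr_ge0 ?invr_ge0 ?ler_wpM2l//.
  by apply: le_trans nE _; rewrite lerDr.
(* M is the normalized trace of the main term. It fits because u >= 1 and B >= 8; the trace bound is
   used with s = p^(-1/2), for which p^(-1) / s = s. *)
- exists 1; split.
    have u1 : 1 <= u.
      rewrite leNgt; apply/negP => u1; suff : tau < 1 by rewrite ltNge (ltW t1).
      by rewrite -u6 exprn_ilt1// ltW.
    have z9 : 1 <= z ^+ 9 by rewrite exprn_ege1.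
    have B2 : 2 <= B by lra.
    have : 2 * 1 <= B * u by apply: ler_pM.
    by lra.
  apply: le_trans (rint_trunc_trace o0 n_gt0 k0 degQ' normQ c2_ge1 GG_int
    GG_mean GG2_int GG2_le G_law H_law GH_indep s0) _.
  rewrite lee_fin -/E -/p zz.
  rewrite [leLHS](_ : _ = 1 + (2^-1 * s + n%:R^-1 * 2^-1 * E * (z ^+ 2 * (p%:R^-1 / s)))).
    rewrite psE lerD2l [leRHS](_ : _ = z ^+ 2 * s + E * (z ^+ 2 * s)); last by ring.
    apply: lerD.
      have z21 : 1 <= z ^+ 2 by rewrite exprn_ege1.
      rewrite ler_wpM2r ?(ltW s0)//; apply: le_trans z21.
      by rewrite invf_le1// ler1n.
    by rewrite ler_wpM2r// mulr_ge0// ltW.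
  by field; rewrite !gt_eqF.
Qed.
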